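(* Let $n,m$ be integers with $2n\le m\le 2^n$, let $\sigma>0$, and let $A\in\mathbb{R}^{m\times n}$ be a random matrix with i.i.d. entries from $N(0,\sigma^2)$, with rows $A_1,\dots,A_m$. There exists a (randomized) algorithm that takes a point $x_0\in\mathbb{R}^n$ as input and outputs a point $x\in\mathbb{Z}^n$, obtained by rounding each coordinate of $x_0$ either up or down, such that with probability at least $1-4/m^3$, for every $i\in[m]$, \[ |\langle A_i, x-x_0\rangle|\le 480\sigma\left(\sqrt{n\log\tfrac{m}{n}}+\sqrt{\log m\,\log(mn)\,\log\tfrac{m}{\log m}}\right). \] Moreover, the algorithm runs in expected time polynomial in $n$ and $m$.
   Context: The paper does not specify the base of $\log$. *)

(* Defs.v *)
From HB Require Import structures.
From mathcomp Require Export all_boot all_order all_algebra.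
From mathcomp Require Export all_classical all_reals all_analysis.
From mathcomp Require Export measurable_realfun.

Set Implicit Arguments.
Unset Strict Implicit.
Unset Printing Implicit Defensive.

Import Order.TTheory GRing.Theory Num.Theory.

Local Open Scope classical_set_scope.
Local Open Scope ring_scope.

(* Randomized algorithms on real inputs are programs of a real RAM: exact real
   arithmetic and comparisons, natural-number registers for counting and array
   addressing, and fair coin tosses, each command taking unit time.  There are
   no real constants, no integer multiplication or division, and no way to round
   a computed real: unit-cost versions of these would make polynomial time too
   generous a notion.  Expressions are part of the (fixed) program, so
   evaluating one costs O(1) elementary operations. *)

Inductive nexp : Type :=
| NConst of nat
| NReg of nat
| NAdd of nexp & nexp
| NSub of nexp & nexp.

(* RCell a i j reads the cell of indices i, j of the two-dimensional array a. *)
Inductive rexp : Type :=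
| RNat of nexp
| RCell of nat & nexp & nexp
| RAdd of rexp & rexp
| ROpp of rexp
| RMul of rexp & rexp
| RInv of rexp.

Inductive bexp : Type :=
| BLeN of nexp & nexp
| BLeR of rexp & rexp
| BNot of bexp
| BAnd of bexp & bexp.

(* CToss x stores the next fair coin toss, as 0 or 1, in the register x. *)
Inductive cmd : Type :=
| CSkip
| CSetN of nat & nexp
| CSetR of nat & nexp & nexp & rexp
| CToss of nat
| CSeq of cmd & cmd
| CIf of bexp & cmd & cmd
| CWhile of bexp & cmd.

Section Semantics.
Variable R : realType.

Record state := State {
  nreg : nat -> nat;
  cell : nat -> nat -> nat -> R;
  tossed : nat (* number of coins tossed so far *)
}.

Fixpoint neval (s : state) (e : nexp) : nat :=
  match e with
  | NConst k => k
  | NReg x => nreg s x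
  | NAdd e1 e2 => (neval s e1 + neval s e2)%N
  | NSub e1 e2 => (neval s e1 - neval s e2)%N
  end.

Fixpoint reval (s : state) (e : rexp) : R :=
  match e with
  | RNat k => (neval s k)%:R
  | RCell a i j => cell s a (neval s i) (neval s j)
  | RAdd e1 e2 => reval s e1 + reval s e2
  | ROpp e1 => - reval s e1
  | RMul e1 e2 => reval s e1 * reval s e2
  | RInv e1 => (reval s e1)^-1
  end.

Fixpoint beval (s : state) (b : bexp) : bool :=
  match b with
  | BLeN e1 e2 => (neval s e1 <= neval s e2)%N
  | BLeR e1 e2 => reval s e1 <= reval s e2
  | BNot b1 => ~~ beval s b1
  | BAnd b1 b2 => beval s b1 && beval s b2
  end.

Definition set_nreg (s : state) (x v : nat) : state :=
  State (fun y => if y == x then v else nreg s y) (cell s) (tossed s).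

Definition set_cell (s : state) (a i j : nat) (v : R) : state :=
  State (nreg s)
    (fun b k l => if [&& b == a, k == i & l == j] then v else cell s b k l)
    (tossed s).

Definition toss (coin : nat -> bool) (s : state) (x : nat) : state :=
  let s' := set_nreg s x (coin (tossed s)) in
  State (nreg s') (cell s') (tossed s).+1.

(* The commands that remain to be executed, and the current state. *)
Definition config : Type := (seq cmd * state)%type.

Definition step (coin : nat -> bool) (c : config) : config :=
  let: (k, s) := c in
  match k with
  | [::] => c
  | CSkip :: k' => (k', s)
  | CSetN x e :: k' => (k', set_nreg s x (neval s e))
  | CSetR a i j e :: k' =>
      (k', set_cell s a (neval s i) (neval s j) (reval s e))
  | CToss x :: k' => (k', toss coin s x)
  | CSeq c1 c2 :: k' => ([:: c1, c2 & k'], s)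
  | CIf b c1 c2 :: k' => ((if beval s b then c1 else c2) :: k', s)
  | CWhile b c1 :: k' =>
      if beval s b then ([:: c1, CWhile b c1 & k'], s) else (k', s)
  end.

Section Rounding.
Variables n m : nat.

Record instance := Instance {
  inst_sigma : R;
  inst_A : 'M[R]_(m, n);
  inst_x0 : 'cV[R]_n
}.

Definition mx_cells p q (M : 'M[R]_(p, q)) (i j : nat) : R :=
  match insub i, insub j with
  | Some i', Some j' => M i' j'
  | _, _ => 0
  end.

(* Registers 0 and 1 hold n and m; arrays 0, 1, 2, 3 hold A, x0, the integer
   parts of x0, and sigma; everything else is 0.  The integer parts are supplied
   because recovering them from x0 by arithmetic and comparisons takes a number
   of steps that is unbounded in terms of n and m. *)
Definition init (I : instance) : state :=
  State
    (fun x => if x == 0%N then n else if x == 1%N then m else 0%N)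
    (fun a => match a with
       | 0 => mx_cells (inst_A I)
       | 1 => mx_cells (inst_x0 I)
       | 2 => mx_cells (map_mx (fun t => (Num.floor t)%:~R) (inst_x0 I))
       | 3 => fun i j => if (i == 0%N) && (j == 0%N) then inst_sigma I else 0
       | _ => fun _ _ => 0
       end)
    0.

Definition run (prog : cmd) (I : instance) (coin : nat -> bool) (t : nat) :
    config :=
  iter t (step coin) ([:: prog], init I).

(* The output is read off the first column of array 4. *)
Definition output (s : state) : 'cV[R]_n := \col_(j < n) cell s 4 j 0.

Definition outputs (prog : cmd) (I : instance) (coin : nat -> bool)
    (x : 'cV[R]_n) : Prop :=
  exists t s, run prog I coin t = ([::], s) /\ output s = x.

(* +oo if the program does not halt *)
Definition running_time (prog : cmd) (I : instance) (coin : nat -> bool) :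
    \bar R :=
  ereal_inf [set t%:R%:E | t in [set t | (run prog I coin t).1 = [::]]].

Definition is_rounding (x0 x : 'cV[R]_n) : Prop :=
  forall j, x j 0 = (Num.floor (x0 j 0))%:~R \/
            x j 0 = (Num.ceil (x0 j 0))%:~R.

End Rounding.
End Semantics.

Section Independence.
Context (d : measure_display) (T : measurableType d) (R : realType).
Variable P : probability T R.

Definition mutually_independent (I : eqType) (F : I -> set (set T)) : Prop :=
  forall (s : seq I) (E : I -> set T),
    uniq s -> (forall i, i \in s -> F i (E i)) ->
    P (\big[setI/setT]_(i <- s) E i) = (\prod_(i <- s) P (E i))%E.

Definition sigma_of (d' : measure_display) (U : measurableType d')
    (X : {RV P >-> U}) : set (set T) :=
  preimage_set_system setT X measurable.

Definition fair (C : {RV P >-> bool}) : Prop :=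
  P (C @^-1` [set true]) = (2^-1)%:E.

Definition gaussian (mean sd : R) (X : {RV P >-> R}) : Prop :=
  forall B : set R, measurable B -> distribution P X B = normal_prob mean sd B.

End Independence.

Definition rounding_bound (R : realType) (n m : nat) (sigma : R) : R :=
  480 * sigma *
  (Num.sqrt (n%:R * ln (m%:R / n%:R)) +
   Num.sqrt (ln m%:R * ln (m%:R * n%:R) * ln (m%:R / ln m%:R))).

(* Main.v *)
(* Coordinates that are already integral stay; the others are fixed one at a time,
   in phases of lengths about r/2, r/4, ..., where r is the number of fractional
   columns left.  A phase starts from the discrepancy vector d and a threshold T
   and steers against the excess v of d over [-T, T]: while the budget
   4 l^2 sigma^2 < 25 |v|^2 lasts, the l-th column a is rounded up exactly when
   <v, a> <= 0, and afterwards columns are rounded down.  No coins are needed, the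
   Gaussian entries are random enough: each steered column moves the discrepancy by
   sigma / sqrt(2 pi) against v on average, and the fluctuation F of a phase has
   E exp<u, F> <= exp(2 sigma^2 r |u|^2).

   Writing exp(theta x^2) as a Gaussian mixture of exponentials turns this bound
   into E prod_i (1 + k exp(theta F_i^2)) <= (1 + 2k)^m, which controls
   sum_i (|F_i| - Delta)_+^2.  With T increasing by Delta = 16 sigma S (3/4)^j in
   phase j, S = ceil sqrt(n L) and L = ceil log2(m / n), the invariant
   |excess_T(d)|_2 <= sigma r / 8 survives a phase except with probability m^-5.
   Phases see disjoint sets of independent entries, so each one may be analysed for
   a fixed starting vector.  Once r <= sqrt n, rounding down is good enough, and
   T never exceeds 64 sigma S = O(sigma sqrt(n log(m / n))).  If
   log m <= 1024 log(m / n), rounding everything down already works, by a union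
   bound. *)

From HB Require Import structures.
From mathcomp Require Import ring lra zify.
Require Import Defs.

Set Implicit Arguments.
Unset Strict Implicit.
Unset Printing Implicit Defensive.

Import Order.TTheory GRing.Theory Num.Theory.
Local Open Scope classical_set_scope.
Local Open Scope ring_scope.

(** * Independent families *)

(** A union bound over all [m] rows would cost sqrt(n log m). To reach log(m / n), a few rows must
    be allowed to pass the threshold; the excess vector measures these rows jointly, in the
    Euclidean norm, and the steering only has to correct them. The coordinates of the fluctuation
    are not independent, since all rows share the rounding decisions. Hence only linear exponential
    moments are directly accessible, and the Gaussian mixture is what turns them into a product over
    rows. The factor 25/4 of the budget is the square of 5/2, a rational stand-in for sqrt(2 pi) =
    2.5066...: steering 5|v| / (2 sigma) columns produces a drift close to -v. Under the invariant
    these are at most 5r/16 columns, fewer than the phase has. The ratio 3/4 lies between 1/sqrt 2,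
    the factor by which the deviation of a row shrinks from one phase to the next, and 1. So Delta
    grows relative to that deviation, as it must because the ratio of [m] to the columns left
    doubles, while the thresholds still form a convergent geometric series. *)

Section Decoupling.
Context (d : measure_display) (T : measurableType d) (R : realType).
Variables (P : probability T R) (I : finType) (X : I -> {RV P >-> R}).

(** Asking for the full index set is enough: [E i = setT] outside a subset gives the product formula
    for that subset. *)
Definition independent_family : Prop :=
  forall E : I -> set R, (forall i, measurable (E i)) ->
  P (\big[setI/setT]_i (X i @^-1` E i)) = (\prod_i P (X i @^-1` E i))%E.

Definition cylinders (S : {set I}) : set (set T) :=
  [set A | exists E : I -> set R,
     [/\ forall i, measurable (E i), forall i, i \notin S -> E i = setT
       & A = \big[setI/setT]_i (X i @^-1` E i)]].

(** The points of [T] with the sigma-algebra generated by the [X i], [i \in S]. As a type of its own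
    it lets [measurable_fun] express dependence on these variables alone, and products of such
    spaces can be formed. *)
Definition sub_space (S : {set I}) := g_sigma_algebraType (cylinders S).
HB.instance Definition _ S := Measurable.on (sub_space S).

Lemma setI_closed_cylinders S : setI_closed (cylinders S).
Proof.
move=> _ _ [E [mE ES ->]] [F [mF FS ->]]; exists (fun i => E i `&` F i); split.
- by move=> i; exact: measurableI.
- by move=> i iS; rewrite ES// FS// setTI.
- by rewrite -big_split/=; apply: eq_bigr => i _; rewrite preimage_setI.
Qed.

Lemma cylindersT S : cylinders S setT.
Proof.
by exists (fun=> setT); split => //; rewrite big1// => i _; rewrite preimage_setT.
Qed.

Lemma measurable_preimageX i (B : set R) : measurable B ->
  measurable (X i @^-1` B).
Proof. by move=> mB; rewrite -[X in measurable X]setTI; exact: measurable_funP. Qed.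

Lemma measurable_cylinders S : cylinders S `<=` measurable.
Proof.
move=> _ [E [mE _ ->]]; apply: bigsetI_measurable => i _.
exact: measurable_preimageX.
Qed.

Lemma sub_space_measurable S (A : set T) :
  <<s cylinders S >> A -> measurable A.
Proof.
apply: (smallest_sub (sigma_algebra_measurable T)).
exact: measurable_cylinders.
Qed.

Lemma measurable_sub_space (S : {set I}) i : i \in S ->
  measurable_fun setT (X i : sub_space S -> R).
Proof.
move=> iS _ B mB; rewrite setTI; apply: sub_sigma_algebra.
exists (fun j => if j == i then B else setT); split.
- by move=> j; case: ifP.
- by move=> j jS; case: eqP => // ji; rewrite ji iS in jS.
- rewrite (bigD1 i)//= eqxx big1 ?setIT// => j /negbTE ->.
  by rewrite preimage_setT.
Qed.

Lemma measurable_from_sub_space S d' (U : measurableType d') (f : T -> U) :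
  measurable_fun setT (f : sub_space S -> U) -> measurable_fun setT f.
Proof.
by move=> mf mT B mB; apply: (@sub_space_measurable S); exact: (mf measurableT B mB).
Qed.

(** The distribution of this identity map is [P] restricted to the smaller sigma-algebra. *)
Definition coarsen S : T -> sub_space S := id.

Lemma measurable_coarsen S : measurable_fun setT (coarsen S).
Proof. by move=> mT B mB; rewrite setTI; exact: (@sub_space_measurable S). Qed.

HB.instance Definition _ S :=
  isMeasurableFun.Build _ _ _ _ (coarsen S) (@measurable_coarsen S).

Hypothesis indepX : independent_family.

Lemma indep_cylinders (S1 S2 : {set I}) A B : [disjoint S1 & S2]%B ->
  cylinders S1 A -> cylinders S2 B -> P (A `&` B) = (P A * P B)%E.
Proof.
move=> dS [E [mE ES ->]] [F [mF FS ->]].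
have -> : (\big[setI/setT]_i (X i @^-1` E i)) `&`
    (\big[setI/setT]_i (X i @^-1` F i)) =
    \big[setI/setT]_i (X i @^-1` (E i `&` F i)).
  by rewrite -big_split/=; apply: eq_bigr => i _; rewrite preimage_setI.
rewrite !indepX//; last by move=> i; exact: measurableI.
rewrite -big_split/=; apply: eq_bigr => i _.
have [iS|iS] := boolP (i \in S1).
  by rewrite (FS i) ?setIT ?preimage_setT ?probability_setT ?mule1//
     (disjointFr dS).
by rewrite (ES i)// setTI preimage_setT probability_setT mul1e.
Qed.

(** As functions of [A], both sides are finite measures that agree on the pi-system [G], hence on
    what it generates. Used once per factor, this extends independence from cylinders to
    sigma-algebras. *)
Lemma sigma_indep (G : set (set T)) (B : set T) :
  G `<=` measurable -> setI_closed G -> G setT -> measurable B ->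
  (forall A, G A -> P (A `&` B) = (P A * P B)%E) ->
  forall A, <<s G >> A -> P (A `&` B) = (P A * P B)%E.
Proof.
move=> Gm GI GT mB GB A sA.
have PB0 : 0 <= fine (P B) by rewrite fine_ge0.
have PBE : P B = (fine (P B))%:E by rewrite fineK// fin_num_measure.
have := @g_sigma_algebra_measure_unique _ R T G Gm (fun=> setT) (fun=> GT)
  _ (mrestr P mB) (mscale (NngNum PB0) P) GI.
move=> /(_ _ _ _ A sA); rewrite /= /mrestr /mscale/= -PBE muleC; apply.
- by rewrite bigcup_const//; exists 0%N.
- by move=> C GC; rewrite GB// muleC.
- by move=> _; rewrite setTI; rewrite ltey_eq fin_num_measure.
Qed.

Lemma indep_sub_space (S1 S2 : {set I}) A B : [disjoint S1 & S2]%B ->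
  <<s cylinders S1 >> A -> <<s cylinders S2 >> B ->
  P (A `&` B) = (P A * P B)%E.
Proof.
move=> dS sA sB; apply: (@sigma_indep (cylinders S1)) => //.
- exact: measurable_cylinders.
- exact: setI_closed_cylinders.
- exact: cylindersT.
- exact: (@sub_space_measurable S2).
move=> {sA}A cA; rewrite setIC muleC.
apply: (@sigma_indep (cylinders S2)) => //.
- exact: measurable_cylinders.
- exact: setI_closed_cylinders.
- exact: cylindersT.
- exact: (@measurable_cylinders S1).
by move=> C cC; rewrite setIC muleC; exact: indep_cylinders dS cA cC.
Qed.

Lemma integral_coarsen S (f : T -> \bar R) :
  measurable_fun setT (f : sub_space S -> \bar R) -> (forall w, 0 <= f w)%E ->
  (\int[distribution P (coarsen S)]_w f w = \int[P]_w f w)%E.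
Proof. by move=> mf f0; rewrite ge0_integral_distribution. Qed.

(** The diagonal map into the product of the two coarser spaces has the product law, because it does
    so on rectangles; Tonelli then separates the two copies of [w]. This is how the past is frozen
    while fresh columns are averaged. *)
Lemma decoupling (S1 S2 : {set I}) (h : T -> T -> \bar R) :
  [disjoint S1 & S2]%B ->
  measurable_fun setT
    ((fun w => h w.1 w.2) : sub_space S1 * sub_space S2 -> \bar R) ->
  (forall w1 w2, 0 <= h w1 w2)%E ->
  (\int[P]_w h w w = \int[P]_w1 \int[P]_w2 h w1 w2)%E.
Proof.
move=> dS mh h0.
pose T1 := sub_space S1; pose T2 := sub_space S2.
pose P1 := distribution P (coarsen S1); pose P2 := distribution P (coarsen S2).
pose dg : T -> (T1 * T2)%type := fun w => (coarsen S1 w, coarsen S2 w).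
have mdg : measurable_fun setT dg.
  by apply: measurable_fun_pair; exact: measurable_coarsen.
pose DG : {mfun T >-> (T1 * T2)%type} := HB.pack dg
  (isMeasurableFun.Build _ _ _ _ dg mdg).
transitivity (\int[distribution P DG]_w h w.1 w.2)%E.
  by rewrite ge0_integral_distribution.
transitivity (\int[(P1 \x P2)%E]_w h w.1 w.2)%E.
  apply: eq_measure_integral => A mA _; apply/esym.
  apply: product_measure_unique => // B C mB mC.
  exact: indep_sub_space dS mB mC.
rewrite fubini_tonelli1//.
have mh1 (w1 : T1) :
    measurable_fun setT ((fun w2 => h w1 w2) : T2 -> \bar R).
  have mp : measurable_fun setT (fun w2 : T2 => (w1, w2)).
    by apply: measurable_fun_pair; [exact: measurable_cst|exact: measurable_id].
  exact: (measurableT_comp mh mp).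
rewrite /fubini_F/=; under eq_integral do rewrite integral_coarsen//.
rewrite integral_coarsen//; last first.
  by move=> w; apply: integral_ge0.
have := measurable_fun_fubini_tonelli_F (m2 := P2)
  ((fun w => h w.1 w.2) : T1 * T2 -> \bar R) mh (fun w => h0 _ _).
congr measurable_fun; apply/funext => w; rewrite /fubini_F/=.
exact: integral_coarsen.
Qed.

Lemma ge0_integral_indepM (S1 S2 : {set I}) (f g : T -> \bar R) :
  [disjoint S1 & S2]%B ->
  measurable_fun setT (f : sub_space S1 -> \bar R) ->
  measurable_fun setT (g : sub_space S2 -> \bar R) ->
  (forall w, 0 <= f w)%E -> (forall w, 0 <= g w)%E ->
  (\int[P]_w (f w * g w) = \int[P]_w f w * \int[P]_w g w)%E.
Proof.
move=> dS mf mg f0 g0.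
rewrite (decoupling (h := fun w1 w2 => f w1 * g w2)%E dS)//; last 2 first.
- apply: emeasurable_funM.
  + exact: (measurableT_comp mf measurable_fst).
  + exact: (measurableT_comp mg measurable_snd).
- by move=> w1 w2; rewrite mule_ge0.
have mg' := measurable_from_sub_space mg.
under eq_integral do rewrite ge0_integralZl//.
rewrite ge0_integralZr//; first exact: (measurable_from_sub_space mf).
exact: integral_ge0.
Qed.

End Decoupling.

(** * Gaussian integrals *)

Section Affine.
Variable R : realType.
Notation mu := (@lebesgue_measure R).

(** Weighted by |a|, the image of Lebesgue measure under the affine map agrees with Lebesgue measure
    on half-open intervals. For negative [a] the preimage is closed at the other end, which does not
    affect its length. *)
Lemma lebesgue_integral_affine (a b : R) (f : R -> \bar R) : a != 0 ->
  measurable_fun setT f -> (forall x, 0 <= f x)%E ->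
  (\int[mu]_x f x = `|a|%:E * \int[mu]_x f (a * x + b)%R)%E.
Proof.
move=> a0 mf f0.
pose phi : measurableTypeR R -> measurableTypeR R := fun x => a * x + b.
have mphi : measurable_fun setT phi.
  by apply: measurable_funD => //; exact: mulrl_measurable.
pose nu := mscale (NngNum (normr_ge0 a))
  (measure_function_pushforward__canonical__measure_function_Measure mu mphi).
have nuE (A : set R) : measurable A -> mu A = nu A.
  apply: lebesgue_measure_unique => _ [[x y] _ <-].
  change (mu `]x, y] = `|a|%:E * mu (phi @^-1` `]x, y]))%E.
  have [xy|yx] := leP y x.
    rewrite set_itv_ge -?leNgt// preimage_set0 !measure0 mule0//.
  have [ap|an] : a > 0 \/ a < 0 by case: ltgtP a0; auto.
    have -> : phi @^-1` `]x, y]%classic = `](x - b) / a, (y - b) / a]%classic.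
      apply/seteqP; split => z /=; rewrite !in_itv/= /phi => /andP[h1 h2];
        apply/andP; split.
      - by rewrite ltr_pdivrMr// ltrBlDr mulrC.
      - by rewrite ler_pdivlMr// lerBrDr mulrC.
      - by move: h1; rewrite ltr_pdivrMr// ltrBlDr mulrC.
      - by move: h2; rewrite ler_pdivlMr// lerBrDr mulrC.
    rewrite !lebesgue_measure_itv/= !lte_fin ltr_pM2r ?invr_gt0// ltrD2r yx.
    rewrite -!EFinB -EFinM gtr0_norm//; congr EFin.
    by field.
  have -> : phi @^-1` `]x, y]%classic = `[(y - b) / a, (x - b) / a[%classic.
    apply/seteqP; split => z /=; rewrite !in_itv/= /phi => /andP[h1 h2];
      apply/andP; split.
    - by rewrite ler_ndivrMr// lerBrDr mulrC.
    - by rewrite ltr_ndivlMr// ltrBlDr mulrC.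
    - by move: h2; rewrite ltr_ndivlMr// ltrBlDr mulrC.
    - by move: h1; rewrite ler_ndivrMr// lerBrDr mulrC.
  rewrite !lebesgue_measure_itv/= !lte_fin ltr_nM2r ?invr_lt0// ltrD2r yx.
  rewrite -!EFinB -EFinM ltr0_norm//; congr EFin.
  by field.
transitivity (\int[nu]_x f x)%E.
  by apply: eq_measure_integral => A mA _; exact: nuE.
rewrite ge0_integral_mscale//=; congr (_ * _)%E.
by rewrite ge0_integral_pushforward.
Qed.

End Affine.

Section NormalIntegrals.
Variable R : realType.
Notation mu := (@lebesgue_measure R).
Implicit Types (psi : R -> \bar R).

(** The mean of [psi] under the normal law of mean [b] and variance [V]; variances are used because
    they add. The case [V = 0] is the point mass, where inductions on the number of summands
    start. *)
Definition normal_mean (psi : R -> \bar R) (b V : R) : \bar R :=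
  if V == 0 then psi b else (\int[mu]_z (psi z * (normal_pdf b (Num.sqrt V) z)%:E))%E.

Lemma normal_mean_ge0 psi b V : (forall x, 0 <= psi x)%E ->
  (0 <= normal_mean psi b V)%E.
Proof.
move=> p0; rewrite /normal_mean; case: ifP => // _.
by apply: integral_ge0 => x _; rewrite mule_ge0// lee_fin normal_pdf_ge0.
Qed.

Lemma normal_peakE (s : R) : 0 < s -> normal_peak s = s^-1 * normal_peak 1.
Proof.
move=> s0; rewrite /normal_peak expr1n mul1r -mulrnAr sqrtrM ?sqr_ge0//.
by rewrite sqrtr_sqr gtr0_norm// invfM.
Qed.

(** Completing the square: an exponential weight is a shift of the mean, up to a constant factor. *)
Lemma normal_pdf_tilt (s u x : R) : 0 < s ->
  expR (u * x) * normal_pdf 0 s x =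
  expR (s ^+ 2 * u ^+ 2 / 2) * normal_pdf (s ^+ 2 * u) s x.
Proof.
move=> s0; rewrite !normal_pdfE ?gt_eqF// /normal_fun.
rewrite !(mulrCA _ (normal_peak s)) -!expRD; congr (_ * expR _).
by field; rewrite gt_eqF.
Qed.

(** Bayes' formula for a normal [x] and [z] equal to [b + v * x] plus independent noise: likelihood
    times prior is the marginal density of [z] times the posterior density of [x], and the latter
    integrates to 1. *)
Lemma normal_pdf_convolve (s t v b c x z : R) : 0 < s -> 0 < t ->
  normal_pdf (b + v * x) t z * normal_pdf c s x =
  normal_pdf (b + v * c) (Num.sqrt (t ^+ 2 + v ^+ 2 * s ^+ 2)) z *
  normal_pdf ((c * t ^+ 2 + v * s ^+ 2 * (z - b)) / (t ^+ 2 + v ^+ 2 * s ^+ 2))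
     (s * t / Num.sqrt (t ^+ 2 + v ^+ 2 * s ^+ 2)) x.
Proof.
move=> s0 t0.
have w0 : 0 < t ^+ 2 + v ^+ 2 * s ^+ 2.
  by rewrite ltr_pwDl ?exprn_gt0// mulr_ge0// sqr_ge0.
set w := t ^+ 2 + v ^+ 2 * s ^+ 2 in w0 *.
have sw0 : 0 < Num.sqrt w by rewrite sqrtr_gt0.
have sw2 : Num.sqrt w ^+ 2 = w by rewrite sqr_sqrtr// ltW.
rewrite !normal_pdfE ?gt_eqF ?divr_gt0 ?mulr_gt0//.
rewrite mulrACA [RHS]mulrACA; congr (_ * _).
  rewrite (normal_peakE s0) (normal_peakE t0) (normal_peakE sw0).
  rewrite (@normal_peakE (s * t / _)) ?divr_gt0 ?mulr_gt0//.
  by field; rewrite !gt_eqF.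
rewrite /normal_fun -!expRD; congr expR.
have : s != 0 by rewrite gt_eqF.
have : t != 0 by rewrite gt_eqF.
have : w != 0 by rewrite gt_eqF.
rewrite !expr_div_n sw2 /w => wn tn sn; field.
by rewrite exprMn wn tn sn.
Qed.

Lemma measurable_normal_pdf2 (s : R) d (U : measurableType d) (f g : U -> R) :
  0 < s -> measurable_fun setT f -> measurable_fun setT g ->
  measurable_fun setT (fun x => normal_pdf (f x) s (g x)).
Proof.
move=> s0 mf mg.
rewrite (_ : (fun x => _) = (fun x => normal_pdf 0 s (g x - f x))); last first.
  by apply/funext => x; rewrite !normal_pdfE ?gt_eqF// /normal_fun subr0.
apply: (measurableT_comp (measurable_normal_pdf 0 s)).
exact: measurable_funB.
Qed.

(** Adding an independent Gaussian term adds means and variances. The generic case is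
    [normal_pdf_convolve] with Tonelli; if [v] or [V] vanishes, only one Gaussian is left and no
    convolution takes place. *)
Lemma normal_mean_mix psi (b c v V s : R) : 0 < s -> 0 <= V ->
  measurable_fun setT psi -> (forall x, 0 <= psi x)%E ->
  (\int[mu]_x (normal_mean psi (b + v * x) V * (normal_pdf c s x)%:E) =
   normal_mean psi (b + v * c) (V + v ^+ 2 * s ^+ 2))%E.
Proof.
move=> s0 V0 mpsi p0.
have mpdf c' s' : measurable_fun setT (fun x => (normal_pdf c' s' x)%:E : \bar R).
  by apply/measurable_EFinP; exact: measurable_normal_pdf.
have [->|v0] := eqVneq v 0.
  under eq_integral do rewrite mul0r addr0.
  rewrite ge0_integralZl//; first last.
  - exact: normal_mean_ge0.
  - by move=> x _; rewrite lee_fin normal_pdf_ge0.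
  - exact: mpdf.
  by rewrite integral_normal_pdf mule1 expr0n/= !mul0r !addr0.
have w0 : 0 < v ^+ 2 * s ^+ 2.
  by rewrite mulr_gt0 ?exprn_even_gt0//= gt_eqF.
move: V0; rewrite le_eqVlt => /predU1P[<-|V0].
  rewrite add0r /normal_mean eqxx (gt_eqF w0).
  rewrite [RHS](@lebesgue_integral_affine R v b)//; first last.
  - by move=> x; rewrite mule_ge0// lee_fin normal_pdf_ge0.
  - by apply: emeasurable_funM => //; exact: mpdf.
  rewrite -ge0_integralZl//; first last.
  - by move=> x _; rewrite mule_ge0// lee_fin normal_pdf_ge0.
  - apply: emeasurable_funM.
      by apply: (measurableT_comp mpsi); apply: measurable_funD.
    apply/measurable_EFinP; apply: measurable_normal_pdf2 => //.
      by rewrite sqrtr_gt0.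
    exact: measurable_funD.
  apply: eq_integral => x _; rewrite muleCA [b + _]addrC; congr (_ * _)%E.
  rewrite -EFinM; congr EFin.
  have sn : s != 0 by rewrite gt_eqF.
  rewrite !normal_pdfE ?gt_eqF ?sqrtr_gt0// /normal_fun sqr_sqrtr ?ltW//.
  rewrite mulrA; congr (_ * expR _); last by field; rewrite ?sn ?v0.
  rewrite (normal_peakE s0) (@normal_peakE (Num.sqrt _)) ?sqrtr_gt0// sqrtrM ?sqr_ge0//
    !sqrtr_sqr (gtr0_norm s0).
  by field; rewrite sn normr_eq0.
rewrite /normal_mean (gt_eqF V0) (gt_eqF (addr_gt0 V0 w0)).
set t := Num.sqrt V; have t0 : 0 < t by rewrite sqrtr_gt0.
have tV : t ^+ 2 = V by rewrite sqr_sqrtr// ltW.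
pose w := Num.sqrt (t ^+ 2 + v ^+ 2 * s ^+ 2).
pose q z x := normal_pdf ((c * t ^+ 2 + v * s ^+ 2 * (z - b)) /
  (t ^+ 2 + v ^+ 2 * s ^+ 2)) (s * t / w) x.
have w1 : 0 < s * t / w.
  by rewrite divr_gt0 ?mulr_gt0// sqrtr_gt0 tV addr_gt0.
have mA : measurable_fun setT (fun xz : measurableTypeR R * measurableTypeR R =>
    (psi xz.2 * (normal_pdf (b + v * xz.1) t xz.2)%:E *
      (normal_pdf c s xz.1)%:E)%E).
  apply: emeasurable_funM; first apply: emeasurable_funM.
  - exact: (measurableT_comp mpsi measurable_snd).
  - apply/measurable_EFinP; apply: measurable_normal_pdf2 => //.
    apply: measurable_funD => //; apply: measurable_funM => //.
  - by apply/measurable_EFinP; apply: measurable_normal_pdf2.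
transitivity (\int[mu]_x \int[mu]_z (psi z * (normal_pdf (b + v * x) t z)%:E *
      (normal_pdf c s x)%:E))%E.
  apply: eq_integral => x _; rewrite ge0_integralZr//.
  - apply: emeasurable_funM; first exact: mpsi.
    exact: mpdf.
  - by move=> z _; rewrite mule_ge0// lee_fin normal_pdf_ge0.
  - by rewrite lee_fin normal_pdf_ge0.
rewrite (@fubini_tonelli _ _ _ _ R mu mu (fun xz : measurableTypeR R * measurableTypeR R =>
    (psi xz.2 * (normal_pdf (b + v * xz.1) t xz.2)%:E *
      (normal_pdf c s xz.1)%:E)%E))//; last first.
  by move=> x; rewrite !mule_ge0// lee_fin normal_pdf_ge0.
apply: eq_integral => z _ /=.
transitivity (\int[mu]_x (psi z * (normal_pdf (b + v * c) w z)%:E *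
  (q z x)%:E))%E.
  apply: eq_integral => x _; rewrite -!muleA -!EFinM; congr (_ * _%:E)%E.
  exact: normal_pdf_convolve.
rewrite ge0_integralZl//.
- by rewrite integral_normal_pdf mule1 /w tV.
- exact: mpdf.
- by move=> x _; rewrite lee_fin normal_pdf_ge0.
- by rewrite mule_ge0// lee_fin normal_pdf_ge0.
Qed.

End NormalIntegrals.

Lemma measurable_boolR (R : realType) d (U : measurableType d) (b : U -> bool) :
  measurable_fun setT b -> measurable_fun setT (fun x => (b x)%:R : R).
Proof.
move=> mb; rewrite (_ : (fun x => _) = (fun x => if b x then 1 else 0 : R)).
  exact: measurable_fun_ifT.
by apply/funext => x; case: (b x).
Qed.

(** * One-sided Gaussian probabilities and the resulting rounding estimate *)

Section NormalProb.
Variable R : realType.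
Notation mu := (@lebesgue_measure R).

(** [normal_prob] is defined on sets by integrating the density, so the density is almost everywhere
    its Radon-Nikodym derivative. *)
Lemma integral_normal_prob (c s : R) (f : R -> \bar R) :
  measurable_fun setT f -> (forall x, 0 <= f x)%E ->
  (\int[normal_prob c s]_x f x = \int[mu]_x (f x * (normal_pdf c s x)%:E))%E.
Proof.
move=> mf f0.
have mpdf : measurable_fun setT (fun x => (normal_pdf c s x)%:E).
  by apply/measurable_EFinP; exact: measurable_normal_pdf.
have dom := normal_prob_dominates c s.
rewrite -(Radon_Nikodym_SigmaFinite.change_of_variables dom)//.
apply: ae_eq_integral => //.
- apply: emeasurable_funM => //.
  exact: measurable_int (Radon_Nikodym_SigmaFinite.f_integrable dom).
- exact: emeasurable_funM.
apply: ae_eqe_mul2l; apply: integral_ae_eq => //.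
- exact: Radon_Nikodym_SigmaFinite.f_integrable dom.
- by move=> A _ mA; rewrite -Radon_Nikodym_SigmaFinite.f_integral.
Qed.

Notation Q := (normal_prob (0 : R) 1).
Notation phi0 := (normal_peak (1 : R)).

Lemma normal_pdf01 (x : R) : normal_pdf 0 1 x = phi0 * expR (- x ^+ 2 / 2).
Proof.
by rewrite normal_pdfE ?oner_eq0// /normal_fun subr0 expr1n.
Qed.

Lemma mpdf01 (D : set R) : measurable_fun D (fun x => (normal_pdf 0 1 x)%:E).
Proof.
by apply: measurable_funTS; apply/measurable_EFinP; exact: measurable_normal_pdf.
Qed.

Lemma normal_prob_set1 (t : R) : Q [set t] = 0%E.
Proof. exact: integral_set1. Qed.

(** From 2 <= pi < 4, the number sqrt(2 pi) lies between 2 and 3. *)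
Lemma normal_peak_bounds : 1 / 3 <= phi0 <= 1 / 2.
Proof.
have p2 := pi_ge2 R; have p4 : pi < 4 :> R.
  by have := pihalf_lt2 R; rewrite ltr_pdivrMr// -natrM.
rewrite /normal_peak expr1n !mul1r; set q := Num.sqrt _.
have q2 : q ^+ 2 = pi *+ 2 by rewrite sqr_sqrtr// mulrn_wge0// pi_ge0.
have q0 : 0 < q by rewrite sqrtr_gt0 mulrn_wgt0// pi_gt0.
rewrite !lef_pV2 ?posrE//.
by apply/andP; split; nra.
Qed.

Lemma normal_prob_half : (Q `]0%R, +oo[ <= (1 / 2)%:E)%E.
Proof.
have QE : Q `]0%R, +oo[ = Q `]-oo, 0%R[.
  rewrite /normal_prob integral_mkcond [RHS]integral_mkcond.
  rewrite (@lebesgue_integral_affine R (-1) 0) ?oppr_eq0 ?oner_eq0//.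
  - rewrite normrN1 mul1e; apply: eq_integral => x _.
    rewrite mulN1r addr0 /patch !mem_setE !in_itv/= andbT oppr_gt0.
    by case: ifP => // _; rewrite !normal_pdf01 sqrrN.
  - by apply/(measurable_restrictT _ _).1 => //; exact: mpdf01.
  - by move=> x; rewrite /patch; case: ifP => // _; rewrite lee_fin normal_pdf_ge0.
have : (Q `]0%R, +oo[ + Q `]-oo, 0%R[ <= 1)%E.
  rewrite -measureU//; first by apply: probability_le1; exact: measurableU.
  apply/seteqP; split => // x [] /=; rewrite !in_itv/= andbT => h1 h2.
  by have := lt_trans h1 h2; rewrite ltxx.
rewrite -QE; have : Q `]0%R, +oo[ \is a fin_num by exact: fin_num_measure.
case: (Q _) => // r _; rewrite -EFinD !lee_fin; lra.
Qed.

(** Near 0 the mass between 0 and [t] is [phi0 * t] up to the curvature of the density, and the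
    quadratic term covers this error for both signs of [t]; beyond 1 it outweighs the linear term. A
    quadratic bound is easily turned into an exponential one later. *)
Lemma normal_prob_tail (t : R) :
  (Q `[t, +oo[ <= (1 / 2 - phi0 * t + phi0 * t ^+ 2)%:E)%E.
Proof.
have /andP[p1 p2] := normal_peak_bounds.
have fQ (A : set R) : measurable A -> Q A \is a fin_num.
  by move=> mA; exact: fin_num_measure.
have -> : Q `[t, +oo[ = Q `]t, +oo[.
  rewrite -(@setU1itv _ _ _ _ false)// measureU//.
    by rewrite [X in (X + _)%E](_ : _ = 0%E) ?add0e//; exact: normal_prob_set1.
  by apply/seteqP; split => // x [/= ->]; rewrite in_itv/= ltxx.
have half := normal_prob_half.
have [t0|t0] := leP 0 t.
  have : (Q `]0%R, +oo[ = Q `]0%R, t] + Q `]t, +oo[)%E.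
    rewrite -measureU//.
      by congr Q; rewrite -itv_bndbnd_setU// bnd_simp.
    apply/seteqP; split => // x [] /=; rewrite !in_itv/= andbT => /andP[_ h1] h2.
    by have := le_lt_trans h1 h2; rewrite ltxx.
  have lb : ((phi0 * expR (- t ^+ 2 / 2) * t)%:E <= Q `]0%R, t])%E.
    have -> : (phi0 * expR (- t ^+ 2 / 2) * t)%:E =
        (\int[mu]_(x in `]0%R, t]) (phi0 * expR (- t ^+ 2 / 2))%:E)%E.
      rewrite integral_cst//= lebesgue_measure_itv/= lte_fin.
      case: ltP => tt; first by rewrite oppr0 adde0.
      have -> : t = 0 by apply/le_anti; rewrite tt t0.
      by rewrite mulr0 mule0.
    apply: ge0_le_integral => //.
    - by move=> x _; rewrite lee_fin mulr_ge0 ?expR_ge0//; lra.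
    - exact: mpdf01.
    - move=> x /=; rewrite in_itv/= => /andP[x0 xt].
      rewrite lee_fin normal_pdf01 ler_wpM2l ?ler_expR; [lra| |].
        by lra.
      by nra.
  move: half lb; case: (Q `]0%R, +oo[) (fQ `]0%R, +oo[%classic (measurable_itv _)) => // a _.
  case: (Q `]0%R, t]) (fQ `]0%R, t]%classic (measurable_itv _)) => // b _.
  case: (Q `]t, +oo[) (fQ `]t, +oo[%classic (measurable_itv _)) => // c _.
  rewrite -EFinD !lee_fin => ah lb [abc].
  have c1 : c = a - b by rewrite abc addrAC subrr add0r.
  have e0 := expR_gt0 (- t ^+ 2 / 2 : R).
  have [t1|t1] := leP t 1.
    have := expR_ge1Dx (- t ^+ 2 / 2 : R); set e := expR _ in lb e0 * => eb.
    have : phi0 * (1 - t ^+ 2 / 2) * t <= b.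
      apply: le_trans lb; apply: ler_wpM2r => //; apply: ler_wpM2l; first lra.
      by apply: le_trans eb; lra.
    have : phi0 * t ^+ 3 <= phi0 * t ^+ 2.
      by apply: ler_wpM2l; [lra|rewrite exprS ler_piMl ?sqr_ge0].
    have := mulr_ge0 (normal_peak_ge0 (1 : R)) (sqr_ge0 t).
    rewrite c1; set p := phi0 in p1 p2 *.
    have -> : p * (1 - t ^+ 2 / 2) * t = p * t - p * t ^+ 3 / 2 by ring.
    lra.
  have b0 : 0 <= b by apply: le_trans lb; rewrite !mulr_ge0//; lra.
  have : phi0 * t <= phi0 * t ^+ 2.
    by apply: ler_wpM2l; [lra|rewrite expr2 ler_peMl// ltW].
  rewrite c1; lra.
have : (Q `]t, +oo[ = Q `]t, 0%R] + Q `]0%R, +oo[)%E.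
  rewrite -measureU//.
    by congr Q; rewrite -itv_bndbnd_setU// bnd_simp ?ltW.
  apply/seteqP; split => // x [] /=; rewrite !in_itv/= andbT => /andP[_ h1] h2.
  by have := le_lt_trans h1 h2; rewrite ltxx.
have ub : (Q `]t, 0%R] <= (phi0 * - t)%:E)%E.
  have -> : (phi0 * - t)%:E = (\int[mu]_(x in `]t, 0%R]) phi0%:E)%E.
    by rewrite integral_cst//= lebesgue_measure_itv/= lte_fin t0 add0e.
  apply: ge0_le_integral => //.
  - by move=> x _; rewrite lee_fin normal_pdf_ge0.
  - exact: mpdf01.
  - by move=> x _; rewrite lee_fin normal_pdf_ub ?oner_eq0.
move: half ub; case: (Q `]0%R, +oo[) (fQ `]0%R, +oo[%classic (measurable_itv _)) => // a _.
case: (Q `]t, 0%R]) (fQ `]t, 0%R]%classic (measurable_itv _)) => // b _.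
case: (Q `]t, +oo[) (fQ `]t, +oo[%classic (measurable_itv _)) => // c _.
rewrite -EFinD !lee_fin => ah lb [abc].
have := mulr_ge0 (normal_peak_ge0 (1 : R)) (sqr_ge0 t); lra.
Qed.

Lemma normal_mean_gt0 (b V : R) : 0 < V ->
  (normal_mean (fun z => ((0 < z)%R%:R : R)%:E) b V =
   Q `](- b / Num.sqrt V)%R, +oo[)%E.
Proof.
move=> V0; set s := Num.sqrt V; have s0 : 0 < s by rewrite sqrtr_gt0.
rewrite /normal_mean gt_eqF// (@lebesgue_integral_affine R s b) ?gt_eqF//.
- rewrite -ge0_integralZl//.
  + rewrite /normal_prob [RHS]integral_mkcond; apply: eq_integral => x _.
    rewrite /patch mem_setE in_itv/= andbT ltr_pdivrMr// -/s.
    rewrite (_ : (- b < x * s) = (0 < x * s + b)); last first.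
      by rewrite -subr_gt0 opprK.
    rewrite [s * x]mulrC; case: ifP => _; last by rewrite mul0e mule0.
    rewrite mul1e -EFinM normal_pdf01 normal_pdfE ?gt_eqF// /normal_fun.
    rewrite (normal_peakE s0) gtr0_norm// addrK; congr EFin.
    rewrite !mulrA divff ?mul1r ?gt_eqF//; congr (_ * expR _).
    by field; rewrite gt_eqF.
  + apply: emeasurable_funM; apply/measurable_EFinP.
      apply: measurable_boolR; apply: measurable_fun_ltr => //.
      exact: measurable_funD.
    by apply: measurable_normal_pdf2 => //; exact: measurable_funD.
  + by move=> x _; rewrite mule_ge0 ?lee_fin ?normal_pdf_ge0.
- apply: emeasurable_funM; apply/measurable_EFinP; last exact: measurable_normal_pdf.
  by apply: measurable_boolR; apply: measurable_fun_ltr.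
- by move=> x; rewrite mule_ge0 ?lee_fin ?normal_pdf_ge0.
Qed.

Lemma normal_mean_le0 (b V : R) : 0 < V ->
  (normal_mean (fun z => ((z <= 0)%R%:R : R)%:E) b V =
   Q `[(b / Num.sqrt V)%R, +oo[)%E.
Proof.
move=> V0; set s := Num.sqrt V; have s0 : 0 < s by rewrite sqrtr_gt0.
have sn : s != 0 by rewrite gt_eqF.
(* Scaling by [- s] turns the half-line [z <= 0] into a right tail. *)
rewrite /normal_mean gt_eqF// (@lebesgue_integral_affine R (- s) b) ?oppr_eq0//.
- rewrite -ge0_integralZl//.
  + rewrite /normal_prob [RHS]integral_mkcond; apply: eq_integral => x _.
    rewrite /patch mem_setE in_itv/= andbT ler_pdivrMr// mulNr addrC subr_le0 -/s.
    rewrite [s * x]mulrC; case: ifP => _; last by rewrite mul0e mule0.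
    rewrite mul1e -EFinM normal_pdf01 normal_pdfE ?gt_eqF// /normal_fun.
    rewrite (normal_peakE s0) normrN gtr0_norm//; congr EFin.
    rewrite !mulrA divff ?mul1r ?gt_eqF//; congr (_ * expR _).
    by field; rewrite gt_eqF.
  + apply: emeasurable_funM; apply/measurable_EFinP.
      apply: measurable_boolR; apply: measurable_fun_ler => //.
      exact: measurable_funD.
    by apply: measurable_normal_pdf2 => //; exact: measurable_funD.
  + by move=> x _; rewrite mule_ge0 ?lee_fin ?normal_pdf_ge0.
- apply: emeasurable_funM; apply/measurable_EFinP; last exact: measurable_normal_pdf.
  by apply: measurable_boolR; apply: measurable_fun_ler.
- by move=> x; rewrite mule_ge0 ?lee_fin ?normal_pdf_ge0.
Qed.

Lemma normal_mean_gt0_le (b V : R) : 0 < V ->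
  (normal_mean (fun z => ((0 < z)%R%:R : R)%:E) (- b) V <=
   (1 / 2 - phi0 * (b / Num.sqrt V) + phi0 * (b / Num.sqrt V) ^+ 2)%:E)%E.
Proof.
move=> V0; rewrite normal_mean_gt0// opprK.
apply: le_trans (normal_prob_tail _); apply: le_measure; rewrite ?inE//.
by move=> x /=; rewrite !in_itv/= !andbT => /ltW.
Qed.

Lemma normal_mean_le0_le (b V : R) : 0 < V ->
  (normal_mean (fun z => ((z <= 0)%R%:R : R)%:E) b V <=
   (1 / 2 - phi0 * (b / Num.sqrt V) + phi0 * (b / Num.sqrt V) ^+ 2)%:E)%E.
Proof. by move=> V0; rewrite normal_mean_le0//; exact: normal_prob_tail. Qed.

Lemma measurable_normal_mean d (U : measurableType d) (psi : R -> \bar R)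
    (f : U -> R) (V : R) :
  measurable_fun setT psi -> (forall x, 0 <= psi x)%E -> measurable_fun setT f ->
  measurable_fun setT (fun x => normal_mean psi (f x) V).
Proof.
move=> mpsi p0 mf; rewrite /normal_mean; have [_|V0] := eqVneq V 0.
  exact: measurableT_comp mpsi mf.
have [Vp|Vn] := leP 0 V; last first.
  (* A negative [V] has square root 0, and [normal_pdf] with deviation 0 ignores the mean. *)
  rewrite ler0_sqrtr ?ltW//.
  rewrite /normal_pdf eqxx; exact: measurable_cst.
have s0 : 0 < Num.sqrt V by rewrite sqrtr_gt0 lt_neqAle eq_sym V0.
apply: (measurable_fun_fubini_tonelli_F (m2 := mu)
  (fun xz : U * measurableTypeR R =>
    psi xz.2 * (normal_pdf (f xz.1) (Num.sqrt V) xz.2)%:E)%E).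
  apply: emeasurable_funM; first exact: (measurableT_comp mpsi measurable_snd).
  apply/measurable_EFinP; apply: measurable_normal_pdf2 => //.
  exact: (measurableT_comp mf measurable_fst).
by move=> x; rewrite mule_ge0 ?lee_fin ?normal_pdf_ge0.
Qed.

(** Only 1 + x <= e^x is used: for z^2 <= 1/2 the left side is at most 2 / (1 - z^2) <= 2 (1 + 2
    z^2), and for larger [z] the inequality z <= 2 z^2 bounds each exponential separately. *)
Lemma cosh_le (z : R) : expR z + expR (- z) <= 2 * expR (2 * z ^+ 2).
Proof.
wlog z0 : z / 0 <= z.
  move=> H; have [/H//|/ltW zn] := leP 0 z.
  by have := H (- z); rewrite oppr_ge0 opprK sqrrN addrC; apply.
have e0 := expR_gt0 z.
have [z1|z1] := leP (z ^+ 2) (1 / 2).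
  have zl : z < 1 by rewrite ltNge; apply/negP => ?; nra.
  have h1 := expR_ge1Dx (- z); have h2 := expR_ge1Dx z.
  have h3 := expR_ge1Dx (2 * z ^+ 2).
  have E : expR z * expR (- z) = 1 by rewrite -expRD subrr expR0.
  have f0 := expR_gt0 (- z).
  have l1 : expR z * (1 - z) <= 1.
    by rewrite -[leRHS]E ler_wpM2l// ltW.
  have l2 : expR (- z) * (1 + z) <= 1.
    by rewrite -[leRHS]E mulrC ler_wpM2r// ltW.
  have w0 : 0 < 1 - z ^+ 2 by lra.
  rewrite -(ler_pM2r w0).
  apply: (@le_trans _ _ 2).
    rewrite (_ : _ * _ = expR z * (1 - z) * (1 + z) + expR (- z) * (1 + z) * (1 - z));
      last by ring.
    have : expR z * (1 - z) * (1 + z) <= 1 * (1 + z) by rewrite ler_wpM2r//; lra.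
    have : expR (- z) * (1 + z) * (1 - z) <= 1 * (1 - z) by rewrite ler_wpM2r//; lra.
    lra.
  have : (1 + 2 * z ^+ 2) * (1 - z ^+ 2) <= expR (2 * z ^+ 2) * (1 - z ^+ 2).
    by rewrite ler_wpM2r// ltW.
  have z20 := sqr_ge0 z; nra.
have h : z <= 2 * z ^+ 2 by rewrite leNgt; apply/negP => ?; nra.
have : expR z <= expR (2 * z ^+ 2) by rewrite ler_expR.
have : expR (- z) <= expR (2 * z ^+ 2) by rewrite ler_expR; lra.
lra.
Qed.

(* With x = sigma <u, v> / |v|, the first summand is the contribution of the
   columns rounded down and the second that of the columns rounded up. *)
Lemma rounding_mgf_bound (f x U : R) : 0 <= f <= 1 -> x ^+ 2 <= U ->
  expR (f ^+ 2 * U / 2) * (1 / 2 - phi0 * (f * x) + phi0 * (f * x) ^+ 2) +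
  expR ((1 - f) ^+ 2 * U / 2) *
    (1 / 2 - phi0 * ((1 - f) * x) + phi0 * ((1 - f) * x) ^+ 2)
  <= expR (2 * U - phi0 * x).
Proof.
have /andP[p1 p2] := normal_peak_bounds; set p := phi0 in p1 p2 *.
move=> /andP[f0 f1] xU.
have U0 : 0 <= U by apply: le_trans xU; exact: sqr_ge0.
have x20 := sqr_ge0 x.
(* Both summands are of this form, with [g] equal to [f] and [1 - f]. After the bound they differ
   only in the last factor, where the exponents are opposite, so [cosh_le] applies. The final
   [2 * U] is U/2 from the tilt, U from the quadratic terms and U/2 from [cosh_le]. *)
have key g : 0 <= g <= 1 ->
    expR (g ^+ 2 * U / 2) * (1 / 2 - p * (g * x) + p * (g * x) ^+ 2) <=
    1 / 2 * expR (U / 2 + 2 * p * x ^+ 2 - p * x) * expR (p * (1 - 2 * g) * x).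
  move=> /andP[g0 g1].
  have g2 : g ^+ 2 <= 1 by rewrite expr_le1.
  have g20 := sqr_ge0 g.
  apply: (@le_trans _ _ (expR (g ^+ 2 * U / 2) *
      (1 / 2 * expR (- (2 * p * (g * x)) + 2 * p * (g * x) ^+ 2)))).
    apply: ler_wpM2l; first exact: expR_ge0.
    have := expR_ge1Dx (- (2 * p * (g * x)) + 2 * p * (g * x) ^+ 2); lra.
  rewrite mulrCA -[leRHS]mulrA; apply: ler_wpM2l; first lra.
  rewrite -!expRD ler_expR exprMn.
  have h1 : g ^+ 2 * U <= 1 * U by apply: ler_wpM2r.
  have h2 : p * (g ^+ 2 * x ^+ 2) <= p * (1 * x ^+ 2).
    by apply: ler_wpM2l; [lra|apply: ler_wpM2r].
  lra.
apply: le_trans (lerD (key f _) (key (1 - f) _)) _; [by rewrite f0|by lra|].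
rewrite -mulrDr (_ : p * (1 - 2 * (1 - f)) * x = - (p * (1 - 2 * f) * x)); last by ring.
set z := p * (1 - 2 * f) * x.
apply: (@le_trans _ _ (1 / 2 * expR (U / 2 + 2 * p * x ^+ 2 - p * x) *
   (2 * expR (2 * z ^+ 2)))).
  by apply: ler_wpM2l; [rewrite mulr_ge0 ?expR_ge0//; lra|exact: cosh_le].
rewrite mulrACA (_ : 1 / 2 * 2 = 1) ?mul1r; last by field.
rewrite -expRD ler_expR.
have zz : z ^+ 2 <= p ^+ 2 * x ^+ 2.
  rewrite /z !exprMn ler_wpM2r// ler_piMr ?sqr_ge0//.
  have : 0 <= f * (1 - f) by rewrite mulr_ge0 ?subr_ge0.
  nra.
have pp : p ^+ 2 * x ^+ 2 <= 1 / 4 * U.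
  by apply: ler_pM => //; [exact: sqr_ge0|nra].
have px : p * x ^+ 2 <= 1 / 2 * U by apply: ler_pM => //; lra.
lra.
Qed.

End NormalProb.

(** * Moments of one rounded column *)

Section Columns.
Context (d : measure_display) (T : measurableType d) (R : realType).
Variables (P : probability T R) (I : finType) (X : I -> {RV P >-> R}).
Variable sigma : R.
Hypotheses (sigma_gt0 : 0 < sigma) (indepX : independent_family X).
Hypothesis gaussX : forall i, gaussian 0 sigma (X i).
Notation mu := (@lebesgue_measure R).
Notation phi0 := (normal_peak (1 : R)).

Lemma integral_gaussian i (psi : R -> \bar R) :
  measurable_fun setT psi -> (forall x, 0 <= psi x)%E ->
  (\int[P]_w psi (X i w) =
   \int[mu]_x (psi x * (normal_pdf 0 sigma x)%:E))%E.
Proof.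
move=> mpsi p0; rewrite -integral_normal_prob//.
pose Y : T -> measurableTypeR R := X i.
have mY : measurable_fun setT Y.
  have mXi : measurable_fun setT (X i) by exact: measurable_funP.
  by move=> mT B mB; exact: (mXi mT B mB).
transitivity (\int[measure_function_pushforward__canonical__measure_function_Measure
    P mY]_x psi x)%E.
  by rewrite ge0_integral_pushforward.
by apply: eq_measure_integral => A mA _; exact: gaussX.
Qed.

Lemma measurable_lincomb d' (U : measurableType d') (Y : I -> U -> R)
    (s : seq I) (v : I -> R) : (forall i, i \in s -> measurable_fun setT (Y i)) ->
  measurable_fun setT (fun w => \sum_(i <- s) v i * Y i w).
Proof.
elim: s => [|i s IH] mY.
  by under eq_fun do rewrite big_nil; exact: measurable_cst.
under eq_fun do rewrite big_cons.
apply: measurable_funD.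
  by apply: measurable_funM => //; apply: mY; rewrite mem_head.
by apply: IH => j js; apply: mY; rewrite inE js orbT.
Qed.

(** Cameron-Martin: the weight exp<u, X> moves the mean of X by sigma^2 u, so <v, X> becomes normal
    around sigma^2 <u, v>. The induction peels off one variable at a time, absorbing it in [b], and
    thus needs no multivariate density. *)
Lemma gaussian_tilt (s : seq I) (u v : I -> R) (psi : R -> \bar R) (b : R) :
  uniq s -> measurable_fun setT psi -> (forall x, 0 <= psi x)%E ->
  (\int[P]_w (psi (b + \sum_(i <- s) v i * X i w)%R *
     (expR (\sum_(i <- s) u i * X i w))%:E) =
   (expR (sigma ^+ 2 * (\sum_(i <- s) u i ^+ 2) / 2))%:E *
   normal_mean psi (b + sigma ^+ 2 * \sum_(i <- s) u i * v i)
     (sigma ^+ 2 * \sum_(i <- s) v i ^+ 2))%E.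
Proof.
move=> + mpsi p0; elim: s b => [b _|i s IH b /= /andP[iNs us]].
  under eq_integral do rewrite !big_nil.
  rewrite !big_nil !mulr0 mul0r expR0 /normal_mean eqxx !addr0.
  by rewrite integral_cst//= probability_setT !mule1 mul1e.
pose S1 := [set i]%SET; pose S2 := [set j in s]%SET.
have dS : [disjoint S1 & S2]%B.
  by rewrite disjoints1 inE.
pose h w1 w2 : \bar R := (psi ((b + v i * X i w1) + \sum_(j <- s) v j * X j w2)%R *
  (expR (\sum_(j <- s) u j * X j w2))%:E * (expR (u i * X i w1))%:E)%E.
transitivity (\int[P]_w h w w)%E.
  apply: eq_integral => w _; rewrite /h !big_cons addrA -muleA -EFinM -expRD.
  by rewrite [u i * _ + _]addrC.
have mX1 : measurable_fun setT (fun w : sub_space X S1 * sub_space X S2 => X i w.1).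
  apply: (measurableT_comp _ measurable_fst).
  by apply: measurable_sub_space; rewrite inE.
have mX2 j : j \in s -> measurable_fun setT
    (fun w : sub_space X S1 * sub_space X S2 => X j w.2).
  move=> js; apply: (measurableT_comp _ measurable_snd).
  by apply: measurable_sub_space; rewrite inE.
rewrite (decoupling indepX dS (h := h)); first last.
- by move=> w1 w2; rewrite !mule_ge0 ?lee_fin ?expR_ge0.
- apply: emeasurable_funM; first apply: emeasurable_funM.
  + apply: (measurableT_comp mpsi); apply: measurable_funD.
      by apply: measurable_funD => //; apply: measurable_funM.
    exact (@measurable_lincomb _ _ _ s v mX2).
  + apply/measurable_EFinP; apply: (measurableT_comp (@measurable_expR R)).
    exact (@measurable_lincomb _ _ _ s u mX2).
  + apply/measurable_EFinP; apply: (measurableT_comp (@measurable_expR R)).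
    exact: measurable_funM.
pose Us := \sum_(j <- s) u j ^+ 2; pose Vs := \sum_(j <- s) v j ^+ 2.
pose K := \sum_(j <- s) u j * v j.
have Vs0 : 0 <= sigma ^+ 2 * Vs.
  by rewrite mulr_ge0 ?sqr_ge0// sumr_ge0// => j _; exact: sqr_ge0.
have mlin (c : I -> R) : measurable_fun setT (fun w => \sum_(j <- s) c j * X j w).
  by apply: measurable_lincomb => j _; exact: measurable_funP.
have mm : measurable_fun setT
    (fun x : R => normal_mean psi (b + sigma ^+ 2 * K + v i * x) (sigma ^+ 2 * Vs)).
  apply: measurable_normal_mean => //.
  by apply: measurable_funD.
transitivity (\int[P]_w1 ((expR (sigma ^+ 2 * Us / 2))%:E *
   (normal_mean psi (b + sigma ^+ 2 * K + v i * X i w1) (sigma ^+ 2 * Vs) *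
     (expR (u i * X i w1))%:E)))%E.
  apply: eq_integral => w _; rewrite /h ge0_integralZr//.
  - by rewrite IH// -muleA [X in normal_mean _ X _]addrAC.
  - apply: emeasurable_funM.
      by apply: (measurableT_comp mpsi); apply: measurable_funD.
    by apply/measurable_EFinP; apply: (measurableT_comp (@measurable_expR R)).
  - by move=> w2 _; rewrite mule_ge0 ?lee_fin ?expR_ge0.
pose g x := (normal_mean psi (b + sigma ^+ 2 * K + v i * x) (sigma ^+ 2 * Vs) *
     (expR (u i * x))%:E)%E.
have mexp : measurable_fun setT (fun x : R => (expR (u i * x))%:E).
  by apply/measurable_EFinP; apply: (measurableT_comp (@measurable_expR R)).
have mg : measurable_fun setT g by exact: emeasurable_funM.
have g0 x : (0 <= g x)%E.
  by rewrite mule_ge0 ?lee_fin ?expR_ge0//; exact: normal_mean_ge0.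
rewrite ge0_integralZl//; first last.
- by move=> w _; exact: g0.
- exact: (measurableT_comp mg).
rewrite (integral_gaussian i mg g0).
transitivity ((expR (sigma ^+ 2 * Us / 2))%:E *
   \int[mu]_x ((expR (sigma ^+ 2 * u i ^+ 2 / 2))%:E *
    (normal_mean psi (b + sigma ^+ 2 * K + v i * x) (sigma ^+ 2 * Vs) *
     (normal_pdf (sigma ^+ 2 * u i) sigma x)%:E)))%E.
  congr (_ * _)%E; apply: eq_integral => x _; rewrite /g -muleA -EFinM.
  by rewrite normal_pdf_tilt// EFinM muleCA.
rewrite ge0_integralZl//; first last.
- by move=> x _; rewrite mule_ge0 ?lee_fin ?normal_pdf_ge0//; exact: normal_mean_ge0.
- apply: emeasurable_funM; first exact: mm.
  by apply/measurable_EFinP; exact: measurable_normal_pdf.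
rewrite normal_mean_mix// muleA -EFinM -expRD !big_cons -/Us -/Vs -/K.
rewrite (_ : sigma ^+ 2 * Us / 2 + sigma ^+ 2 * u i ^+ 2 / 2 =
  sigma ^+ 2 * (u i ^+ 2 + Us) / 2); last by ring.
rewrite (_ : b + sigma ^+ 2 * K + v i * (sigma ^+ 2 * u i) =
  b + sigma ^+ 2 * (u i * v i + K)); last by ring.
by rewrite (_ : sigma ^+ 2 * Vs + v i ^+ 2 * sigma ^+ 2 =
  sigma ^+ 2 * (v i ^+ 2 + Vs)); last by ring.
Qed.

Lemma sum_CauchySchwarz (s : seq I) (u v : I -> R) :
  (\sum_(i <- s) u i * v i) ^+ 2 <=
  (\sum_(i <- s) u i ^+ 2) * (\sum_(i <- s) v i ^+ 2).
Proof.
set K := \sum_(i <- s) _ * _; set U := \sum_(i <- s) u i ^+ 2.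
set V := \sum_(i <- s) v i ^+ 2.
have U0 : 0 <= U by apply: sumr_ge0 => i _; exact: sqr_ge0.
have V0 : 0 <= V by apply: sumr_ge0 => i _; exact: sqr_ge0.
have E a b : 0 <= a ^+ 2 * U - 2 * a * b * K + b ^+ 2 * V.
  have -> : a ^+ 2 * U - 2 * a * b * K + b ^+ 2 * V =
      \sum_(i <- s) (a * u i - b * v i) ^+ 2.
    rewrite /U /V /K !mulr_sumr -sumrN -!big_split/=.
    by apply: eq_bigr => i _; ring.
  by apply: sumr_ge0 => i _; exact: sqr_ge0.
have [V1|V1] := eqVneq V 0.
  (* For [V = 0] the form is affine in its second argument; this choice makes it negative unless
     [K = 0]. *)
  have := E (K / 2) (U + 1); rewrite V1 mulr0 addr0 => h.
  have [->|K0] := eqVneq K 0; first by rewrite expr0n/= mulr0.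
  have : 0 < K ^+ 2 by rewrite exprn_even_gt0.
  nra.
have Vp : 0 < V by rewrite lt_neqAle eq_sym V1.
have := E V K; rewrite -(pmulr_rge0 _ Vp) => h.
have : 0 <= V * (U * V - K ^+ 2).
  by move: (E V K); congr (0 <= _); ring.
by rewrite pmulr_rge0// subr_ge0.
Qed.

(* Rounding up exactly when <v, X> <= 0 pushes the column sum against v. *)
Lemma rounded_column_mgf (s : seq I) (u v : I -> R) (f : R) :
  uniq s -> 0 <= f <= 1 -> 0 < \sum_(i <- s) v i ^+ 2 ->
  (\int[P]_w (expR (((\sum_(i <- s) v i * X i w <= 0)%R%:R - f) *
     \sum_(i <- s) u i * X i w))%:E <=
   (expR (2 * (sigma ^+ 2 * \sum_(i <- s) u i ^+ 2) -
     phi0 * (sigma * (\sum_(i <- s) u i * v i) /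
       Num.sqrt (\sum_(i <- s) v i ^+ 2))))%:E)%E.
Proof.
move=> us f01 V0.
set U := \sum_(i <- s) u i ^+ 2; set V := \sum_(i <- s) v i ^+ 2 in V0 *.
set K := \sum_(i <- s) u i * v i.
set H := fun w => \sum_(i <- s) v i * X i w.
pose G c w := \sum_(i <- s) (c * u i) * X i w.
have mH : measurable_fun setT H.
  by apply: measurable_lincomb => j _; exact: measurable_funP.
have mG c : measurable_fun setT (G c).
  by apply: measurable_lincomb => j _; exact: measurable_funP.
have mgt : measurable_fun setT (fun z : R => ((0 < z)%R%:R : R)%:E).
  by apply/measurable_EFinP; apply: measurable_boolR; exact: measurable_fun_ltr.
have mle : measurable_fun setT (fun z : R => ((z <= 0)%R%:R : R)%:E).
  by apply/measurable_EFinP; apply: measurable_boolR; exact: measurable_fun_ler.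
have mexp c : measurable_fun setT (fun w => (expR (G c w))%:E).
  by apply/measurable_EFinP; apply: (measurableT_comp (@measurable_expR R)).
(* On each side of the sign test the rounding is constant, so the integrand becomes an indicator in
   <v, X> times a pure exponential, the form that [gaussian_tilt] evaluates. *)
apply: (@le_trans _ _ (\int[P]_w (((0 < 0 + H w)%R%:R)%:E * (expR (G (- f) w))%:E +
   ((0 + H w <= 0)%R%:R)%:E * (expR (G (1 - f) w))%:E))%E).
  apply: ge0_le_integral => //.
  - apply/measurable_EFinP; apply: (measurableT_comp (@measurable_expR R)).
    apply: measurable_funM.
      apply: measurable_funB => //; apply: measurable_boolR.
      exact: measurable_fun_ler.
    by apply: measurable_lincomb => j _; exact: measurable_funP.
  - apply: emeasurable_funD; apply: emeasurable_funM => //.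
      by apply: (measurableT_comp mgt); exact: measurable_funD.
    by apply: (measurableT_comp mle); exact: measurable_funD.
  - move=> w _; rewrite add0r -/(H w) /G.
    under [in leRHS]eq_bigr do rewrite -mulrA.
    under [X in (_ + _ * (expR X)%:E)%E]eq_bigr do rewrite -mulrA.
    rewrite -!mulr_sumr; case: leP => h.
      by rewrite mul0e add0e mul1e.
    by rewrite mul0e adde0 mul1e sub0r.
rewrite ge0_integralD//; first last.
- apply: emeasurable_funM => //.
  by apply: (measurableT_comp mle); exact: measurable_funD.
- apply: emeasurable_funM => //.
  by apply: (measurableT_comp mgt); exact: measurable_funD.
have ge0b (b : R -> bool) x : (0 <= ((b x)%:R : R)%:E)%E by rewrite lee_fin.
have I1 : (\int[P]_w (((0 < 0 + H w)%R%:R)%:E * (expR (G (- f) w))%:E) = _)%E :=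
  gaussian_tilt (fun i => - f * u i) v 0 us mgt (ge0b (fun z => 0 < z)).
have I2 : (\int[P]_w (((0 + H w <= 0)%R%:R)%:E * (expR (G (1 - f) w))%:E) = _)%E :=
  gaussian_tilt (fun i => (1 - f) * u i) v 0 us mle (ge0b (fun z => z <= 0)).
rewrite I1 I2 !add0r -/V.
have scU c : \sum_(i <- s) (c * u i) ^+ 2 = c ^+ 2 * U.
  by rewrite mulr_sumr; apply: eq_bigr => i _; rewrite exprMn.
have scK c : \sum_(i <- s) (c * u i) * v i = c * K.
  by rewrite mulr_sumr; apply: eq_bigr => i _; rewrite mulrA.
rewrite !scU !scK.
have s2V : 0 < sigma ^+ 2 * V by rewrite mulr_gt0// exprn_gt0.
have sV : Num.sqrt (sigma ^+ 2 * V) = sigma * Num.sqrt V.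
  by rewrite sqrtrM ?sqr_ge0// sqrtr_sqr gtr0_norm.
have rV0 : 0 < Num.sqrt V by rewrite sqrtr_gt0.
set x := sigma * K / Num.sqrt V.
have xE c : sigma ^+ 2 * (c * K) / Num.sqrt (sigma ^+ 2 * V) = c * x.
  by rewrite sV /x; field; rewrite !gt_eqF.
have h1 := normal_mean_gt0_le (sigma ^+ 2 * (f * K)) s2V.
have h2 := normal_mean_le0_le (sigma ^+ 2 * ((1 - f) * K)) s2V.
rewrite xE in h1; rewrite xE in h2.
have xU : x ^+ 2 <= sigma ^+ 2 * U.
  rewrite /x expr_div_n (sqr_sqrtr (ltW V0)) exprMn ler_pdivrMr// -[leRHS]mulrA.
  by rewrite ler_pM2l ?exprn_gt0//; exact: sum_CauchySchwarz.
have := rounding_mgf_bound f01 xU; rewrite -lee_fin; apply: le_trans.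
rewrite EFinD !EFinM; apply: leeD.
- rewrite mulNr mulrN sqrrN [sigma ^+ 2 * (f ^+ 2 * U)]mulrCA.
  by apply: lee_wpmul2l; rewrite ?lee_fin ?expR_ge0.
- rewrite [sigma ^+ 2 * ((1 - f) ^+ 2 * U)]mulrCA.
  by apply: lee_wpmul2l; rewrite ?lee_fin ?expR_ge0.
Qed.

(** The tilt with constant [psi]. The multiplier [c] is [- f j] for a column rounded down, and a
    sign in the union bound of [floors_tail]. *)
Lemma fixed_column_mgf (s : seq I) (u : I -> R) (c : R) :
  uniq s -> c ^+ 2 <= 1 ->
  (\int[P]_w (expR (c * \sum_(i <- s) u i * X i w))%:E <=
   (expR (sigma ^+ 2 * (\sum_(i <- s) u i ^+ 2) / 2))%:E)%E.
Proof.
move=> us c1.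
have := gaussian_tilt (fun i => c * u i) (fun=> 0) 0 us
  (measurable_cst (1%:E : \bar R)) (fun=> lee01).
rewrite /= /normal_mean.
under eq_integral do rewrite mul1e.
set S := \sum_(i <- s) 0 ^+ 2.
have -> : S = 0 by rewrite /S big1// => i _; rewrite expr0n.
rewrite mulr0 eqxx mule1 => h.
under eq_integral do rewrite mulr_sumr.
under eq_integral do (under eq_bigr do rewrite mulrA).
rewrite h lee_fin ler_expR ler_pM2r// ler_wpM2l ?sqr_ge0//.
by apply: ler_sum => i _; rewrite exprMn ler_piMl ?sqr_ge0.
Qed.

End Columns.

(** * The steered walk *)

Section Walk.
Variables (R : realType) (m : nat) (sigma : R) (scale : nat) (active : nat -> bool).

(* disc is the discrepancy of the columns rounded so far, dir the direction
   against which the current phase steers, thr the threshold T of the phase,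
   rem the number of columns left at its start, pos the position in it. *)
Record walk := Walk {
  disc : 'I_m -> R; dir : 'I_m -> R; thr : R; rem : nat; pos : nat }.

(** Soft thresholding: for [t >= 0], the difference between [x] and the nearest point of [-t, t]. *)
Definition excess (t x : R) : R :=
  if t < x then x - t else if x < - t then x + t else 0.

(** The budget test is 2 sigma pos < 5 |dir|, in squared form because the machine has no square
    roots. A zero direction fails the strict inequality, so it only ever rounds down. *)
Definition rounds_up (s : walk) (a : 'I_m -> R) : bool :=
  (4 * ((pos s)%:R * (pos s)%:R) * (sigma * sigma) <
     25 * \sum_i dir s i * dir s i) &&
  (\sum_i dir s i * a i <= 0).

(** Started at 0, this recursion with fixed point 64 sigma scale has the increments 16 sigma scale
    (3/4)^j, without any power being stored. *)
Definition next_thr (t : R) : R := 3 / 4 * t + 16 * (sigma * scale%:R).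

(** Comparing [rem] with twice the number of columns done ends a phase after half of its columns,
    rounded up, using additions only. *)
Definition advance (s : walk) (f : R) (a : 'I_m -> R) : walk :=
  let d := fun i => disc s i + a i * ((rounds_up s a)%:R - f) in
  if (rem s <= (pos s).+1 + (pos s).+1)%N then
    let r := (rem s - (pos s).+1)%N in
    let t := next_thr (thr s) in
    Walk d (fun i => if active r then excess t (d i) else 0) t r 0
  else Walk d (dir s) (thr s) (rem s) (pos s).+1.

Lemma disc_advance s f a i :
  disc (advance s f a) i = disc s i + a i * ((rounds_up s a)%:R - f).
Proof. by rewrite /advance; case: ifP. Qed.

Definition walk0 (r : nat) : walk := Walk (fun=> 0) (fun=> 0) 0 r 0.

End Walk.

Lemma root_exists k : exists s, (k <= s * s)%N.
Proof. by exists k; nia. Qed.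

Definition root_ceil k : nat := ex_minn (root_exists k).

Section Scale.
Variables (n m : nat).
Hypothesis n_gt0 : (0 < n)%N.

Lemma doubling_exists : exists k, (m <= n * 2 ^ k)%N.
Proof.
exists m; apply: leq_trans (ltnW (ltn_expl m (isT : 1 < 2)%N)) _.
by rewrite leq_pmull.
Qed.

Definition doublings : nat := ex_minn doubling_exists.

End Scale.

(* The second condition, log m > 1024 log(m / n), singles out the instances in
   which rounding down alone is not good enough. *)
Definition steering_range (R : realType) (n m : nat) (r : nat) : bool :=
  (n < r * r)%N && ((m%:R / n%:R : R) ^+ (2 ^ 10) < m%:R).

Lemma measurable_bool_set d (U : measurableType d) (b : U -> bool) :
  measurable_fun setT b -> measurable [set w | b w].
Proof. by move=> mb; rewrite -[X in measurable X]setTI; exact: (mb _ [set true]). Qed.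

Lemma leq_uphalf_double r : (r <= 2 * uphalf r)%N.
Proof. by rewrite uphalf_half; have := odd_double_half r; rewrite -muln2; lia. Qed.

Lemma uphalf_leq r : (uphalf r <= r)%N.
Proof. by rewrite uphalf_half; have := odd_double_half r; rewrite -muln2; lia. Qed.

Lemma leq_half_double1 r : (r <= (2 * r./2).+1)%N.
Proof. by have := odd_double_half r; rewrite -muln2; case: (odd r) => /=; lia. Qed.

(** * One phase *)

Section SubgaussianVectors.
Context (d : measure_display) (T : measurableType d) (R : realType).
Variable P : probability T R.
Notation mu := (@lebesgue_measure R).

Lemma le_probability_mean (E : set T) (f : T -> R) : measurable E ->
  measurable_fun setT f -> (forall w, 0 <= f w) -> (forall w, E w -> 1 <= f w) ->
  (P E <= \int[P]_w (f w)%:E)%E.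
Proof.
move=> mE mf f0 fE; rewrite -[X in P X]setIT -integral_indic//.
apply: ge0_le_integral => //.
- by apply/measurable_EFinP; exact: measurable_indic.
- exact/measurable_EFinP.
- move=> w _; rewrite lee_fin indicE; have [wE|_] := boolP (w \in E) => //.
  by apply: fE; rewrite inE in wE.
Qed.

Lemma integral_exp_normal (a : R) :
  (\int[mu]_x ((expR (a * x))%:E * (normal_pdf 0 1 x)%:E) = (expR (a ^+ 2 / 2))%:E)%E.
Proof.
have mpdf c s : measurable_fun setT (fun x : R => (normal_pdf c s x)%:E).
  by apply/measurable_EFinP; exact: measurable_normal_pdf.
under eq_integral do rewrite -EFinM normal_pdf_tilt// expr1n !mul1r EFinM.
rewrite ge0_integralZl//.
- by rewrite integral_normal_pdf mule1.
- exact: mpdf.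
- by move=> x _; rewrite lee_fin normal_pdf_ge0.
Qed.

(** Of the Gaussian exponent 1/2, the weight 3/8 leaves 1/8; this is the exponent of deviation 2,
    whose density is smaller by a factor 2. *)
Lemma integral_expsqr_normal :
  (\int[mu]_x ((expR (3 / 8 * x ^+ 2))%:E * (normal_pdf (0 : R) 1 x)%:E) = 2%:E)%E.
Proof.
have mpdf c s : measurable_fun setT (fun x : R => (normal_pdf c s x)%:E).
  by apply/measurable_EFinP; exact: measurable_normal_pdf.
have E (x : R) : expR (3 / 8 * x ^+ 2) * normal_pdf 0 1 x = 2 * normal_pdf 0 2 x.
  rewrite !normal_pdfE ?oner_eq0// ?pnatr_eq0// (@normal_peakE _ 2)// /normal_fun.
  rewrite mulrCA !mulrA divff ?mul1r ?pnatr_eq0// -mulrA -expRD; congr (_ * expR _).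
  by field.
under eq_integral do rewrite -EFinM E EFinM.
rewrite ge0_integralZl//.
- by rewrite integral_normal_pdf mule1.
- exact: mpdf.
- by move=> x _; rewrite lee_fin normal_pdf_ge0.
Qed.

Variables (m : nat) (G : 'I_m -> T -> R) (D : R).
Hypothesis mG : forall i, measurable_fun setT (G i).
Hypothesis mgfG : forall u : 'I_m -> R,
  (\int[P]_w (expR (\sum_i u i * G i w))%:E <= (expR (D * \sum_i u i ^+ 2))%:E)%E.

(* exp(theta x^2) is a Gaussian mixture of exp(a x), which reduces quadratic
   exponential moments to the linear ones. *)
Lemma prod_expsqr_mean (theta k : R) (s : seq 'I_m) (u : 'I_m -> R) :
  0 <= theta -> theta * D = 3 / 16 -> 0 <= k ->
  uniq s -> (forall i, i \in s -> u i = 0) ->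
  (\int[P]_w ((\prod_(i <- s) (1 + k * expR (theta * G i w ^+ 2))) *
     expR (\sum_i u i * G i w))%:E <=
   ((1 + 2 * k) ^+ size s * expR (D * \sum_i u i ^+ 2))%:E)%E.
Proof.
move=> th0 thD k0; elim: s u => [|i0 s IH] u /=.
  by move=> _ _; under eq_integral do rewrite big_nil mul1r; rewrite mul1r.
move=> /andP[i0s us] u0.
pose pr w := \prod_(i <- s) (1 + k * expR (theta * G i w ^+ 2)).
have pr0 w : 0 <= pr w.
  by apply: prodr_ge0 => i _; rewrite addr_ge0// mulr_ge0 ?expR_ge0.
have mpr : measurable_fun setT pr.
  apply: measurable_prod => i _; apply: measurable_funD => //.
  apply: measurable_funM => //; apply: (measurableT_comp (@measurable_expR R)).
  by apply: measurable_funM => //; exact: measurable_funX.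
pose ug g i := if i == i0 then Num.sqrt (2 * theta) * g else u i.
have ugE g w : \sum_i ug g i * G i w =
    Num.sqrt (2 * theta) * g * G i0 w + \sum_i u i * G i w.
  rewrite (bigD1 i0)//= [in RHS](bigD1 i0)//= u0 ?mem_head// mul0r add0r.
  rewrite /ug eqxx; congr (_ + _); apply: eq_bigr => i /negbTE ni.
  by rewrite ni.
have ug2 g : \sum_i ug g i ^+ 2 = 2 * theta * g ^+ 2 + \sum_i u i ^+ 2.
  rewrite (bigD1 i0)//= [in RHS](bigD1 i0)//= u0 ?mem_head// expr0n/= add0r.
  rewrite /ug eqxx exprMn sqr_sqrtr ?mulr_ge0//; congr (_ + _).
  by apply: eq_bigr => i /negbTE ->.
have mlin (v : 'I_m -> R) : measurable_fun setT (fun w => \sum_i v i * G i w).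
  by apply: measurable_sum => i; apply: measurable_funM.
have mexplin (v : 'I_m -> R) :
    measurable_fun setT (fun w => expR (\sum_i v i * G i w)).
  exact: (measurableT_comp (@measurable_expR R)).
pose h (wg : T * measurableTypeR R) := ((pr wg.1 * expR (\sum_i ug wg.2 i * G i wg.1))%:E *
   (normal_pdf 0 1 wg.2)%:E)%E.
have mh : measurable_fun setT h.
  apply: emeasurable_funM; apply/measurable_EFinP.
    apply: measurable_funM; first exact: (measurableT_comp mpr).
    apply: (measurableT_comp (@measurable_expR R)).
    under eq_fun do rewrite ugE.
    apply: measurable_funD.
      apply: measurable_funM; first exact: measurable_funM.
      exact: (measurableT_comp (mG i0)).
    exact: (measurableT_comp (mlin u)).
  exact: (measurableT_comp (measurable_normal_pdf 0 1)).
have h0 wg : (0 <= h wg)%E.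
  by rewrite mule_ge0// lee_fin ?normal_pdf_ge0// mulr_ge0 ?expR_ge0.
have E w : ((\prod_(i <- i0 :: s) (1 + k * expR (theta * G i w ^+ 2))) *
     expR (\sum_i u i * G i w))%:E =
   ((pr w * expR (\sum_i u i * G i w))%:E + k%:E * \int[mu]_g h (w, g))%E.
  rewrite big_cons -/(pr w).
  have -> : (\int[mu]_g h (w, g) =
     (pr w * expR (\sum_i u i * G i w))%:E * (expR (theta * G i0 w ^+ 2))%:E)%E.
    have -> : theta * G i0 w ^+ 2 = (Num.sqrt (2 * theta) * G i0 w) ^+ 2 / 2.
      by rewrite exprMn sqr_sqrtr ?mulr_ge0//; field.
    rewrite -integral_exp_normal -ge0_integralZl//.
    - apply: eq_integral => g _; rewrite /h/= ugE addrC expRD.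
      by rewrite [_ * g * _]mulrAC mulrA EFinM muleA.
    - apply: emeasurable_funM; apply/measurable_EFinP.
        apply: (measurableT_comp (@measurable_expR R)).
        exact: measurable_funM.
      exact: measurable_normal_pdf.
    - by move=> g _; rewrite mule_ge0 ?lee_fin ?expR_ge0 ?normal_pdf_ge0.
    - by rewrite lee_fin mulr_ge0 ?expR_ge0.
  rewrite -!EFinM -EFinD; congr EFin; ring.
under eq_integral do rewrite E.
have mF : measurable_fun setT (fun w => (\int[mu]_g h (w, g))%E).
  exact: (measurable_fun_fubini_tonelli_F (m2 := mu) h).
rewrite ge0_integralD//; first last.
- by apply: emeasurable_funM.
- by move=> w _; rewrite mule_ge0// ?lee_fin//; apply: integral_ge0.
- apply/measurable_EFinP; apply: measurable_funM => //.
- by move=> w _; rewrite lee_fin mulr_ge0 ?expR_ge0.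
rewrite ge0_integralZl//; first last.
- by move=> w _; apply: integral_ge0.
rewrite (fubini_tonelli h mh h0).
(* As [theta * D = 3 / 16], the enlarged coefficient vector contributes exactly exp(3/8 g^2), of
   Gaussian mean 2; this is the 2 in [1 + 2 * k]. *)
have KE (x : R) : D * (2 * theta * x) = 3 / 8 * x.
  rewrite (_ : D * (2 * theta * x) = 2 * (theta * D) * x); last by ring.
  by rewrite thD; field.
pose B := ((1 + 2 * k) ^+ size s * expR (D * \sum_i u i ^+ 2)).
have B0 : 0 <= B.
  by rewrite mulr_ge0 ?expR_ge0// exprn_ge0// addr_ge0// mulr_ge0.
apply: (@le_trans _ _ (B%:E + k%:E * (B%:E * 2%:E))%E); last first.
  by rewrite -!EFinM -EFinD lee_fin exprS /B; lra.
apply: leeD.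
  by apply: IH => // i is_; apply: u0; rewrite inE is_ orbT.
apply: lee_wpmul2l; first by rewrite lee_fin.
rewrite -integral_expsqr_normal -ge0_integralZl//; first last.
- by move=> g _; rewrite mule_ge0 ?lee_fin ?expR_ge0 ?normal_pdf_ge0.
- apply: emeasurable_funM; apply/measurable_EFinP.
    apply: (measurableT_comp (@measurable_expR R)).
    by apply: measurable_funM => //; exact: measurable_funX.
  exact: measurable_normal_pdf.
apply: ge0_le_integral => //.
- by move=> g _; apply: integral_ge0.
- exact: (measurable_fun_fubini_tonelli_G (m1 := P) h).
- apply: emeasurable_funM => //; apply: emeasurable_funM; apply/measurable_EFinP.
    apply: (measurableT_comp (@measurable_expR R)).
    by apply: measurable_funM => //; exact: measurable_funX.
  exact: measurable_normal_pdf.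
move=> g _; rewrite /h/= ge0_integralZr//.
- rewrite muleA; apply: lee_wpmul2r; first by rewrite lee_fin normal_pdf_ge0.
  apply: le_trans (IH (ug g) us _) _.
    move=> i is_; rewrite /ug; case: eqP => [ii0|_].
      by rewrite -ii0 is_ in i0s.
    by apply: u0; rewrite inE is_ orbT.
  rewrite ug2 -EFinM lee_fin /B mulrDr expRD -[leRHS]mulrA; apply: ler_wpM2l.
    by rewrite exprn_ge0// addr_ge0// mulr_ge0.
  rewrite mulrC; apply: ler_wpM2l; first exact: expR_ge0.
  rewrite ler_expR.
  by rewrite KE.
- apply/measurable_EFinP; apply: measurable_funM => //.
- by move=> w _; rewrite lee_fin mulr_ge0 ?expR_ge0.
- by rewrite lee_fin normal_pdf_ge0.
Qed.

(** Beyond the threshold, (|x| - Dl)^2 <= (|x| - Dl)(|x| + Dl). So exp(theta excess^2) is at most 1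
    or at most exp(-theta Dl^2) exp(theta x^2), and the sum of these bounds is a factor in
    [prod_expsqr_mean]. *)
Lemma excess_sqr_le (Dl x : R) : 0 <= Dl ->
  excess Dl x ^+ 2 <= 0 \/ excess Dl x ^+ 2 <= x ^+ 2 - Dl ^+ 2.
Proof.
move=> D0; rewrite /excess; case: ltP => h; first by right; nra.
case: ltP => h'; first by right; nra.
by left; rewrite expr0n.
Qed.

Lemma measurable_excess d' (U : measurableType d') (t : R) (f : U -> R) :
  measurable_fun setT f -> measurable_fun setT (fun w => excess t (f w)).
Proof.
move=> mf; rewrite /excess; apply: measurable_fun_ifT => //.
- exact: measurable_fun_ltr.
- exact: measurable_funB.
- apply: measurable_fun_ifT => //; first exact: measurable_fun_ltr.
  exact: measurable_funD.
Qed.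

(** Markov's inequality for the exponential of [theta] times the sum of squares, dominated by the
    product of [prod_expsqr_mean]; finally (1 + 2k)^m <= exp(2km). *)
Lemma excess_norm_tail (theta Dl B : R) :
  0 <= theta -> theta * D = 3 / 16 -> 0 <= Dl ->
  (P [set w | (B < \sum_i excess Dl (G i w) ^+ 2)%R] <=
   (expR (2 * expR (- (theta * Dl ^+ 2)) * m%:R - theta * B))%:E)%E.
Proof.
move=> th0 thD D0; set k := expR (- (theta * Dl ^+ 2)).
have k0 : 0 <= k by exact: expR_ge0.
pose f w := expR (- (theta * B)) *
  ((\prod_(i <- enum 'I_m) (1 + k * expR (theta * G i w ^+ 2))) *
    expR (\sum_i 0 * G i w)).
have mpr : measurable_fun setT
    (fun w => \prod_(i <- enum 'I_m) (1 + k * expR (theta * G i w ^+ 2))).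
  apply: measurable_prod => i _; apply: measurable_funD => //.
  apply: measurable_funM => //; apply: (measurableT_comp (@measurable_expR R)).
  by apply: measurable_funM => //; exact: measurable_funX.
have mlin : measurable_fun setT (fun w => expR (\sum_i 0 * G i w)).
  apply: (measurableT_comp (@measurable_expR R)).
  by apply: measurable_sum => i; apply: measurable_funM.
have pr0 w : 0 <= \prod_(i <- enum 'I_m) (1 + k * expR (theta * G i w ^+ 2)).
  by apply: prodr_ge0 => i _; rewrite addr_ge0// mulr_ge0 ?expR_ge0.
apply: (@le_trans _ _ (\int[P]_w (f w)%:E)%E).
  apply: le_probability_mean.
  - apply: measurable_bool_set; apply: measurable_fun_ltr => //.
    by apply: measurable_sum => i; apply: measurable_funX; exact: measurable_excess.
  - by apply: measurable_funM => //; exact: measurable_funM.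
  - by move=> w; rewrite !mulr_ge0 ?expR_ge0.
  - move=> w /= hB; rewrite /f (_ : \sum_i 0 * G i w = 0); last first.
      by apply: big1 => i _; rewrite mul0r.
    rewrite expR0 mulr1.
    apply: (@le_trans _ _ (expR (- (theta * B)) *
       \prod_(i <- enum 'I_m) expR (theta * excess Dl (G i w) ^+ 2))).
      rewrite -expR_sum -expRD -[leLHS]expR0 ler_expR -mulr_sumr addrC subr_ge0.
      by apply: ler_wpM2l => //; rewrite big_enum/= ltW.
    apply: ler_wpM2l; first exact: expR_ge0.
    apply: ler_prod => i _; rewrite expR_ge0/=.
    have [h|h] := excess_sqr_le (G i w) D0.
      apply: (@le_trans _ _ 1); last by rewrite lerDl mulr_ge0 ?expR_ge0.
      by rewrite -expR0 ler_expR mulr_ge0_le0.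
    apply: (@le_trans _ _ (k * expR (theta * G i w ^+ 2))); last by rewrite lerDr.
    rewrite /k -expRD ler_expR addrC -mulrBr; exact: ler_wpM2l.
rewrite /f; under eq_integral do rewrite EFinM.
rewrite ge0_integralZl//.
- apply: (@le_trans _ _ ((expR (- (theta * B)))%:E *
     ((1 + 2 * k) ^+ size (enum 'I_m) * expR (D * \sum_(i < m) 0 ^+ 2))%:E)%E).
    apply: lee_wpmul2l; first by rewrite lee_fin expR_ge0.
    by apply: (prod_expsqr_mean (u := fun=> 0)) => //; exact: enum_uniq.
  rewrite -EFinM lee_fin size_enum_ord big1 ?mulr0 ?expR0 ?mulr1; last first.
    by move=> i _; rewrite expr0n.
  rewrite [2 * k * m%:R - _]addrC expRD; apply: ler_wpM2l; first exact: expR_ge0.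
  rewrite expRM_natr lerXn2r ?nnegrE ?expR_ge0 ?addr_ge0 ?mulr_ge0//.
  exact: expR_ge1Dx.
- by apply/measurable_EFinP; exact: measurable_funM.
- by move=> w _; rewrite lee_fin mulr_ge0 ?expR_ge0.
Qed.

End SubgaussianVectors.

(** * A block of columns steered against a frozen direction *)

Section Blocks.
Context (R : realType) (m n : nat).
Implicit Types (a : 'I_n -> 'I_m -> R) (v : 'I_m -> R) (js : seq 'I_n).
Variables (sigma : R) (f : 'I_n -> R).

(** [rounds_up] reads only the direction and the position, so the other fields are dummies. *)
Definition steer v (p : nat) (aj : 'I_m -> R) : bool :=
  rounds_up sigma (Walk (fun=> 0) v 0 0 p) aj.

Fixpoint block_sum a v (p : nat) js (i : 'I_m) : R :=
  if js is j :: js' then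
    a j i * ((steer v p (a j))%:R - f j) + block_sum a v p.+1 js' i
  else 0.

Lemma measurable_steer d (U : measurableType d) (v aj : 'I_m -> U -> R) p :
  (forall i, measurable_fun setT (v i)) -> (forall i, measurable_fun setT (aj i)) ->
  measurable_fun setT (fun w => steer (v ^~ w) p (aj ^~ w)).
Proof.
move=> mv ma; rewrite /steer /rounds_up/=; apply: measurable_and.
  apply: measurable_fun_ltr => //; apply: measurable_funM => //.
  by apply: measurable_sum => i; apply: measurable_funM.
apply: measurable_fun_ler => //.
by apply: measurable_sum => i; apply: measurable_funM.
Qed.

Lemma measurable_block_sum d (U : measurableType d)
    (a : 'I_n -> 'I_m -> U -> R) (v : 'I_m -> U -> R) p js i :
  (forall i, measurable_fun setT (v i)) ->
  (forall j i, j \in js -> measurable_fun setT (a j i)) ->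
  measurable_fun setT
    (fun w => block_sum (fun j i => a j i w) (v ^~ w) p js i).
Proof.
move=> mv; elim: js p => [|j js IH] p ma /=; first exact: measurable_cst.
apply: measurable_funD.
  apply: measurable_funM; first by apply: ma; rewrite mem_head.
  apply: measurable_funB => //; apply: measurable_boolR.
  by apply: measurable_steer => // i'; apply: ma; rewrite mem_head.
by apply: IH => j' i' jj; apply: ma; rewrite inE jj orbT.
Qed.

Variables (scale : nat) (active : nat -> bool).
Notation adv := (advance sigma scale active).

Definition walk_cols a (s : walk R m) js : walk R m :=
  foldl (fun s j => adv s (f j) (a j)) s js.

Definition phase_end (D : 'I_m -> R) (t : R) (r : nat) : walk R m :=
  Walk D (fun i => if active r./2 then excess (next_thr sigma scale t) (D i) else 0)
    (next_thr sigma scale t) r./2 0.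

(** The direction does not change until the phase ends, so a whole phase is a single [block_sum]. *)
Lemma walk_cols_phase a (dd : 'I_m -> R) v t r p js :
  (0 < size js)%N -> (p + size js = uphalf r)%N ->
  walk_cols a (Walk dd v t r p) js =
  phase_end (fun i => dd i + block_sum a v p js i) t r.
Proof.
elim: js dd p => [//|j js IH] dd p _ /= pj.
rewrite {1}/advance/= -/(steer v p (a j)).
have rE : (r = r./2 + uphalf r)%N by rewrite addnC uphalf_half; lia.
case: js IH pj => [|j' js'] IH pj.
  have -> : (r <= p.+1 + p.+1)%N by move: pj; rewrite /=; lia.
  have -> : (r - p.+1 = r./2)%N by move: pj => /=; lia.
  transitivity (phase_end (fun i => dd i + a j i * ((steer v p (a j))%:R - f j)) t r).
    by [].
  by congr phase_end; apply/funext => i; rewrite addr0.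
have -> : (r <= p.+1 + p.+1)%N = false by move: pj => /=; lia.
rewrite IH//; last by move: pj => /=; lia.
apply: (congr1 (fun D => phase_end D t r)); apply/funext => i.
by rewrite -addrA.
Qed.

Lemma steer0 p aj : steer (fun=> 0) p aj = false.
Proof.
rewrite /steer /rounds_up/= big1; last by move=> i _; rewrite mulr0.
rewrite mulr0.
apply/negP => /andP[h _]; move: h; rewrite ltNge => /negP; apply.
by rewrite -!expr2 mulr_ge0 ?sqr_ge0// mulr_ge0 ?sqr_ge0.
Qed.

Lemma disc_walk_cols_inactive a (dd : 'I_m -> R) t r p js i :
  (forall r', (r' <= r)%N -> ~~ active r') ->
  disc (walk_cols a (Walk dd (fun=> 0) t r p) js) i =
  dd i + \sum_(j <- js) a j i * - f j.
Proof.
move=> na; elim: js dd t r p na => [|j js IH] dd t r p na /=.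
  by rewrite big_nil addr0.
have st0 : rounds_up sigma (Walk dd (fun=> 0) t r p) (a j) = false.
  exact: steer0.
rewrite {1}/advance/= st0 big_cons addrA.
case: ifP => _.
  rewrite (negbTE (na _ _)) ?leq_subr// IH ?sub0r// => r' h; apply: na; lia.
by rewrite IH// sub0r.
Qed.

End Blocks.

Section BlockMGF.
Context (d : measure_display) (T : measurableType d) (R : realType).
Variables (P : probability T R) (m n : nat) (X : 'I_m * 'I_n -> {RV P >-> R}).
Variables (sigma : R) (f : 'I_n -> R).
Hypotheses (sigma_gt0 : 0 < sigma) (indepX : independent_family X).
Hypothesis gaussX : forall i, gaussian 0 sigma (X i).
Hypothesis f01 : forall j, 0 <= f j <= 1.
Notation phi0 := (normal_peak (1 : R)).

Definition entries (w : T) (j : 'I_n) (i : 'I_m) : R := X (i, j) w.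
Definition col_set (js : seq 'I_n) : {set 'I_m * 'I_n} := [set p | p.2 \in js].

Lemma measurable_entry (js : seq 'I_n) j i : j \in js ->
  measurable_fun setT ((fun w => entries w j i) : sub_space X (col_set js) -> R).
Proof. by move=> jj; apply: measurable_sub_space; rewrite inE. Qed.

Lemma disjoint_col_set js js' : (forall j, j \in js -> j \notin js') ->
  [disjoint col_set js & col_set js']%B.
Proof.
move=> h; rewrite -setI_eq0; apply/eqP/setP => p; rewrite !inE.
by apply/negbTE/negP => /andP[/h /negP].
Qed.

Definition steps (v : 'I_m -> R) (p k : nat) : nat :=
  count (fun l => 4 * (l%:R * l%:R) * (sigma * sigma) <
     25 * \sum_i v i * v i) (iota p k).

(** The direction and the budget test are not random, so the rounding of a column depends on that
    column alone and the exponential moment factors over columns. Steered columns contribute drift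
    by [rounded_column_mgf], the others none by [fixed_column_mgf]; [2 * sigma ^+ 2] per column
    covers both. *)
Lemma block_mgf (u v : 'I_m -> R) p js : uniq js ->
  (\int[P]_w (expR (\sum_i u i * block_sum sigma f (entries w) v p js i))%:E <=
   (expR (2 * sigma ^+ 2 * (size js)%:R * (\sum_i u i ^+ 2) -
     phi0 * sigma * (steps v p (size js))%:R *
       ((\sum_i u i * v i) / Num.sqrt (\sum_i v i ^+ 2))))%:E)%E.
Proof.
elim: js p => [|j js IH] p /=.
  move=> _; rewrite (_ : \sum_(i < m) u i * 0 = 0); last first.
    by apply: big1 => i _; rewrite mulr0.
  rewrite expR0 integral_cst//= probability_setT mule1 lee_fin /steps/=.
  by rewrite !(mulr0, mul0r) subr0 expR0.
move=> /andP[jj us].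
set U := \sum_i u i ^+ 2; set K := (\sum_i u i * v i) / _.
pose g w := ((steer sigma v p (entries w j))%:R - f j) * \sum_i u i * entries w j i.
have E w : (expR (\sum_i u i * (entries w j i *
      ((steer sigma v p (entries w j))%:R - f j) +
      block_sum sigma f (entries w) v p.+1 js i)))%:E =
    ((expR (g w))%:E *
     (expR (\sum_i u i * block_sum sigma f (entries w) v p.+1 js i))%:E)%E.
  rewrite -EFinM -expRD; congr (expR _)%:E.
  rewrite /g mulr_sumr -big_split/=; apply: eq_bigr => i _; ring.
under eq_integral do rewrite E.
have mcol (js' : seq 'I_n) v' p' i : measurable_fun setT
    ((fun w => block_sum sigma f (entries w) v' p' js' i) :
      sub_space X (col_set js') -> R).
  apply: (@measurable_block_sum R m n sigma f _ (sub_space X (col_set js'))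
      (fun j i w => entries w j i) (fun i _ => v' i) p' js' i) => [i'|j' i' jj'].
    exact: measurable_cst.
  exact: measurable_entry.
rewrite (ge0_integral_indepM (S1 := col_set [:: j]) (S2 := col_set js) indepX)//.
- have -> : 2 * sigma ^+ 2 * (size js).+1%:R * U -
      phi0 * sigma * (steps v p (size js).+1)%:R * K =
    (2 * (sigma ^+ 2 * U) - phi0 * sigma * (4 * (p%:R * p%:R) * (sigma * sigma) <
     25 * \sum_i v i * v i)%R%:R * K) +
    (2 * sigma ^+ 2 * (size js)%:R * U -
      phi0 * sigma * (steps v p.+1 (size js))%:R * K).
    rewrite /steps/= natrD -natr1; ring.
  rewrite expRD EFinM; apply: lee_pmul => //.
  + by apply: integral_ge0 => w _; rewrite lee_fin expR_ge0.
  + by apply: integral_ge0 => w _; rewrite lee_fin expR_ge0.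
  + pose sj := [seq (i, j) | i <- enum 'I_m].
    have usj : uniq sj by rewrite map_inj_uniq ?enum_uniq// => x y [].
    have sumE (F : 'I_m * 'I_n -> R) : \sum_(e <- sj) F e = \sum_i F (i, j).
      by rewrite big_map big_enum.
    rewrite /g /steer /rounds_up/=.
    case: (boolP (4 * (p%:R * p%:R) * (sigma * sigma) < 25 * \sum_i v i * v i))
      => st /=.
      have V0 : 0 < \sum_(e <- sj) (v e.1) ^+ 2.
        rewrite sumE/= (_ : \sum_i v i ^+ 2 = \sum_i v i * v i); last first.
          by apply: eq_bigr => i _; rewrite expr2.
        suff : 0 < 25 * \sum_i v i * v i by rewrite pmulr_rgt0.
        by apply: le_lt_trans st; rewrite -!expr2 mulr_ge0 ?sqr_ge0.
      have := rounded_column_mgf sigma_gt0 indepX gaussX (fun e => u e.1) usj (f01 j) V0.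
      rewrite !sumE/= -/U => H.
      apply: le_trans (le_trans H _); last first.
        by rewrite lee_fin ler_expR mulr1 /K !mulrA.
      by rewrite le_eqVlt; apply/predU1P; left; apply: eq_integral => w _; rewrite !sumE.
    have c1 : (- f j) ^+ 2 <= 1 by have /andP[a b] := f01 j; nra.
    have := fixed_column_mgf sigma_gt0 indepX gaussX (fun e => u e.1) usj c1.
    rewrite !sumE/= -/U => H.
    apply: le_trans (le_trans H _); last first.
      have U0 : 0 <= sigma ^+ 2 * U.
        by rewrite mulr_ge0 ?sqr_ge0// sumr_ge0// => i _; exact: sqr_ge0.
      by rewrite lee_fin ler_expR mulr0 mul0r; lra.
    rewrite le_eqVlt; apply/predU1P; left; apply: eq_integral => w _.
    by rewrite !sumE sub0r.
  + exact: IH.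
- by apply: disjoint_col_set => k; rewrite inE => /eqP ->.
- apply/measurable_EFinP; apply: (measurableT_comp (@measurable_expR R)).
  apply: measurable_funM.
    apply: measurable_funB => //; apply: measurable_boolR.
    apply: (@measurable_steer R m sigma _ (sub_space X (col_set [:: j]))
      (fun i _ => v i) (fun i w => entries w j i) p).
      by move=> i; exact: measurable_cst.
    by move=> i; apply: measurable_entry; rewrite mem_head.
  apply: measurable_sum => i; apply: measurable_funM => //.
  by apply: measurable_entry; rewrite mem_head.
- apply/measurable_EFinP; apply: (measurableT_comp (@measurable_expR R)).
  by apply: measurable_sum => i; apply: measurable_funM => //; exact: mcol.
Qed.

(** The budget test is antitone in [l], so the positions passing it form an initial segment and
    their number is the first position that fails. *)
Lemma steps_first (v : 'I_m -> R) k :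
  let ok l := 4 * (l%:R * l%:R) * (sigma * sigma) < 25 * \sum_i v i * v i in
  (forall l, (l < steps v 0 k)%N -> ok l) /\
  ((steps v 0 k < k)%N -> ~~ ok (steps v 0 k)).
Proof.
move=> ok; rewrite /steps -/ok.
have mono l l' : (l <= l')%N -> ok l' -> ok l.
  move=> ll; apply: le_lt_trans; apply: ler_wpM2r; first by rewrite mulr_ge0 ?ltW.
  by apply: ler_wpM2l => //; rewrite -!natrM ler_nat leq_mul.
elim: k => [|k [h1 h2]]; first by [].
rewrite -addn1 iotaD count_cat/= add0n addn0.
set c := count _ _ in h1 h2 *.
have ck : (c <= k)%N by rewrite /c -[leqRHS](size_iota 0 k) count_size.
have [okk|nok] := boolP (ok k).
  have cE : c = k.
    apply/eqP; rewrite eqn_leq ck/= leqNgt; apply/negP => lt.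
    by have /negP := h2 lt; apply; apply: mono okk.
  rewrite cE addn1 ltnn; split => // l; rewrite ltnS leq_eqVlt => /predU1P[->//|lk].
  by apply: mono okk; exact: ltnW.
rewrite addn0; split => // _; have [/h2//|] := ltnP c k.
move=> kc; suff -> : c = k by [].
by apply/eqP; rewrite eqn_leq ck.
Qed.

(** Steering stops at the first position past 5|v| / (2 sigma), so it overshoots by at most one
    column. The block is long enough, because |v| <= sigma r / 8 keeps 5|v| below sigma r <= 2 sigma
    k. *)
Lemma steps_bounds (v : 'I_m -> R) k r : (r <= 2 * k)%N -> (1 <= r)%N ->
  Num.sqrt (\sum_i v i ^+ 2) <= sigma * r%:R / 8 ->
  5 * Num.sqrt (\sum_i v i ^+ 2) <= 2 * sigma * (steps v 0 k)%:R
    <= 5 * Num.sqrt (\sum_i v i ^+ 2) + 2 * sigma.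
Proof.
move=> rk r1; set V := \sum_i v i ^+ 2; set x := Num.sqrt V => xr.
have V0 : 0 <= V by apply: sumr_ge0 => i _; exact: sqr_ge0.
have x0 : 0 <= x by exact: sqrtr_ge0.
have x2 : x ^+ 2 = V by rewrite sqr_sqrtr.
have := steps_first v k; rewrite /=.
rewrite (_ : \sum_i v i * v i = V); last by apply: eq_bigr => i _; rewrite expr2.
move=> [h1 h2]; set c := steps v 0 k in h1 h2 *.
have okE (l : nat) : (4 * (l%:R * l%:R) * (sigma * sigma) < 25 * V) =
    (2 * sigma * l%:R < 5 * x).
  have -> : 4 * (l%:R * l%:R) * (sigma * sigma) = (2 * sigma * l%:R) ^+ 2 by ring.
  have -> : 25 * V = (5 * x) ^+ 2 by rewrite -x2; ring.
  by rewrite ltr_pXn2r// nnegrE !mulr_ge0// ltW.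
have ck : (c <= k)%N by rewrite /c /steps -[leqRHS](size_iota 0 k) count_size.
apply/andP; split.
  have [/h2|kc] := ltnP c k; first by rewrite okE -leNgt.
  have rk' : r%:R <= 2 * c%:R :> R by rewrite -natrM ler_nat; lia.
  have : sigma * r%:R <= sigma * (2 * c%:R) by rewrite ler_pM2l.
  have : 0 <= sigma * c%:R by rewrite mulr_ge0 ?ler0n// ltW.
  lra.
case: c h1 {h2 ck} => [|c] h1.
  by rewrite mulr0 addr_ge0// mulr_ge0// ltW.
have := h1 c (ltnSn c); rewrite okE => h.
by rewrite -[c.+1%:R]natr1 mulrDr mulr1 lerD2r ltW.
Qed.

(** The threshold [t] absorbs [a], and [Dl] absorbs [c] up to its own excess, which leaves at most
    |b| + |excess Dl c|. The increase of the threshold is thus spent on the fluctuation only. *)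
Lemma excess_shift (t Dl a b c : R) : 0 <= t -> 0 <= Dl -> `|a| <= t ->
  excess (t + Dl) (a + b + c) ^+ 2 <= 2 * b ^+ 2 + 2 * excess Dl c ^+ 2.
Proof.
move=> t0 D0; rewrite ler_norml => /andP[a1 a2].
have key (x y : R) : 0 <= x -> x <= `|b| + `|y| -> x ^+ 2 <= 2 * b ^+ 2 + 2 * y ^+ 2.
  move=> x0 xy; have : x ^+ 2 <= (`|b| + `|y|) ^+ 2.
    by rewrite ler_sqr ?nnegrE ?addr_ge0.
  rewrite -(real_normK (num_real b)) -(real_normK (num_real y)).
  have := sqr_ge0 (`|b| - `|y|); lra.
have b1 := ler_norm b; have b2 := ler_norm (- b); rewrite normrN in b2.
set e := excess Dl c.
have e1 : c - Dl <= `|e|.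
  rewrite /e /excess; case: ltP => h; first exact: ler_norm.
  by case: ltP => h'; have := normr_ge0 (c + Dl); rewrite ?normr0; lra.
have e2 : - c - Dl <= `|e|.
  rewrite /e /excess; case: ltP => h; first by have := normr_ge0 (c - Dl); lra.
  case: ltP => h'; last by rewrite normr0; lra.
  by have := ler_norm (- (c + Dl)); rewrite normrN; lra.
rewrite {1}/excess; case: ltP => h1; first by apply: key; lra.
case: ltP => h2; first by rewrite -sqrrN; apply: key; lra.
by rewrite expr0n/= addr_ge0// mulr_ge0 ?sqr_ge0.
Qed.

(* One phase from a fixed discrepancy vector: the drift of the block cancels the
   excess up to a quarter, and the fluctuations are subgaussian. *)
Lemma phase_failure (dd : 'I_m -> R) (t Dl : R) r js :
  uniq js -> size js = uphalf r -> (100 <= r)%N -> 0 <= t -> 0 <= Dl ->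
  \sum_i excess t (dd i) ^+ 2 <= (sigma * r%:R / 8) ^+ 2 ->
  (P [set w | ((sigma * r./2%:R / 8) ^+ 2 < \sum_i excess (t + Dl)
     (dd i + block_sum sigma f (entries w) (fun i => excess t (dd i)) 0 js i) ^+ 2)%R] <=
   (expR (2 * expR (- (3 / 32 / (sigma ^+ 2 * r%:R) * Dl ^+ 2)) * m%:R
      - 3 / 2 ^+ 17 * r%:R))%:E)%E.
Proof.
move=> ujs sjs r100 t0 D0; set v := fun i => excess t (dd i).
set V := \sum_i _ => Vr.
have V0 : 0 <= V by apply: sumr_ge0 => i _; exact: sqr_ge0.
set x := Num.sqrt V; have x0 : 0 <= x by exact: sqrtr_ge0.
have x2 : x ^+ 2 = V by rewrite sqr_sqrtr.
have r1 : 100 <= r%:R :> R by rewrite ler_nat.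
have sr0 : 0 <= sigma * r%:R / 8 by rewrite !mulr_ge0 ?ler0n// ltW.
have xr : x <= sigma * r%:R / 8.
  by rewrite -(@ler_pXn2r _ 2%N)// x2.
have rk : (r <= 2 * size js)%N by rewrite sjs leq_uphalf_double.
have /andP[c1 c2] := steps_bounds (v := v) rk (leq_trans (isT : 1 <= 100)%N r100) xr.
rewrite -/V -/x in c1 c2.
set c := steps v 0 (size js) in c1 c2.
have /andP[p1 p2] := normal_peak_bounds R.
(* The drift term in the exponent of [block_mgf], read as a vector along [v]; adding it back leaves
   a purely quadratic exponent for [G]. If [x = 0], the inverse is 0 and so is [dr]. *)
pose dr i := phi0 * sigma * c%:R * (v i / x).
pose G i w := block_sum sigma f (entries w) v 0 js i + dr i.
have mG i : measurable_fun setT (G i).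
  apply: measurable_funD => //.
  apply: (@measurable_block_sum R m n sigma f _ T
      (fun j i w => entries w j i) (fun i _ => v i) 0 js i) => [i'|j' i' jj'].
    exact: measurable_cst.
  exact: measurable_funP.
pose D := 2 * sigma ^+ 2 * r%:R.
have sg2 : 0 < sigma ^+ 2 by rewrite exprn_gt0.
have D0' : 0 < D by rewrite !mulr_gt0//; lra.
have sjr : (size js)%:R <= r%:R :> R by rewrite ler_nat sjs uphalf_leq.
have mgf (u : 'I_m -> R) : (\int[P]_w (expR (\sum_i u i * G i w))%:E <=
    (expR (D * \sum_i u i ^+ 2))%:E)%E.
  have U0 : 0 <= \sum_i u i ^+ 2 by apply: sumr_ge0 => i _; exact: sqr_ge0.
  have drE : \sum_i u i * dr i = phi0 * sigma * c%:R * ((\sum_i u i * v i) / x).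
    by rewrite mulr_suml mulr_sumr; apply: eq_bigr => i _; rewrite /dr; ring.
  under eq_integral => w _.
    rewrite (_ : \sum_i u i * G i w = \sum_i u i * dr i +
       \sum_i u i * block_sum sigma f (entries w) v 0 js i); last first.
      by rewrite -big_split/=; apply: eq_bigr => i _; rewrite /G; ring.
    rewrite expRD EFinM; over.
  rewrite ge0_integralZl//.
  - have H := block_mgf u v 0 ujs.
    apply: le_trans (lee_wpmul2l _ H) _; first by rewrite lee_fin expR_ge0.
    rewrite -EFinM lee_fin -expRD ler_expR drE -/c -/x -/V.
    rewrite addrCA subrr addr0 ler_wpM2r// /D ler_wpM2l// mulr_ge0 ?ltW//.
  - apply/measurable_EFinP; apply: (measurableT_comp (@measurable_expR R)).
    apply: measurable_sum => i; apply: measurable_funM => //.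
    apply: (@measurable_block_sum R m n sigma f _ T
      (fun j i w => entries w j i) (fun i _ => v i) 0 js i) => [i'|j' i' jj'].
      exact: measurable_cst.
    exact: measurable_funP.
pose theta := 3 / 32 / (sigma ^+ 2 * r%:R) : R.
have th0 : 0 <= theta by rewrite /theta divr_ge0// mulr_ge0 ?ler0n// ltW.
have thD : theta * D = 3 / 16.
  rewrite /theta /D; field; rewrite !gt_eqF//=; lra.
(* The fluctuation may have excess of norm sigma r / 64; with [theta] forced by
   [theta * D = 3 / 16], this yields the exponent [3 / 2 ^+ 17 * r]. *)
pose B := (sigma * r%:R / 64) ^+ 2.
have thB : theta * B = 3 / 2 ^+ 17 * r%:R.
  rewrite /theta /B; field; rewrite !gt_eqF//=; lra.
have := excess_norm_tail mG mgf B th0 thD D0.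
rewrite thB; apply: le_trans.
have mGe (tt : R) (F : 'I_m -> T -> R) (b : R) : (forall i, measurable_fun setT (F i)) ->
    measurable [set w | (b < \sum_i excess tt (F i w) ^+ 2)%R].
  move=> mF; apply: measurable_bool_set; apply: measurable_fun_ltr => //.
  by apply: measurable_sum => i; apply: measurable_funX; exact: measurable_excess.
apply: le_measure; rewrite ?inE.
- apply: mGe => i; apply: measurable_funD => //.
  apply: (@measurable_block_sum R m n sigma f _ T
      (fun j i w => entries w j i) (fun i _ => v i) 0 js i) => [i'|j' i' jj'].
    exact: measurable_cst.
  exact: measurable_funP.
- exact: mGe.
move=> w /=; apply: contraTT; rewrite -!leNgt => hB.
(* The steering count is 5x / (2 sigma) up to one more, and [phi0] is between 1/3 and 1/2. So the
   drift has length between 5x/6 and 5x/4 + sigma/2, and differs from [v] by at most x/4 +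
   sigma/2. *)
have Vdr : \sum_i (v i - dr i) ^+ 2 <= (x / 4 + sigma / 2) ^+ 2.
  have [x0'|xp] := eqVneq x 0.
    have Vz : V = 0 by rewrite -x2 x0' expr0n.
    rewrite (_ : \sum_i _ = V).
      by rewrite Vz sqr_ge0.
    by apply: eq_bigr => i _; rewrite /dr x0' invr0 mulr0 mulr0 subr0.
  pose g := phi0 * sigma * c%:R / x.
  have -> : \sum_i (v i - dr i) ^+ 2 = ((1 - g) * x) ^+ 2.
    rewrite exprMn x2 mulr_sumr; apply: eq_bigr => i _.
    by rewrite -/(v i) -exprMn /g /dr; congr (_ ^+ 2); ring.
  have -> : (1 - g) * x = x - phi0 * (sigma * c%:R).
    by rewrite /g; field.
  have q1 : phi0 * (5 * x) <= phi0 * (2 * sigma * c%:R) by apply: ler_wpM2l => //; lra.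
  have q2 : phi0 * (2 * sigma * c%:R) <= phi0 * (5 * x + 2 * sigma).
    by apply: ler_wpM2l => //; lra.
  have q3 : 1 / 3 * x <= phi0 * x by apply: ler_wpM2r.
  have q4 : phi0 * x <= 1 / 2 * x by apply: ler_wpM2r.
  have q5 : phi0 * sigma <= 1 / 2 * sigma by apply: ler_wpM2r => //; exact: ltW.
  set y := x - _; set z := x / 4 + sigma / 2.
  have yz1 : 0 <= z - y by rewrite /y /z; lra.
  have yz2 : 0 <= z + y by rewrite /y /z; lra.
  by rewrite -subr_ge0 subr_sqr mulr_ge0.
apply: (@le_trans _ _ (\sum_i (2 * (v i - dr i) ^+ 2 + 2 * excess Dl (G i w) ^+ 2))).
  apply: ler_sum => i _.
  have -> : dd i + block_sum sigma f (entries w) v 0 js i =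
      (dd i - v i) + (v i - dr i) + G i w by rewrite /G; ring.
  apply: excess_shift => //.
  rewrite /v /excess ler_norml; case: ltP => h; first by apply/andP; split; lra.
  by case: ltP => h'; apply/andP; split; lra.
rewrite big_split/= -!mulr_sumr.
have r2 : r%:R - 1 <= 2 * r./2%:R :> R.
  by rewrite lerBlDr -natrM natr1 ler_nat leq_half_double1.
set s := sigma * r%:R in sr0 xr hB *.
have s1 : 100 * sigma <= s by rewrite /s mulrC ler_pM2l.
(* 29/800 is 1/32 + 1/200, from x <= s/8 and sigma <= s/100; 99/1600 is (1 - 1/100)/16 and accounts
   for the rounding in [r./2]. What remains is 2 (29/800)^2 + 2/64^2 <= (99/1600)^2. *)
have hx : x / 4 + sigma / 2 <= s * (29 / 800) by lra.
have hx2 : (x / 4 + sigma / 2) ^+ 2 <= (s * (29 / 800)) ^+ 2.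
  by rewrite ler_pXn2r// nnegrE; lra.
have hr : s * (99 / 1600) <= sigma * r./2%:R / 8.
  have : sigma * (r%:R - 1) <= sigma * (2 * r./2%:R) by rewrite ler_pM2l.
  rewrite mulrBr mulr1 -/s; lra.
have hr2 : (s * (99 / 1600)) ^+ 2 <= (sigma * r./2%:R / 8) ^+ 2.
  by rewrite ler_pXn2r// nnegrE; lra.
move: hB; rewrite /B => hB.
have s20 := sqr_ge0 s.
apply: le_trans hr2.
apply: (@le_trans _ _ (2 * (s * (29 / 800)) ^+ 2 + 2 * (s / 64) ^+ 2)).
  by apply: lerD; apply: ler_wpM2l => //; exact: le_trans hx2.
rewrite !exprMn; lra.
Qed.

End BlockMGF.

Lemma size_drop_uphalf (T : Type) (s : seq T) :
  size (drop (uphalf (size s)) s) = (size s)./2.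
Proof.
by rewrite size_drop uphalf_half; have := odd_double_half (size s); rewrite -muln2; lia.
Qed.

(** The integral of a nonnegative function is a supremum over simple functions below it, hence
    monotone without any measurability. This spares the measurability of inner integrals. *)
Lemma le_ge0_integral d (T : measurableType d) (R : realType)
    (mu : {measure set T -> \bar R}) (f g : T -> \bar R) :
  (forall x, 0 <= f x)%E -> (forall x, f x <= g x)%E ->
  (\int[mu]_x f x <= \int[mu]_x g x)%E.
Proof.
move=> f0 fg; rewrite !ge0_integralTE//; last by move=> x; exact: le_trans (fg x).
by apply: ereal_sup_le => _ [h /= hf <-]; exists h => // x; exact: le_trans (fg x).
Qed.

Lemma measurable_exists_ord d (T : measurableType d) m (b : 'I_m -> T -> bool) :
  (forall i, measurable_fun setT (b i)) ->
  measurable_fun setT (fun w => [exists i, b i w]).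
Proof.
move=> mb; rewrite (_ : (fun w => _) = (fun w => has (b ^~ w) (enum 'I_m))); last first.
  apply/funext => w; apply/existsP/hasP => [[i h]|[i _ h]]; exists i => //.
  by rewrite mem_enum.
elim: (enum 'I_m) => [|i e IH] /=; first exact: measurable_cst.
exact: measurable_or.
Qed.

Lemma integral_bool d (T : measurableType d) (R : realType)
    (P : probability T R) (b : T -> bool) : measurable [set w | b w] ->
  (\int[P]_w (b w)%:R%:E = P [set w | b w])%E.
Proof.
move=> mb; rewrite -[X in P X]setIT -integral_indic//; apply: eq_integral => w _.
rewrite indicE; suff -> : (w \in [set w | b w]) = b w by [].
by apply/idP/idP; rewrite inE.
Qed.

(** * The sequence of phases *)

Section Phases.
Context (R : realType) (m n : nat).
Implicit Types (a : 'I_n -> 'I_m -> R).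
Variables (sigma : R) (f : 'I_n -> R) (scale : nat) (js : seq 'I_n).

Definition rest (k : nat) : seq 'I_n :=
  iter k (fun s => drop (uphalf (size s)) s) js.

Definition thr_at (k : nat) : R := iter k (next_thr sigma scale) 0.

Definition block (k : nat) : seq 'I_n := take (uphalf (size (rest k))) (rest k).

(** Every phase is treated as active here; [walk_cols_at] identifies this with the walk for as long
    as that is the case. *)
Fixpoint disc_at a (k : nat) : 'I_m -> R :=
  if k is k'.+1 then fun i => disc_at a k' i +
    block_sum sigma f a (fun i => excess (thr_at k') (disc_at a k' i)) 0 (block k') i
  else fun=> 0.

Lemma size_rest k : size (rest k.+1) = (size (rest k))./2.
Proof. exact: size_drop_uphalf. Qed.

Lemma size_block k : size (block k) = uphalf (size (rest k)).
Proof. by rewrite size_takel// uphalf_leq. Qed.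

Lemma mem_rest k : {subset rest k.+1 <= rest k}.
Proof. by move=> j; exact: mem_drop. Qed.

Lemma mem_block k : {subset block k <= rest k}.
Proof. by move=> j; exact: mem_take. Qed.

Lemma mem_rest0 k : {subset rest k <= js}.
Proof. by elim: k => [|k IH] j // /mem_rest /IH. Qed.

Lemma size_rest_sub k : (size (rest k) <= size js - k)%N.
Proof. by elim: k => [|k IH]; [rewrite subn0|rewrite size_rest; lia]. Qed.

Lemma size_rest_exp k : (size (rest k) * 2 ^ k <= size js)%N.
Proof.
elim: k => [|k IH]; first by rewrite muln1.
apply: leq_trans IH; rewrite size_rest expnS mulnA leq_mul2r; apply/orP; right.
by rewrite muln2 -[leqRHS]odd_double_half leq_addl.
Qed.

Hypothesis ujs : uniq js.

Lemma uniq_rest k : uniq (rest k).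
Proof. by elim: k => //= k IH; rewrite drop_uniq. Qed.

Lemma block_notin_rest k j : j \in block k -> j \notin rest k.+1.
Proof.
have := uniq_rest k; rewrite -{1}(cat_take_drop (uphalf (size (rest k))) (rest k)).
rewrite cat_uniq => /and3P[_ /hasPn h _] jb; apply/negP => /h.
by rewrite jb.
Qed.

(** Measurability is assumed only for the columns already consumed, so the result also holds for the
    sigma-algebra that these generate, as [decoupling] requires. *)
Lemma measurable_disc_at d (U : measurableType d) (a : 'I_n -> 'I_m -> U -> R) k i :
  (forall j i, j \in js -> j \notin rest k -> measurable_fun setT (a j i)) ->
  measurable_fun setT (fun w => disc_at (fun j i => a j i w) k i).
Proof.
elim: k i => [|k IH] i ma /=; first exact: measurable_cst.
have {}IH i' : measurable_fun setT (fun w => disc_at (fun j i => a j i w) k i').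
  by apply: IH => j i'' jj jk; apply: ma => //; apply: contra jk => /mem_rest.
apply: measurable_funD => //.
apply: (@measurable_block_sum R m n sigma f _ U a
  (fun i w => excess (thr_at k) (disc_at (fun j i => a j i w) k i))).
  by move=> i'; exact: measurable_excess.
move=> j i' jb; apply: ma; last exact: block_notin_rest.
exact/mem_rest0/mem_block/jb.
Qed.

Variable active : nat -> bool.
Hypothesis active0 : ~~ active 0.

Definition walk_at a (k : nat) : walk R m :=
  Walk (disc_at a k) (fun i => if active (size (rest k))
    then excess (thr_at k) (disc_at a k i) else 0) (thr_at k) (size (rest k)) 0.

Lemma walk_cols_at a k : (forall l, (l < k)%N -> active (size (rest l))) ->
  walk_cols sigma f scale active a (walk0 R m (size js)) js =
  walk_cols sigma f scale active a (walk_at a k) (rest k).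
Proof.
elim: k => [|k IH] act.
  (* At the start [excess 0 0 = 0], so the zero direction of [walk0] is right whether or not phase 0
     is active. *)
  congr walk_cols; rewrite /walk0 /walk_at/=; congr Walk; apply/funext => i.
  by rewrite /excess oppr0 ltxx if_same.
rewrite IH; last by move=> l lk; apply: act; exact: ltnW.
have ak := act k (ltnSn k).
rewrite -{1}(cat_take_drop (uphalf (size (rest k))) (rest k)).
rewrite /walk_cols foldl_cat; congr (foldl _ _ _).
rewrite -/(walk_cols sigma f scale active a (walk_at a k) (block k)).
rewrite /walk_at ak walk_cols_phase ?size_block//.
  by rewrite /phase_end -size_rest.
case: (size (rest k)) ak => [|r] ak; last by rewrite uphalfE.
by have := active0; rewrite ak.
Qed.

Lemma disc_walk_cols a K i : (forall l, (l < K)%N -> active (size (rest l))) ->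
  (forall r, (r <= size (rest K))%N -> ~~ active r) ->
  disc (walk_cols sigma f scale active a (walk0 R m (size js)) js) i =
  disc_at a K i + \sum_(j <- rest K) a j i * - f j.
Proof.
move=> act nact; rewrite (walk_cols_at _ act) /walk_at.
by rewrite (negbTE (nact _ (leqnn _))) disc_walk_cols_inactive.
Qed.

End Phases.

(** * The invariant along the phases, and the columns rounded down at the end *)

Section Chain.
Context (d : measure_display) (T : measurableType d) (R : realType).
Variables (P : probability T R) (m n : nat) (X : 'I_m * 'I_n -> {RV P >-> R}).
Variables (sigma : R) (f : 'I_n -> R) (scale : nat) (js : seq 'I_n).
Hypotheses (sigma_gt0 : 0 < sigma) (indepX : independent_family X).
Hypothesis gaussX : forall i, gaussian 0 sigma (X i).
Hypothesis f01 : forall j, 0 <= f j <= 1.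
Hypothesis ujs : uniq js.
Notation rest := (rest js).
Notation block := (block js).
Notation thr_at := (thr_at sigma scale).
Notation disc_at w := (disc_at sigma f scale js (entries X w)).

Definition overflow (k : nat) (D : 'I_m -> R) : bool :=
  (sigma * (size (rest k))%:R / 8) ^+ 2 < \sum_i excess (thr_at k) (D i) ^+ 2.

Lemma measurable_overflow d' (U : measurableType d') k (D : 'I_m -> U -> R) :
  (forall i, measurable_fun setT (D i)) ->
  measurable_fun setT (fun w => overflow k (D ^~ w)).
Proof.
move=> mD; apply: measurable_fun_ltr => //.
by apply: measurable_sum => i; apply: measurable_funX; exact: measurable_excess.
Qed.

Lemma measurable_disc_at_entries k i : measurable_fun setT (fun w => disc_at w k i).
Proof.
apply: (@measurable_disc_at R m n sigma f scale js ujs _ T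
  (fun j i w => entries X w j i) k i) => j i' _ _.
exact: measurable_funP.
Qed.

(** Either the invariant was already violated, or it breaks in this phase. For the latter the past
    columns are frozen, and [phase_failure] is uniform in the starting vector. *)
Lemma overflow_step k (eps : R) : (100 <= size (rest k))%N ->
  0 <= thr_at k <= thr_at k.+1 -> 0 <= eps ->
  expR (2 * expR (- (3 / 32 / (sigma ^+ 2 * (size (rest k))%:R) *
      (thr_at k.+1 - thr_at k) ^+ 2)) * m%:R
      - 3 / 2 ^+ 17 * (size (rest k))%:R) <= eps ->
  (P [set w | overflow k.+1 (disc_at w k.+1)] <=
   P [set w | overflow k (disc_at w k)] + eps%:E)%E.
Proof.
move=> r100 /andP[t0 tS] eps0 heps.
have mbad l : measurable [set w | overflow l (disc_at w l)].
  apply: measurable_bool_set; apply: (@measurable_overflow _ T l (fun i w => disc_at w l i)).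
  by move=> i; exact: measurable_disc_at_entries.
(* Of the two sample points, [w1] supplies the columns of the earlier phases and [w2] those of the
   current block. *)
pose nxt w1 w2 i := disc_at w1 k i +
  block_sum sigma f (entries X w2) (fun i => excess (thr_at k) (disc_at w1 k i))
    0 (block k) i.
pose b w1 w2 := ~~ overflow k (disc_at w1 k) && overflow k.+1 (nxt w1 w2).
pose h w1 w2 : \bar R := ((b w1 w2)%:R)%:E.
pose past := [seq j <- js | j \notin rest k].
have mb : measurable_fun setT ((fun w => b w.1 w.2) :
    sub_space X (col_set m past) * sub_space X (col_set m (block k)) -> bool).
  have mD i : measurable_fun setT ((fun w => disc_at w.1 k i) :
    sub_space X (col_set m past) * sub_space X (col_set m (block k)) -> R).
    apply: (@measurable_disc_at R m n sigma f scale js ujs _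
      (sub_space X (col_set m past) * sub_space X (col_set m (block k)))%type
      (fun j i w => entries X w.1 j i) k i) => j i' jj jk.
    apply: (@measurableT_comp _ _ _ _ _ _
      ((fun w => entries X w j i') : sub_space X (col_set m past) -> R)) => //.
    by apply: measurable_entry; rewrite mem_filter jk.
  apply: measurable_and.
    apply: measurable_neg.
    exact: (@measurable_overflow _
      (sub_space X (col_set m past) * sub_space X (col_set m (block k)))%type k
      (fun i w => disc_at w.1 k i)).
  apply: (@measurable_overflow _
      (sub_space X (col_set m past) * sub_space X (col_set m (block k)))%type k.+1
      (fun i w => nxt w.1 w.2 i)) => i.
  apply: measurable_funD => //.
  apply: (@measurable_block_sum R m n sigma f _
    (sub_space X (col_set m past) * sub_space X (col_set m (block k)))%type
    (fun j i w => entries X w.2 j i)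
    (fun i w => excess (thr_at k) (disc_at w.1 k i))).
    by move=> i'; exact: measurable_excess.
  move=> j i' jb.
  apply: (@measurableT_comp _ _ _ _ _ _
      ((fun w => entries X w j i') : sub_space X (col_set m (block k)) -> R)) => //.
  exact: measurable_entry.
have dis : [disjoint col_set m past & col_set m (block k)]%B.
  apply: disjoint_col_set => j; rewrite mem_filter => /andP[jk _].
  by apply: contra jk => /mem_block.
have mh : measurable_fun setT ((fun w => h w.1 w.2) :
    sub_space X (col_set m past) * sub_space X (col_set m (block k)) -> \bar R).
  by apply/measurable_EFinP; exact: measurable_boolR.
have h0 w1 w2 : (0 <= h w1 w2)%E by rewrite lee_fin.
have dec := decoupling indepX dis mh h0.
pose E := [set w | b w w].
have mE : measurable E.
  have -> : E = ~` [set w | overflow k (disc_at w k)] `&`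
      [set w | overflow k.+1 (disc_at w k.+1)].
    by apply/seteqP; split => w /=; rewrite /E/= /b; [move=> /andP[/negP]|move=> [/negP ->]].
  by apply: measurableI => //; exact: measurableC.
apply: (@le_trans _ _ (P ([set w | overflow k (disc_at w k)] `|` E))).
  apply: le_measure; rewrite ?inE//; first exact: measurableU.
  move=> w /= ov; case: (boolP (overflow k (disc_at w k))) => h1; first by left.
  by right; rewrite /E /= /b h1.
apply: (le_trans (measureU2 _ _ _)) => //.
apply: leeD => //.
have PE : P E = (\int[P]_w h w w)%E.
  by rewrite integral_bool.
apply: (@le_trans _ _ (\int[P]_w h w w)%E).
  by rewrite le_eqVlt; apply/predU1P; left; exact: PE.
rewrite dec.
have step w1 : (\int[P]_w2 h w1 w2 <= eps%:E)%E.
  rewrite /h /b; case: (boolP (overflow k (disc_at w1 k))) => /= ov.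
    by rewrite integral0_eq// lee_fin.
  move: ov; rewrite /overflow -leNgt => ov.
  have := phase_failure sigma_gt0 indepX gaussX f01 (take_uniq _ (uniq_rest ujs k))
    (size_block js k) r100 t0 (_ : 0 <= thr_at k.+1 - thr_at k) ov.
  rewrite subr_ge0 => /(_ tS).
  rewrite addrC subrK -size_rest => H.
  have mB : measurable [set w | overflow k.+1 (nxt w1 w)].
    apply: measurable_bool_set; apply: (@measurable_overflow _ T k.+1 (fun i w => nxt w1 w i)).
    move=> i; apply: measurable_funD => //.
    apply: (@measurable_block_sum R m n sigma f _ T
      (fun j i w => entries X w j i) (fun i _ => excess (thr_at k) (disc_at w1 k i))).
      by move=> i'; exact: measurable_cst.
    by move=> j i' _; exact: measurable_funP.
  by rewrite integral_bool//; apply: (le_trans H); rewrite lee_fin.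
apply: (@le_trans _ _ (\int[P]_w1 (eps%:E))%E).
  by apply: le_ge0_integral => // w1; exact: integral_ge0.
by rewrite integral_cst//= probability_setT mule1.
Qed.

Lemma overflow_chain K (eps : R) : 0 <= eps ->
  (forall k, (k < K)%N -> [/\ (100 <= size (rest k))%N, 0 <= thr_at k <= thr_at k.+1 &
    expR (2 * expR (- (3 / 32 / (sigma ^+ 2 * (size (rest k))%:R) *
      (thr_at k.+1 - thr_at k) ^+ 2)) * m%:R
      - 3 / 2 ^+ 17 * (size (rest k))%:R) <= eps]) ->
  (P [set w | overflow K (disc_at w K)] <= (K%:R * eps)%:E)%E.
Proof.
move=> eps0; elim: K => [_|K IH h].
  rewrite mul0r (_ : [set w | _] = set0) ?measure0//; apply/seteqP; split => // w /=.
  rewrite /overflow/= big1; last by move=> i _; rewrite /excess oppr0 ltxx expr0n.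
  by move/lt_geF; rewrite sqr_ge0.
have [h1 h2 h3] := h K (ltnSn K).
apply: (le_trans (overflow_step h1 h2 eps0 h3)).
rewrite -[K.+1%:R]natr1 mulrDl mul1r EFinD leeD2r//.
by apply: IH => k kK; apply: h; exact: ltnW.
Qed.

(** Chernoff's bound with the optimal parameter [l], and a union bound over rows and signs. The real
    [r] only dominates the number of columns, so that it can be [n] or its square root. *)
Lemma floors_tail (s : seq 'I_n) (y r : R) : uniq s -> 0 <= y -> 0 < r ->
  (size s)%:R <= r ->
  (P [set w | [exists i : 'I_m, (y < `|\sum_(j <- s) entries X w j i * - f j|)%R]] <=
   (2 * m%:R * expR (- (y ^+ 2 / (2 * sigma ^+ 2 * r))))%:E)%E.
Proof.
move=> us y0 r0 sr.
have s2 : 0 < sigma ^+ 2 by rewrite exprn_gt0.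
pose l := y / (sigma ^+ 2 * r).
pose Y i w := \sum_(j <- s) entries X w j i * - f j.
have mY i : measurable_fun setT (Y i).
  by apply: measurable_sum => j; apply: measurable_funM.
pose G (c : R) i w := expR (c * (l * Y i w)).
have mG c i : measurable_fun setT (G c i).
  apply: (measurableT_comp (@measurable_expR R)).
  by apply: measurable_funM => //; apply: measurable_funM.
have mgf c i : c ^+ 2 <= 1 -> (\int[P]_w (G c i w)%:E <=
    (expR (sigma ^+ 2 * l ^+ 2 * r / 2))%:E)%E.
  move=> c1; pose si := [seq (i, j) | j <- s].
  have usi : uniq si by rewrite map_inj_uniq// => ? ? [].
  have := fixed_column_mgf sigma_gt0 indepX gaussX (fun e => - (l * f e.2)) usi c1.
  rewrite /si !big_map/= => H.
  rewrite (_ : (\int[P]_w _)%E = (\int[P]_w (expR (c * (\sum_(j <- s)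
      - (l * f j) * X (i, j) w)))%:E)%E); last first.
    apply: eq_integral => w _; rewrite /G /Y mulr_sumr/=.
    by congr ((expR (c * _))%:E); apply: eq_bigr => j _; rewrite /entries; ring.
  apply: (le_trans _ (le_trans H _)).
    by rewrite le_eqVlt; apply/predU1P; left; apply: eq_integral => w _; rewrite big_map.
  rewrite lee_fin ler_expR ler_pM2r// -mulrA ler_pM2l//.
  apply: (@le_trans _ _ (\sum_(j <- s) l ^+ 2)).
    apply: ler_sum => j _; rewrite sqrrN exprMn -[leRHS]mulr1 ler_wpM2l ?sqr_ge0//.
    by have /andP[a b] := f01 j; rewrite expr_le1.
  rewrite big_const_seq count_predT iter_addr_0 -mulr_natr ler_wpM2l ?sqr_ge0//.
pose F w := expR (- (l * y)) * \sum_i (G 1 i w + G (-1) i w).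
have G0 c i w : 0 <= G c i w by exact: expR_ge0.
have mS : measurable_fun setT (fun w => \sum_i (G 1 i w + G (-1) i w)).
  by apply: measurable_sum => i; exact: measurable_funD.
have lr : 0 < sigma ^+ 2 * r by rewrite mulr_gt0.
apply: (@le_trans _ _ (\int[P]_w (F w)%:E)%E).
  apply: le_probability_mean.
  - apply: measurable_bool_set.
    apply: measurable_exists_ord => i; apply: measurable_fun_ltr => //.
    by apply: measurableT_comp => //; exact: (mY i).
  - exact: measurable_funM.
  - by move=> w; rewrite mulr_ge0 ?expR_ge0// sumr_ge0// => i _; rewrite addr_ge0.
  - move=> w /existsP[i]; rewrite -/(Y i w) => yY.
    have l0 : 0 <= l by rewrite /l divr_ge0// ltW.
    rewrite /F (bigD1 i)//= mulrDr -[leLHS]addr0; apply: lerD; last first.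
      by rewrite mulr_ge0 ?expR_ge0// sumr_ge0// => j _; rewrite addr_ge0.
    have h : 1 <= expR (- (l * y)) * expR (l * `|Y i w|).
      by rewrite -expRD -expR0 ler_expR addrC -mulrBr mulr_ge0// subr_ge0 ltW.
    apply: (le_trans h); rewrite ler_wpM2l ?expR_ge0// /G mul1r mulN1r.
    have [Y0|Y0] := leP 0 (Y i w).
      by rewrite ger0_norm// lerDl expR_ge0.
    by rewrite ltr0_norm// mulrN lerDr expR_ge0.
rewrite (_ : (\int[P]_w _)%E = ((expR (- (l * y)))%:E *
    \sum_i (\int[P]_w (G 1%R i w)%:E + \int[P]_w (G (-1)%R i w)%:E))%E); last first.
  rewrite /F; under eq_integral do rewrite EFinM.
  rewrite ge0_integralZl//; last first.
  - by move=> w _; rewrite lee_fin sumr_ge0// => j _; rewrite addr_ge0.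
  - exact/measurable_EFinP.
  congr (_ * _)%E.
  under eq_integral do rewrite -sumEFin.
  rewrite ge0_integral_sum//; last first.
  - by move=> i w _; rewrite lee_fin addr_ge0.
  - by move=> i; apply/measurable_EFinP; exact: measurable_funD.
  apply: eq_bigr => i _; under eq_integral do rewrite EFinD.
  rewrite ge0_integralD//.
  - by move=> w _; rewrite lee_fin.
  - exact/measurable_EFinP.
  - by move=> w _; rewrite lee_fin.
  - exact/measurable_EFinP.
apply: (@le_trans _ _ ((expR (- (l * y)))%:E * \sum_(i < m)
    (2 * expR (sigma ^+ 2 * l ^+ 2 * r / 2))%:E)%E).
  apply: lee_wpmul2l; first by rewrite lee_fin expR_ge0.
  apply: lee_sum => i _; rewrite mulrDl !mul1r EFinD; apply: leeD; apply: mgf.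
    by rewrite expr1n.
  by rewrite sqrrN expr1n.
rewrite sumEFin -EFinM lee_fin big_const_ord iter_addr_0.
rewrite -[_ *+ m]mulr_natr; set a := expR (- (l * y)); set b := expR (_ / 2).
have -> : a * (2 * b * m%:R) = 2 * m%:R * (a * b) by ring.
rewrite /a /b -expRD ler_wpM2l ?mulr_ge0// ler_expR /l.
rewrite le_eqVlt; apply/predU1P; left; field.
by rewrite !gt_eqF.
Qed.

(** A coordinate of the excess is at most its Euclidean norm; here the invariant is turned back into
    a bound on every row. *)
Lemma disc_bound w K (y : R) i : 0 <= thr_at K -> ~~ overflow K (disc_at w K) ->
  `|\sum_(j <- rest K) entries X w j i * - f j| <= y ->
  `|disc_at w K i + \sum_(j <- rest K) entries X w j i * - f j| <=
    thr_at K + sigma * (size (rest K))%:R / 8 + y.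
Proof.
move=> t0; rewrite /overflow -leNgt => ov hy.
apply: (le_trans (ler_normD _ _)); apply: lerD => //.
have sr0 : 0 <= sigma * (size (rest K))%:R / 8 by rewrite !mulr_ge0 ?ler0n// ltW.
have h : `|excess (thr_at K) (disc_at w K i)| <= sigma * (size (rest K))%:R / 8.
  rewrite -(ler_pXn2r (n := 2))// ?nnegrE// real_normK ?num_real//.
  apply: le_trans ov; rewrite (bigD1 i)//= lerDl.
  by apply: sumr_ge0 => j _; exact: sqr_ge0.
have : `|disc_at w K i| <= thr_at K + `|excess (thr_at K) (disc_at w K i)|.
  rewrite /excess; set x := disc_at w K i; set t := thr_at K in t0 *.
  rewrite -/t; case: ltP => h1.
    by rewrite !ger0_norm; lra.
  case: ltP => h2; first by rewrite !ltr0_norm; lra.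
  by rewrite normr0 ler_norml; lra.
by move/le_trans; apply; rewrite lerD2l.
Qed.

End Chain.

(** * Numerical bounds *)

Section Exponents.
Context {R : realType}.

Lemma expR_nat_ge (k : nat) : 2 ^+ k <= expR k%:R :> R.
Proof.
rewrite -[k%:R]mul1r expRM_natr lerXn2r ?nnegrE ?expR_ge0//.
by have := expR_ge1Dx (1 : R); lra.
Qed.

Lemma ln2_ge : 1 / 2 <= ln 2 :> R.
Proof.
rewrite -ler_expR lnK ?posrE//.
have := expR_ge1Dx (- (1 / 2) : R); rewrite expRN => h.
have e0 := expR_gt0 (1 / 2 : R).
have : expR (1 / 2) * (1 + - (1 / 2)) <= expR (1 / 2) * (expR (1 / 2))^-1 :> R.
  by rewrite ler_pM2l.
rewrite divff ?gt_eqF//; lra.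
Qed.

(* The total exponent is at least 18 + L + k + (Q - 1) with Q = n / (r 2^k), and
   e >= 2, e^(Q-1) >= Q. *)
Lemma phase_exponent (n r L S k m : nat) : (0 < r)%N -> (r * 2 ^ k <= n)%N ->
  (n * L <= S * S)%N -> (m <= n * 2 ^ L)%N -> (0 < L)%N ->
  2 ^+ 18 * m%:R <= r%:R * expR (24 * (S%:R ^+ 2 * (9 / 16) ^+ k / r%:R)) :> R.
Proof.
move=> r0 rk nL mL L0.
have rR : 0 < r%:R :> R by rewrite ltr0n.
have p2 : 0 < 2 ^+ k :> R by rewrite exprn_gt0.
pose Q : R := n%:R / (r%:R * 2 ^+ k).
have Q1 : 1 <= Q.
  by rewrite /Q ler_pdivlMr ?mulr_gt0// mul1r -natrX -natrM ler_nat.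
have L1 : 1 <= L%:R :> R by rewrite ler1n.
have LQ1 : 0 <= (L%:R - 1) * (Q - 1) by rewrite mulr_ge0// subr_ge0.
(* By S^2 >= n L the right side is at least L Q (9/8)^k, as 9/16 competes with the halving of the
   columns; Bernoulli's inequality gives the factor [1 + k / 8]. *)
have E1 : L%:R * Q * (1 + k%:R / 8) <= S%:R ^+ 2 * (9 / 16) ^+ k / r%:R.
  apply: (@le_trans _ _ (L%:R * Q * (9 / 8) ^+ k)).
    apply: ler_wpM2l; first by rewrite mulr_ge0//; lra.
    elim: (k) => [|j IH]; first by rewrite expr0; lra.
    rewrite exprS -[j.+1%:R]natr1; have : 0 <= j%:R :> R by []; lra.
  have -> : L%:R * Q * (9 / 8) ^+ k = (n%:R * L%:R) * (9 / 16) ^+ k / r%:R.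
    have -> : 9 / 8 = 9 / 16 * 2 :> R by lra.
    by rewrite /Q exprMn; field; rewrite !gt_eqF.
  rewrite ler_pM2r ?invr_gt0// ler_wpM2r ?exprn_ge0//.
  by rewrite expr2 -!natrM ler_nat.
have kQ : 0 <= k%:R * (L%:R * Q - 1) by rewrite mulr_ge0//; lra.
have E2 : 18%:R + L%:R + k%:R + (Q - 1) <= 24 * (S%:R ^+ 2 * (9 / 16) ^+ k / r%:R).
  apply: (@le_trans _ _ (24 * (L%:R * Q * (1 + k%:R / 8)))); last by rewrite ler_pM2l.
  have k0 : 0 <= k%:R :> R by [].
  have -> : 24 * (L%:R * Q * (1 + k%:R / 8)) =
    24 * (L%:R * Q) + 3 * (k%:R * (L%:R * Q - 1)) + 3 * k%:R by field.
  lra.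
apply: (@le_trans _ _ (r%:R * expR (18%:R + L%:R + k%:R + (Q - 1)))); last first.
  by rewrite ler_pM2l// ler_expR.
rewrite (expRD _ (Q - 1)) (expRD _ k%:R) (expRD 18%:R).
apply: (@le_trans _ _ (r%:R * (2 ^+ 18 * 2 ^+ L * 2 ^+ k * Q))); last first.
  have Q0 : 0 <= Q by lra.
  have pw j : 0 <= 2 ^+ j :> R by rewrite exprn_ge0.
  have p1 : 0 <= 2 ^+ 18 * 2 ^+ L :> R by exact: mulr_ge0.
  have p3 : 0 <= 2 ^+ 18 * 2 ^+ L * 2 ^+ k :> R by exact: mulr_ge0.
  rewrite ler_pM2l//; apply: ler_pM => //.
    by apply: ler_pM => //; [apply: ler_pM => //|]; exact: expR_nat_ge.
  by have := expR_ge1Dx (Q - 1); lra.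
have -> : r%:R * (2 ^+ 18 * 2 ^+ L * 2 ^+ k * Q) = 2 ^+ 18 * (n%:R * 2 ^+ L).
  by rewrite /Q; field; rewrite !gt_eqF.
by rewrite ler_pM2l ?exprn_gt0// -natrX -natrM ler_nat.
Qed.

(** By [phase_exponent] the first term of the exponent is at most r / 2^17, a third of the second
    one; the remaining r / 2^16 dominates [t]. *)
Lemma phase_failure_bound (n r L S k m : nat) (sigma t : R) : 0 < sigma ->
  (0 < r)%N -> (r * 2 ^ k <= n)%N ->
  (n * L <= S * S)%N -> (m <= n * 2 ^ L)%N -> (0 < L)%N ->
  t <= r%:R / 2 ^+ 16 ->
  expR (2 * expR (- (3 / 32 / (sigma ^+ 2 * r%:R) *
      (16 * (sigma * S%:R) * (3 / 4) ^+ k) ^+ 2)) * m%:R - 3 / 2 ^+ 17 * r%:R)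
    <= expR (- t).
Proof.
move=> s0 r0 rk nL mL L0 tr; rewrite ler_expR.
have rR : 0 < r%:R :> R by rewrite ltr0n.
have := phase_exponent r0 rk nL mL L0.
have -> : 3 / 32 / (sigma ^+ 2 * r%:R) * (16 * (sigma * S%:R) * (3 / 4) ^+ k) ^+ 2
    = 24 * (S%:R ^+ 2 * (9 / 16) ^+ k / r%:R) :> R.
  have -> : 9 / 16 = (3 / 4) ^+ 2 :> R by lra.
  rewrite -exprM mulnC exprM; set q := (3 / 4) ^+ k.
  by field; rewrite !gt_eqF.
set e := 24 * _; rewrite expRN => h.
have e0 := expR_gt0 e.
have h1 : m%:R / expR e <= r%:R / 2 ^+ 18 :> R.
  by rewrite ler_pdivlMr ?exprn_gt0// mulrAC ler_pdivrMr// mulrC.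
have -> : 2 * (expR e)^-1 * m%:R = 2 * (m%:R / expR e) by ring.
have : 2 * (m%:R / expR e) <= 2 * (r%:R / 2 ^+ 18) by rewrite ler_pM2l.
have -> : 2 * (r%:R / 2 ^+ 18) = r%:R / 2 ^+ 17 :> R by field.
have -> : r%:R / 2 ^+ 17 = r%:R / 2 ^+ 16 / 2 :> R by field.
have -> : 3 / 2 ^+ 17 * r%:R = 3 * (r%:R / 2 ^+ 16) / 2 :> R by field.
lra.
Qed.

End Exponents.

Section Scales.
Context (R : realType) (n m : nat).
Hypotheses (n_gt0 : (0 < n)%N) (mn : (2 * n <= m)%N).
Notation L := (doublings m n_gt0).
Notation S := (root_ceil (n * L)).
Notation ell := (ln (m%:R / n%:R) : R).

Lemma doublings_ge : (m <= n * 2 ^ L)%N.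
Proof. by rewrite /doublings; case: ex_minnP. Qed.

Lemma doublings_gt0 : (0 < L)%N.
Proof.
rewrite lt0n; apply/negP => /eqP L0; have := doublings_ge; rewrite L0; lia.
Qed.

Lemma root_ceil_ge k : (k <= root_ceil k * root_ceil k)%N.
Proof. by rewrite /root_ceil; case: ex_minnP. Qed.

Let nR : 0 < n%:R :> R. Proof. by rewrite ltr0n. Qed.
Let mR : 0 < m%:R :> R. Proof. by rewrite ltr0n; lia. Qed.
Let mnR : 2 <= m%:R / n%:R :> R.
Proof. by rewrite ler_pdivlMr// -natrM ler_nat. Qed.

Lemma ell_ge : 1 / 2 <= ell.
Proof.
by apply: le_trans ln2_ge _; rewrite ler_ln ?posrE// divr_gt0.
Qed.

(** One doubling fewer does not reach [m], so (L - 1) ln 2 <= ell. With ln 2 >= 1/2 and ell >= 1/2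
    this gives L <= 2 ell + 1 <= 4 ell. *)
Lemma doublings_le_ln : L%:R <= 4 * ell.
Proof.
have h := ell_ge; have := doublings_gt0.
rewrite /doublings; case: ex_minnP => -[//|l] _ lmin _.
have : (n * 2 ^ l < m)%N by rewrite ltnNge; apply/negP => /lmin; rewrite ltnn.
move=> lm; have : 2 ^+ l <= m%:R / n%:R :> R.
  by rewrite ler_pdivlMr// mulrC -natrX -natrM ler_nat ltnW.
rewrite -ler_ln ?posrE ?exprn_gt0 ?divr_gt0// lnXn// => hl.
have : 1 / 2 *+ l <= ln 2 *+ l :> R by rewrite lerMn2r ln2_ge orbT.
rewrite -mulr_natr -[l.+1%:R]natr1; lra.
Qed.

(** Minimality gives (S - 1)^2 < n L, hence S^2 <= 4 n L, and L <= 4 ell. *)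
Lemma scale_le_sqrt : S%:R <= 4 * Num.sqrt (n%:R * ell).
Proof.
have h := ell_ge; have nl0 : 0 <= n%:R * ell by rewrite mulr_ge0//; lra.
rewrite -(ler_pXn2r (n := 2)) ?nnegrE ?mulr_ge0 ?sqrtr_ge0//.
rewrite exprMn sqr_sqrtr//.
have : (S * S <= 4 * (n * L))%N.
  have := doublings_gt0; rewrite /root_ceil; case: ex_minnP => -[//|s] _ smin L0.
  have : (s * s < n * L)%N by rewrite ltnNge; apply/negP => /smin; rewrite ltnn.
  have : (0 < n * L)%N by rewrite muln_gt0 n_gt0.
  move: (n * L)%N => N N0 sN; nia.
rewrite -(ler_nat R) !natrM -expr2 => /le_trans; apply.
have := ler_wpM2l (ltW nR) doublings_le_ln.
lra.
Qed.

Lemma sqrt_n_le : Num.sqrt n%:R <= 2 * Num.sqrt (n%:R * ell).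
Proof.
have h := ell_ge; have nl0 : 0 <= n%:R * ell by rewrite mulr_ge0//; lra.
rewrite -(ler_pXn2r (n := 2)) ?nnegrE ?mulr_ge0 ?sqrtr_ge0//.
rewrite exprMn (sqr_sqrtr nl0) (sqr_sqrtr (ltW nR)).
have := ler_wpM2l (ltW nR) h; lra.
Qed.

Lemma rounding_bound_ge (sigma : R) : 0 < sigma ->
  480 * (sigma * Num.sqrt (n%:R * ell)) <= rounding_bound n m sigma.
Proof.
move=> s0; rewrite /rounding_bound -mulrA ler_pM2l ?ltr0n//.
by rewrite ler_pM2l// lerDl sqrtr_ge0.
Qed.

Hypothesis close : (m%:R / n%:R) ^+ (2 ^ 10) < m%:R :> R.

(** As m / n >= 2, the hypothesis [close] makes [m] exceed 2^1024. *)
Lemma ln_m_ge : 512 <= ln m%:R :> R.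
Proof.
have : 2 ^+ (2 ^ 10) <= m%:R :> R.
  by apply: le_trans (ltW close); rewrite lerXn2r ?nnegrE ?divr_ge0.
rewrite -ler_ln ?posrE ?exprn_gt0// lnXn// -[_ *+ _ in X in X -> _]mulr_natr.
have -> : (2 ^ 10)%:R = 1024 :> R by rewrite natrX; lra.
by have := @ln2_ge R; lra.
Qed.

(** [close] forces ln n >= ln m / 2, so sqrt n is at least the 16th power of e^z with z = ln m / 64
    >= 8, and e^z >= z suffices. The factor 2^19 is 8 times the 2^16 lost in
    [phase_failure_bound]. *)
Lemma sqrt_n_ge : 2 ^+ 19 * ln m%:R <= Num.sqrt n%:R :> R.
Proof.
have t512 := ln_m_ge; set t := ln m%:R in t512 *.
have h : t / 2 <= ln n%:R.
  move: close; rewrite -ltr_ln ?posrE ?exprn_gt0 ?divr_gt0// lnXn ?divr_gt0//.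
  rewrite ln_div ?posrE// -/t -[_ *+ _ in X in X -> _]mulr_natr.
  have -> : (2 ^ 10)%:R = 1024 :> R by rewrite natrX; lra.
  lra.
have -> : Num.sqrt n%:R = expR (ln n%:R / 2) :> R.
  apply/eqP; rewrite -(@eqrXn2 _ 2) ?sqrtr_ge0 ?expR_ge0// sqr_sqrtr ?ltW//.
  by rewrite -expRM_natr -mulrA mulVf ?pnatr_eq0// mulr1 lnK ?posrE.
apply: (@le_trans _ _ (expR (t / 64 * 16%:R))); last by rewrite ler_expR; lra.
rewrite expRM_natr; set z := t / 64.
have z8 : 8 <= z by rewrite /z; lra.
have -> : t = z * 2 ^+ 6 by rewrite /z; field.
apply: (@le_trans _ _ (z * 8 ^+ 15)).
  have -> : 2 ^+ 19 * (z * 2 ^+ 6) = z * 2 ^+ 25 :> R by ring.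
  have -> : 8 = 2 ^+ 3 :> R by lra.
  rewrite -exprM; apply: ler_wpM2l; first lra.
  by apply: ler_weXn2l => //; lra.
rewrite [leRHS](exprS _ 15); have zz : z <= expR z by have := expR_ge1Dx z; lra.
apply: ler_pM => //; rewrite ?exprn_ge0//; first lra.
by rewrite lerXn2r ?nnegrE ?expR_ge0//; lra.
Qed.

End Scales.

(** * The program *)

Section Triples.
Variable R : realType.
Implicit Types (s : state R) (c : cmd) (Q : state R -> Prop).

(** A total-correctness triple with a time bound. The remaining commands [k] are arbitrary, which
    lets triples compose; the coins can be fixed because the program tosses none. *)
Definition runs c s Q (B : nat) : Prop := exists s' t,
  [/\ forall k, iter t (step (fun=> true)) (c :: k, s) = (k, s'), (t <= B)%N
    & Q s'].

Lemma runs_le c s Q B B' : (B <= B')%N -> runs c s Q B -> runs c s Q B'.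
Proof. by move=> h [s' [t [h1 h2 h3]]]; exists s', t; split => //; lia. Qed.

Lemma runs_skip s Q : Q s -> runs CSkip s Q 1.
Proof. by move=> h; exists s, 1%N; split. Qed.

Lemma runs_setN s x e Q : Q (set_nreg s x (neval s e)) -> runs (CSetN x e) s Q 1.
Proof. by move=> h; eexists; exists 1%N; split => //. Qed.

Lemma runs_setR s a i j e Q :
  Q (set_cell s a (neval s i) (neval s j) (reval s e)) ->
  runs (CSetR a i j e) s Q 1.
Proof. by move=> h; eexists; exists 1%N; split => //. Qed.

Lemma runs_seq c1 c2 s Q1 Q B1 B2 : runs c1 s Q1 B1 ->
  (forall s1, Q1 s1 -> runs c2 s1 Q B2) -> runs (CSeq c1 c2) s Q (B1 + B2).+1.
Proof.
move=> [s1 [t1 [h1 b1 q1]]] /(_ s1 q1) [s2 [t2 [h2 b2 q2]]].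
exists s2, (t2 + t1).+1; split => //; last by lia.
by move=> k; rewrite iterSr /= iterD h1 h2.
Qed.

Lemma runs_setN_seq s x e c Q B : runs c (set_nreg s x (neval s e)) Q B ->
  runs (CSeq (CSetN x e) c) s Q B.+2.
Proof.
move=> h; apply: (@runs_seq _ _ s (eq (set_nreg s x (neval s e))) Q 1 B).
  exact: runs_setN.
by move=> _ <-.
Qed.

Lemma runs_setR_seq s a i j e c Q B :
  runs c (set_cell s a (neval s i) (neval s j) (reval s e)) Q B ->
  runs (CSeq (CSetR a i j e) c) s Q B.+2.
Proof.
move=> h; apply: (@runs_seq _ _ s
  (eq (set_cell s a (neval s i) (neval s j) (reval s e))) Q 1 B).
  exact: runs_setR.
by move=> _ <-.
Qed.

Lemma runs_if s b c1 c2 Q B : runs (if beval s b then c1 else c2) s Q B ->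
  runs (CIf b c1 c2) s Q B.+1.
Proof.
move=> [s' [t [h1 h2 h3]]]; exists s', t.+1; split => // k.
by rewrite iterSr /= h1.
Qed.

Lemma runs_skip_seq s c Q B : runs c s Q B -> runs (CSeq CSkip c) s Q B.+2.
Proof.
move=> h; apply: (@runs_seq _ _ s (eq s) Q 1 B); first exact: runs_skip.
by move=> _ <-.
Qed.

(** Pushing the continuation into the chosen branch lets symbolic execution go on after a
    conditional without an intermediate assertion. *)
Lemma runs_if_seq s b c1 c2 c Q B :
  runs (CSeq (if beval s b then c1 else c2) c) s Q B ->
  runs (CSeq (CIf b c1 c2) c) s Q B.+1.
Proof.
move=> [s' [[|t] [h1 h2 h3]]]; first by have := h1 [::].
exists s', t.+2; split => // k; have := h1 k.
by rewrite !iterSr.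
Qed.

Lemma runs_while (Inv : nat -> state R -> Prop) N B b c s :
  (forall i s, (i <= N)%N -> Inv i s -> beval s b = (i < N)%N) ->
  (forall i s, (i < N)%N -> Inv i s -> runs c s (Inv i.+1) B) ->
  Inv 0 s -> runs (CWhile b c) s (Inv N) (N * B.+1).+1.
Proof.
move=> hb hc.
suff H k i s' : (i + k = N)%N -> Inv i s' ->
    runs (CWhile b c) s' (Inv N) (k * B.+1).+1.
  by move=> h; exact: (H N 0%N).
elim: k i s' => [|k IH] i s' ikN h.
  rewrite addn0 in ikN; rewrite ikN in h; exists s', 1%N; split => // k.
  by rewrite /= (hb N) ?ltnn.
have iN : (i < N)%N by lia.
have [s1 [t1 [h1 b1 q1]]] := hc _ _ iN h.
have [|s2 [t2 [h2 b2 q2]]] := IH i.+1 s1 _ q1; first by lia.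
exists s2, (t2 + t1).+1; split => //; last by nia.
by move=> k'; rewrite iterSr /= (hb i _ (ltnW iN) h) iN iterD h1 h2.
Qed.

Fixpoint toss_free c : bool :=
  match c with
  | CToss _ => false
  | CSeq c1 c2 | CIf _ c1 c2 => toss_free c1 && toss_free c2
  | CWhile _ c1 => toss_free c1
  | _ => true
  end.

(** Only [CToss] reads the coins, and none of the commands still to be executed ever contains
    one. *)
Lemma run_toss_free n m prog (I : instance R n m) coin t : toss_free prog ->
  run prog I coin t = run prog I (fun=> true) t.
Proof.
move=> tf; rewrite /run.
suff : let: (k, s) := iter t (step (fun=> true)) ([:: prog], init I) in
    all toss_free k /\ iter t (step coin) ([:: prog], init I) = (k, s).
  by case: (iter t (step (fun=> true)) _) => k s [].
elim: t => [|t]; first by rewrite /= tf.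
rewrite !iterS; case: (iter t (step (fun=> true)) _) => k s [tk ->].
case: k tk => [|[|x e|a i j e|x|c1 c2|b c1 c2|b c1] k] //= /andP[h1 h2];
  rewrite ?h2 ?andbT//.
- by move/andP: h1 => [h3 h4]; case: (beval s b); rewrite ?h3 ?h4.
- by case: (beval s b); rewrite /= ?h1 ?h2.
Qed.

End Triples.

(* Registers: j, i loop indices; r, l the fields rem and pos of the walk;
   L, p, S the doublings, n 2^L and the scale.  Arrays: 4 the output, 5 and 6 the
   fields disc and dir, 7 the threshold, 8 the power of m / n, 9 the inner product
   <v, a>, 10 the squared norm of v. *)
Section Program.
Notation rn := (NReg 0). Notation rm := (NReg 1). Notation rj := (NReg 2).
Notation ri := (NReg 3). Notation rr := (NReg 4). Notation rl := (NReg 5).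
Notation rL := (NReg 6). Notation rp := (NReg 7). Notation rS := (NReg 8).
Notation K := NConst.
Notation "a +n b" := (NAdd a b) (at level 50).
Notation "a *r b" := (RMul a b) (at level 40).
Notation "a +r b" := (RAdd a b) (at level 50).
Notation xout := (RCell 4 rj (K 0)).
Notation x0j := (RCell 1 rj (K 0)).
Notation flj := (RCell 2 rj (K 0)).
Notation Aij := (RCell 0 ri rj).
Notation sg := (RCell 3 (K 0) (K 0)).
Notation di := (RCell 5 ri (K 0)).
Notation vi := (RCell 6 ri (K 0)).
Notation cT := (RCell 7 (K 0) (K 0)).
Notation cz := (RCell 8 (K 0) (K 0)).
Notation ch := (RCell 9 (K 0) (K 0)).
Notation cw := (RCell 10 (K 0) (K 0)).
Notation "c1 ;; c2" := (CSeq c1 c2) (at level 61, right associativity).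
Notation nonint := (BNot (BLeR x0j flj)).

(** The number of fractional coordinates is left in register 4, as the initial [rem] of the walk. *)
Definition prog_floor : cmd :=
  CWhile (BLeN (rj +n K 1) rn)
    (CSetR 4 rj (K 0) flj ;;
     CIf nonint (CSetN 4 (rr +n K 1)) CSkip ;;
     CSetN 2 (rj +n K 1)).

Definition prog_doublings : cmd :=
  CSetN 7 rn ;;
  CWhile (BLeN (rp +n K 1) rm) (CSetN 7 (rp +n rp) ;; CSetN 6 (rL +n K 1)).

(** Only reals can be multiplied, so the search compares real images of the registers. *)
Definition prog_root : cmd :=
  CWhile (BNot (BLeR (RNat rn *r RNat rL) (RNat rS *r RNat rS)))
    (CSetN 8 (rS +n K 1)).

(** Ten squarings give the exponent 2^10 of [steering_range], which stands in for a comparison of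
    logarithms. *)
Definition prog_power : cmd :=
  CSetR 8 (K 0) (K 0) (RNat rm *r RInv (RNat rn)) ;;
  CSetN 3 (K 0) ;;
  CWhile (BLeN (ri +n K 1) (K 10))
    (CSetR 8 (K 0) (K 0) (cz *r cz) ;; CSetN 3 (ri +n K 1)).

Definition prog_inner : cmd :=
  CSetR 9 (K 0) (K 0) (RNat (K 0)) ;;
  CSetN 3 (K 0) ;;
  CWhile (BLeN (ri +n K 1) rm)
    (CSetR 9 (K 0) (K 0) (ch +r (vi *r Aij)) ;; CSetN 3 (ri +n K 1)).

Definition prog_disc : cmd :=
  CSetN 3 (K 0) ;;
  CWhile (BLeN (ri +n K 1) rm)
    (CSetR 5 ri (K 0) (di +r (Aij *r (xout +r ROpp x0j))) ;;
     CSetN 3 (ri +n K 1)).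

(** The squared norm is cached in array 10 once per phase, since the direction stays fixed within a
    phase. *)
Definition prog_excess : cmd :=
  CSetR 10 (K 0) (K 0) (RNat (K 0)) ;;
  CSetN 3 (K 0) ;;
  CWhile (BLeN (ri +n K 1) rm)
    (CIf (BAnd (BNot (BLeR (RNat rr *r RNat rr) (RNat rn)))
               (BNot (BLeR (RNat rm) cz)))
       (CIf (BNot (BLeR di cT)) (CSetR 6 ri (K 0) (di +r ROpp cT))
         (CIf (BNot (BLeR (ROpp cT) di)) (CSetR 6 ri (K 0) (di +r cT))
           (CSetR 6 ri (K 0) (RNat (K 0)))))
       (CSetR 6 ri (K 0) (RNat (K 0))) ;;
     CSetR 10 (K 0) (K 0) (cw +r (vi *r vi)) ;;
     CSetN 3 (ri +n K 1)).

Definition prog_column : cmd :=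
  prog_inner ;;
  CIf (BAnd
        (BNot (BLeR (RNat (K 25) *r cw)
           (RNat (K 4) *r (RNat rl *r RNat rl) *r (sg *r sg))))
        (BLeR ch (RNat (K 0))))
    (CSetR 4 rj (K 0) (flj +r RNat (K 1))) CSkip ;;
  prog_disc ;;
  CSetN 5 (rl +n K 1) ;;
  CIf (BLeN rr (rl +n rl))
    (CSetN 4 (NSub rr rl) ;;
     CSetN 5 (K 0) ;;
     CSetR 7 (K 0) (K 0) (RNat (K 3) *r RInv (RNat (K 4)) *r cT +r
        (RNat (K 16) *r (sg *r RNat rS))) ;;
     prog_excess)
    CSkip.

Definition prog_walk : cmd :=
  CSetN 2 (K 0) ;;
  CWhile (BLeN (rj +n K 1) rn)
    (CIf nonint prog_column CSkip ;; CSetN 2 (rj +n K 1)).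

Definition rounding_program : cmd :=
  prog_floor ;; prog_doublings ;; prog_root ;; prog_power ;; prog_walk.

(** * Correctness and running time of the program *)

Section Correctness.
Variables (R : realType) (n m : nat) (sigma : R) (A : 'M[R]_(m, n)) (x0 : 'cV[R]_n).
Hypotheses (n_gt0 : (0 < n)%N) (m_le : (m <= 2 ^ n)%N).

Let fl (j : 'I_n) : R := (Num.floor (x0 j 0))%:~R.
Definition frac (j : 'I_n) : R := x0 j 0 - fl j.
Definition fractional (j : 'I_n) : bool := fl j < x0 j 0.

Let c0 := mx_cells A.
Let c1 := mx_cells x0.
Let c2 := mx_cells (map_mx (fun t => (Num.floor t)%:~R) x0) : nat -> nat -> R.
Let c3 := (fun i j => if (i == 0%N) && (j == 0%N) then sigma else 0) : nat -> nat -> R.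

Record inputs (s : state R) : Prop := Inputs {
  in_n : nreg s 0 = n; in_m : nreg s 1 = m;
  in_A : cell s 0 = c0; in_x0 : cell s 1 = c1; in_fl : cell s 2 = c2;
  in_sg : cell s 3 = c3 }.

Lemma mx_cellsE p q (M : 'M[R]_(p, q)) (i : 'I_p) (j : 'I_q) :
  mx_cells M i j = M i j.
Proof. by rewrite /mx_cells !valK. Qed.

Lemma c1E (j : 'I_n) : c1 j 0 = x0 j 0.
Proof. exact: (mx_cellsE x0 j ord0). Qed.

Lemma c2E (j : 'I_n) : c2 j 0 = fl j.
Proof. by rewrite /c2 (mx_cellsE _ j ord0) mxE. Qed.

Definition scratch0 (s : state R) : Prop :=
  [/\ nreg s 3 = 0%N, nreg s 5 = 0%N & nreg s 8 = 0%N] /\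
  [/\ forall i, cell s 5 i 0 = 0, forall i, cell s 6 i 0 = 0,
      cell s 7 0 0 = 0, cell s 9 0 0 = 0 & cell s 10 0 0 = 0].

Definition fcols : seq 'I_n := [seq j <- enum 'I_n | fractional j].

Lemma take_enumS j (jn : (j < n)%N) :
  take j.+1 (enum 'I_n) = rcons (take j (enum 'I_n)) (Ordinal jn).
Proof.
rewrite (take_nth (Ordinal jn)) ?size_enum_ord//; congr rcons.
exact: (nth_ord_enum (Ordinal jn) (Ordinal jn)).
Qed.

Lemma fractionalE s j (jn : (j < n)%N) : inputs s -> nreg s 2 = j ->
  beval s nonint = fractional (Ordinal jn).
Proof.
move=> [Hn Hm HA Hx Hf Hs] Hj /=.
by rewrite Hx Hf Hj (c1E (Ordinal jn)) (c2E (Ordinal jn)) -ltNge.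
Qed.

Lemma runs_floor : runs prog_floor (init (Instance sigma A x0))
  (fun s => [/\ inputs s, scratch0 s, forall j : 'I_n, cell s 4 j 0 = fl j,
     nreg s 4 = size fcols & nreg s 6 = 0%N]) (n * 8).+1.
Proof.
pose Inv (j : nat) s := [/\ inputs s, scratch0 s,
   forall k : 'I_n, (k < j)%N -> cell s 4 k 0 = fl k,
   nreg s 4 = count fractional (take j (enum 'I_n))
   & nreg s 6 = 0%N /\ nreg s 2 = j].
have [s [t [h1 h2 h3]]] : runs prog_floor (init (Instance sigma A x0)) (Inv n) (n * 8).+1.
  apply: runs_while.
  - by move=> j s _ [[Hn _ _ _ _ _] _ _ _ [_ Hj]] /=; rewrite Hn Hj addn1.
  - move=> j s jn [Hin [[H3 H5 H8] [D V T H W]] Hx4 Hr [HL Hj]].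
    have fE := fractionalE jn Hin Hj.
    move: Hin => [Hn Hm HA Hx Hf Hs].
    apply: (@runs_le _ _ _ _ 6) => //.
    apply: runs_setR_seq => /=; apply: runs_if_seq.
    rewrite [beval _ _]fE.
    have x4 (k : 'I_n) : (k < j.+1)%N -> (if [&& 4 == 4, nat_of_ord k == nreg s 2 & 0 == 0]%N
        then cell s 2 (nreg s 2) 0 else cell s 4 k 0) = fl k.
      move=> kj; rewrite /= andbT Hj; case: eqP => kj'.
        by rewrite Hf -kj' c2E.
      by apply: Hx4; move: kj kj'; rewrite ltnS leq_eqVlt => /predU1P[].
    have rE : (nreg s 4 + fractional (Ordinal jn))%N =
        count fractional (take j.+1 (enum 'I_n)).
      by rewrite Hr (take_enumS jn) -cats1 count_cat/= addn0.
    move: rE; case: ifP => fr rE.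
      apply: runs_setN_seq; apply: runs_setN; split => //=.
      by rewrite Hj addn1.
    apply: runs_skip_seq; apply: runs_setN; split => //=.
      by rewrite -rE addn0.
    by rewrite Hj addn1.
  - by split => //=; rewrite take0.
exists s, t; split => //; case: h3 => [a b c e [f g]]; split => //.
- by move=> j; apply: c.
- by rewrite e take_oversize ?size_enum_ord// size_filter.
Qed.

Notation dbl := (doublings m n_gt0).
Notation scl := (root_ceil (n * dbl)).

(** Here [m <= 2 ^ n] limits the doubling loop, and through [scale_le] the search for the root, in
    terms of [n]. *)
Lemma doublings_le : (dbl <= n)%N.
Proof.
rewrite /doublings; case: ex_minnP => k _ /(_ n) -> //.
by apply: leq_trans m_le _; rewrite leq_pmull.
Qed.

Record prepared (s : state R) : Prop := Prepared {
  pr_in : inputs s;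
  pr_x : forall j : 'I_n, cell s 4 j 0 = fl j;
  pr_r : nreg s 4 = size fcols;
  pr_l : nreg s 5 = 0%N;
  pr_d : forall i, cell s 5 i 0 = 0;
  pr_v : forall i, cell s 6 i 0 = 0;
  pr_T : cell s 7 0 0 = 0;
  pr_w : cell s 10 0 0 = 0 }.

Lemma runs_doublings s : prepared s -> nreg s 6 = 0%N ->
  runs prog_doublings s
    (fun s' => [/\ prepared s', nreg s' 6 = dbl & nreg s' 8 = nreg s 8])
    (n * 4 + 3).
Proof.
move=> [[Hn Hm HA Hx Hf Hs] X Rr L D V T W] L0.
apply: (@runs_le _ _ _ _ (dbl * 4).+3); first by have := doublings_le; lia.
apply: runs_setN_seq => /=.
pose Inv i s' := [/\ prepared s', nreg s' 6 = i, nreg s' 7 = (n * 2 ^ i)%N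
  & nreg s' 8 = nreg s 8].
have [|||s' [t [h1 h2 [h3 h4 h5 h6]]]] := @runs_while R Inv dbl 3
  (BLeN (rp +n K 1) rm) (CSetN 7 (rp +n rp) ;; CSetN 6 (rL +n K 1))
  (set_nreg s 7 (nreg s 0)).
- move=> i s' il [[[Hn' Hm' _ _ _ _] _ _ _ _ _ _ _] H6 H7 _] /=.
  rewrite Hm' H7 addn1; move: il; rewrite /doublings; case: ex_minnP => k mk kmin ik.
  apply/idP/idP => [lt|ik'].
    rewrite ltn_neqAle ik andbT; apply/eqP => ek; rewrite ek in lt.
    by rewrite leqNgt lt in mk.
  by rewrite ltnNge; apply/negP => /kmin; rewrite leqNgt ik'.
- move=> i s' il [[[Hn' Hm' HA' Hx' Hf' Hs'] X' R' L' D' V' T' W'] H6 H7 H8].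
  apply: runs_setN_seq; apply: runs_setN; split => //=.
  + by rewrite H6 addn1.
  + by rewrite H7 expnS; lia.
- by split => //=; rewrite Hn expn0 muln1.
by exists s', t; split.
Qed.

Lemma scale_le : (scl <= n * n)%N.
Proof.
rewrite /root_ceil; case: ex_minnP => k _ /(_ (n * n)%N) -> //.
apply: (leq_trans (leq_mul (leqnn n) doublings_le)).
by rewrite leq_pmulr// muln_gt0 n_gt0.
Qed.

Lemma runs_root s : prepared s -> nreg s 6 = dbl -> nreg s 8 = 0%N ->
  runs prog_root s (fun s' => prepared s' /\ nreg s' 8 = scl) (n * n * 2).+1.
Proof.
move=> P L0 S0.
apply: (@runs_le _ _ _ _ (scl * 2).+1); first by have := scale_le; lia.
pose Inv i s' := [/\ prepared s', nreg s' 6 = dbl & nreg s' 8 = i].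
have [|||s' [t [h1 h2 [h3 h4 h5]]]] := @runs_while R Inv scl 1
  (BNot (BLeR (RNat rn *r RNat rL) (RNat rS *r RNat rS)))
    (CSetN 8 (rS +n K 1)) s.
- move=> i s' il [[[Hn' Hm' _ _ _ _] _ _ _ _ _ _ _] H6 H8] /=.
  rewrite Hn' H6 H8 -!natrM ler_nat -ltnNge.
  move: il; rewrite /root_ceil; case: ex_minnP => k mk kmin ik.
  apply/idP/idP => [lt|ik'].
    rewrite ltn_neqAle ik andbT; apply/eqP => ek; rewrite ek in lt.
    by rewrite leqNgt lt in mk.
  by rewrite ltnNge; apply/negP => /kmin; rewrite leqNgt ik'.
- move=> i s' il [[[Hn' Hm' HA' Hx' Hf' Hs'] X' R' L' D' V' T' W'] H6 H8].
  by apply: runs_setN; split => //=; rewrite H8 addn1.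
- by split.
by exists s', t; split.
Qed.

Notation ratio_pow k := ((m%:R / n%:R : R) ^+ (2 ^ k)).

Lemma runs_power s : prepared s -> nreg s 8 = scl ->
  runs prog_power s
    (fun s' => [/\ prepared s', nreg s' 8 = scl & cell s' 8 0 0 = ratio_pow 10]) 45.
Proof.
move=> [[Hn Hm HA Hx Hf Hs] X Rr L D V T W] S0.
apply: runs_setR_seq; apply: runs_setN_seq.
pose Inv i s' := [/\ prepared s', nreg s' 8 = scl, nreg s' 3 = i &
  cell s' 8 0 0 = ratio_pow i].
set s1 := set_nreg _ _ _.
have [|||s' [t [h1 h2 [h3 h4 h5 h6]]]] := @runs_while R Inv 10 3
  (BLeN (ri +n K 1) (K 10))
    (CSetR 8 (K 0) (K 0) (cz *r cz) ;; CSetN 3 (ri +n K 1)) s1.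
- by move=> i s' il [_ _ H3 _] /=; rewrite H3 addn1.
- move=> i s' il [[[Hn' Hm' HA' Hx' Hf' Hs'] X' R' L' D' V' T' W'] H8 H3 Z].
  apply: runs_setR_seq; apply: runs_setN; split => //=.
  + by rewrite H3 addn1.
  + by rewrite Z -expr2 -exprM expnSr.
- by split => //=; rewrite Hm Hn expr1.
by exists s', t; split.
Qed.

Definition frame (s s' : state R) (xs ar : seq nat) : Prop :=
  (forall x, x \notin xs -> nreg s' x = nreg s x) /\
  (forall a, a \notin ar -> cell s' a = cell s a).

Lemma inputs_frame s s' xs ar : frame s s' xs ar -> all (leq 2) xs ->
  all (leq 4) ar -> inputs s -> inputs s'.
Proof.
move=> [fn fc] /allP hx /allP ha [Hn Hm HA Hx Hf Hs].
by split; rewrite ?fn ?fc//; apply/negP => /hx || apply/negP => /ha.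
Qed.

Lemma runs_inner s j (jn : (j < n)%N) : inputs s -> nreg s 2 = j ->
  runs prog_inner s (fun s' => frame s s' [:: 3] [:: 9] /\
    cell s' 9 0 0 = \sum_(i < m) cell s 6 i 0 * A i (Ordinal jn)) (m * 4 + 5).
Proof.
move=> Hin Hj.
apply: (@runs_le _ _ _ _ (m * 4).+1.+4); first by lia.
apply: runs_setR_seq; apply: runs_setN_seq; set s1 := set_nreg _ _ _.
pose Inv i s' := [/\ frame s s' [:: 3] [:: 9], nreg s' 3 = i
  & cell s' 9 0 0 = \sum_(0 <= k < i) cell s 6 k 0 * c0 k j].
have [|||s' [t [h1 h2 [h3 h4 h5]]]] := @runs_while R Inv m 3
  (BLeN (ri +n K 1) rm)
    (CSetR 9 (K 0) (K 0) (ch +r (vi *r Aij)) ;; CSetN 3 (ri +n K 1)) s1.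
- move=> i s' il [[fn fc] H3 _] /=; rewrite H3 fn// addn1.
  by case: Hin => _ ->.
- move=> i s' il [[fn fc] H3 H].
  apply: runs_setR_seq; apply: runs_setN; split => /=.
  + split => [x xs|a aa] /=.
      by rewrite (negbTE (_ : x != 3))//; [exact: fn|move: xs; rewrite inE].
    apply/funext => k; apply/funext => l /=.
    by rewrite (fc _ aa); move: aa; rewrite inE => /negbTE ->.
  + by rewrite H3 addn1.
  + rewrite H big_nat_recr//= H3 !fc//; case: Hin => _ _ -> _ _ _.
    by rewrite fn// Hj.
- split => //=.
  + split => [x xs|a aa] /=; first by move: xs; rewrite inE => /negbTE ->.
    apply/funext => k; apply/funext => l /=.
    by move: aa; rewrite inE => /negbTE ->.
  + by rewrite big_geq.
exists s', t; split => //; split => //.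
rewrite h5 big_mkord; apply: eq_bigr => i _.
by rewrite -(mx_cellsE A i (Ordinal jn)).
Qed.

Lemma runs_disc s j (jn : (j < n)%N) : inputs s -> nreg s 2 = j ->
  runs prog_disc s (fun s' => frame s s' [:: 3] [:: 5] /\
    forall i : 'I_m, cell s' 5 i 0 =
      cell s 5 i 0 + A i (Ordinal jn) * (cell s 4 j 0 - x0 (Ordinal jn) 0))
    (m * 4 + 3).
Proof.
move=> Hin Hj; case: (Hin) => Hn Hm HA Hx Hf Hs.
apply: (@runs_le _ _ _ _ (m * 4).+1.+2); first by lia.
apply: runs_setN_seq; set s1 := set_nreg _ _ _.
pose Inv i s' := [/\ frame s s' [:: 3] [:: 5], nreg s' 3 = i
  & forall k, cell s' 5 k 0 = cell s 5 k 0 +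
     if (k < i)%N then c0 k j * (cell s 4 j 0 - c1 j 0) else 0].
have [|||s' [t [h1 h2 [h3 h4 h5]]]] := @runs_while R Inv m 3
  (BLeN (ri +n K 1) rm)
    (CSetR 5 ri (K 0) (di +r (Aij *r (xout +r ROpp x0j))) ;;
     CSetN 3 (ri +n K 1)) s1.
- by move=> i s' il [[fn fc] H3 _] /=; rewrite H3 fn// addn1 Hm.
- move=> i s' il [[fn fc] H3 H].
  apply: runs_setR_seq; apply: runs_setN; split => /=.
  + split => [x xs|a aa] /=.
      by rewrite (negbTE (_ : x != 3))//; [exact: fn|move: xs; rewrite inE].
    apply/funext => k; apply/funext => l /=.
    by rewrite (fc _ aa); move: aa; rewrite inE => /negbTE ->.
  + by rewrite H3 addn1.
  + move=> k; rewrite andbT H3; case: eqP => [->|ki].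
      by rewrite H ltnn addr0 ltnSn !fc// fn// Hj HA Hx.
    by rewrite H (_ : (k < i.+1)%N = (k < i)%N)//; lia.
- split => //=.
  + by split => [x xs|//] /=; move: xs; rewrite inE => /negbTE ->.
  + by move=> k; rewrite addr0.
exists s', t; split => //; split => // i.
by rewrite h5 ltn_ord -(mx_cellsE A i (Ordinal jn)) -(c1E (Ordinal jn)).
Qed.

Lemma runs_excess s : inputs s -> cell s 8 0 0 = ratio_pow 10 ->
  runs prog_excess s (fun s' => [/\ frame s s' [:: 3] [:: 6; 10],
    forall i : 'I_m, cell s' 6 i 0 = if steering_range R n m (nreg s 4)
      then excess (cell s 7 0 0) (cell s 5 i 0) else 0
    & cell s' 10 0 0 = \sum_(i < m) cell s' 6 i 0 * cell s' 6 i 0])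
    (m * 10 + 5).
Proof.
move=> Hin Hz; case: (Hin) => Hn Hm HA Hx Hf Hs.
apply: (@runs_le _ _ _ _ (m * 10).+1.+4); first by lia.
apply: runs_setR_seq; apply: runs_setN_seq; set s1 := set_nreg _ _ _.
pose e k : R := if steering_range R n m (nreg s 4)
      then excess (cell s 7 0 0) (cell s 5 k 0) else 0.
pose Inv i s' := [/\ frame s s' [:: 3] [:: 6; 10], nreg s' 3 = i,
  forall k, (k < i)%N -> cell s' 6 k 0 = e k
  & cell s' 10 0 0 = \sum_(0 <= k < i) e k * e k].
have [|||s' [t [h1 h2 [h3 h4 h5 h6]]]] := @runs_while R Inv m 9
  (BLeN (ri +n K 1) rm)
    (CIf (BAnd (BNot (BLeR (RNat rr *r RNat rr) (RNat rn)))
               (BNot (BLeR (RNat rm) cz)))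
       (CIf (BNot (BLeR di cT)) (CSetR 6 ri (K 0) (di +r ROpp cT))
         (CIf (BNot (BLeR (ROpp cT) di)) (CSetR 6 ri (K 0) (di +r cT))
           (CSetR 6 ri (K 0) (RNat (K 0)))))
       (CSetR 6 ri (K 0) (RNat (K 0))) ;;
     CSetR 10 (K 0) (K 0) (cw +r (vi *r vi)) ;;
     CSetN 3 (ri +n K 1)) s1.
- by move=> i s' il [[fn fc] H3 _ _] /=; rewrite H3 fn// addn1 Hm.
- move=> i s' il [[fn fc] H3 H6 H10].
  have main v B : v = e i -> (B <= 4)%N ->
    runs (CSetR 10 (K 0) (K 0) (cw +r (vi *r vi)) ;; CSetN 3 (ri +n K 1))
      (set_cell s' 6 i 0 v) (Inv i.+1) 3.
    move=> vE _.
    apply: runs_setR_seq; apply: runs_setN; split => /=.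
    + split => [x xs|a aa] /=.
        by rewrite (negbTE (_ : x != 3))//; [exact: fn|move: xs; rewrite inE].
      apply/funext => k; apply/funext => l /=; rewrite (fc _ aa).
      by move: aa; rewrite !inE negb_or => /andP[/negbTE -> /negbTE ->].
    + by rewrite H3 addn1.
    + move=> k ki; rewrite andbT; case: eqP => [->//|ki']; apply: H6; lia.
    + by rewrite H10 H3 eqxx/= big_nat_recr//= vE.
  have actE : beval s' (BAnd (BNot (BLeR (RNat rr *r RNat rr) (RNat rn)))
               (BNot (BLeR (RNat rm) cz))) = steering_range R n m (nreg s 4).
    rewrite /= !fn// !fc// Hn Hm Hz -natrM ler_nat -ltnNge -ltNge.
    by [].
  apply: runs_if_seq; rewrite actE.
  have eE : e i = if steering_range R n m (nreg s 4)
      then excess (cell s 7 0 0) (cell s 5 i 0) else 0 by [].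
  have set6 r v : reval s' r = v -> v = e i ->
     runs (CSetR 6 ri (K 0) r ;; CSetR 10 (K 0) (K 0) (cw +r (vi *r vi)) ;;
        CSetN 3 (ri +n K 1)) s' (Inv i.+1) 5.
    by move=> rE vE; apply: runs_setR_seq; rewrite rE /= H3; exact: (main v 1%N).
  move: eE; case: ifP => act eE; last first.
    by apply: (@runs_le _ _ _ _ 5) => //; exact: (set6 _ 0).
  apply: runs_if_seq => /=; rewrite !fc// H3 -ltNge.
  move: eE; rewrite /excess; case: ifP => c1' eE.
    apply: (@runs_le _ _ _ _ 5) => //; apply: (set6 _ (e i)) => //=.
    by rewrite !fc// H3.
  apply: runs_if_seq => /=; rewrite !fc// H3 -ltNge.
  move: eE; case: ifP => c2' eE.
    apply: (@runs_le _ _ _ _ 5) => //; apply: (set6 _ (e i)) => //=.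
    by rewrite !fc// H3.
  by apply: (@runs_le _ _ _ _ 5) => //; apply: (set6 _ 0).
- split => //=.
  + split => [x xs|a aa] /=; first by move: xs; rewrite inE => /negbTE ->.
    apply/funext => k; apply/funext => l /=.
    by move: aa; rewrite !inE negb_or => /andP[_ /negbTE ->].
  + by rewrite big_geq.
exists s', t; split => //; split => //.
- by move=> i; rewrite h5.
- by rewrite h6 big_mkord; apply: eq_bigr => i _; rewrite h5.
Qed.

Notation adv := (advance sigma scl (steering_range R n m)).

Definition walk_after (js : seq 'I_n) (w : walk R m) : walk R m :=
  foldl (fun w j => if fractional j then adv w (frac j) (fun i => A i j) else w)
    w js.

Record tracks (s : state R) (w : walk R m) : Prop := Tracks {
  tr_disc : forall i : 'I_m, cell s 5 i 0 = disc w i;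
  tr_dir : forall i : 'I_m, cell s 6 i 0 = dir w i;
  tr_thr : cell s 7 0 0 = thr w;
  tr_rem : nreg s 4 = rem w;
  tr_pos : nreg s 5 = pos w;
  tr_w : cell s 10 0 0 = \sum_i dir w i * dir w i }.

Lemma runs_column s (w : walk R m) j (jn : (j < n)%N) :
  inputs s -> nreg s 2 = j -> nreg s 8 = scl ->
  cell s 8 0 0 = ratio_pow 10 -> cell s 4 j 0 = fl (Ordinal jn) -> tracks s w ->
  runs prog_column s (fun s' =>
    [/\ frame s s' [:: 3; 4; 5] [:: 4; 5; 6; 7; 9; 10],
      tracks s' (adv w (frac (Ordinal jn)) (fun i => A i (Ordinal jn))),
      forall k, k != j -> cell s' 4 k 0 = cell s 4 k 0 &
      cell s' 4 j 0 = fl (Ordinal jn) +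
        (rounds_up sigma w (fun i => A i (Ordinal jn)))%:R]) (m * 18 + 35).
Proof.
move=> Hin Hj HS Hz Hxj [D V T Rr L W]; case: (Hin) => Hn Hm HA Hx Hf Hs.
set a := fun i : 'I_m => A i (Ordinal jn); set up := rounds_up sigma w a.
apply: (@runs_le _ _ _ _ ((m * 4 + 5) + ((m * 14 + 28).+1)).+1); first by lia.
apply: runs_seq (runs_inner jn Hin Hj) _ => s1 [[fn1 fc1] h1].
have {}h1 : cell s1 9 0 0 = \sum_i dir w i * a i.
  by rewrite h1; apply: eq_bigr => i _; rewrite V.
apply: runs_if_seq.
have -> : beval s1 (BAnd
        (BNot (BLeR (RNat (K 25) *r cw)
           (RNat (K 4) *r (RNat rl *r RNat rl) *r (sg *r sg))))
        (BLeR ch (RNat (K 0)))) = up.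
  by rewrite /= h1 !fn1// !fc1// W L Hs /c3/= -ltNge.
(* Both outcomes of the rounding test rejoin here: all that the rest needs is that [s2] differs in
   array 4 only, with known entries. *)
suff next (s2 : state R) :
    frame s1 s2 [::] [:: 4] ->
    (forall k, k != j -> cell s2 4 k 0 = cell s1 4 k 0) ->
    cell s2 4 j 0 = fl (Ordinal jn) + up%:R ->
  runs (prog_disc ;;
  CSetN 5 (rl +n K 1) ;;
  CIf (BLeN rr (rl +n rl))
    (CSetN 4 (NSub rr rl) ;;
     CSetN 5 (K 0) ;;
     CSetR 7 (K 0) (K 0) (RNat (K 3) *r RInv (RNat (K 4)) *r cT +r
        (RNat (K 16) *r (sg *r RNat rS))) ;;
     prog_excess)
    CSkip) s2 (fun s' =>
    [/\ frame s s' [:: 3; 4; 5] [:: 4; 5; 6; 7; 9; 10],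
      tracks s' (adv w (frac (Ordinal jn)) a),
      forall k, k != j -> cell s' 4 k 0 = cell s 4 k 0 &
      cell s' 4 j 0 = fl (Ordinal jn) + up%:R]) (m * 14 + 26).
  case: ifP => upE; rewrite upE in next.
    apply: (@runs_le _ _ _ _ (m * 14 + 26).+2); first by lia.
    apply: runs_setR_seq; apply: next.
    + split => // b bb; apply/funext => k; apply/funext => l /=.
      by move: bb; rewrite inE => /negbTE ->.
    + move=> k kj /=; rewrite !fn1// Hj (negbTE kj)//.
    + rewrite /= !fn1// Hj eqxx/= !fc1// Hf.
      by rewrite (c2E (Ordinal jn)).
  apply: (@runs_le _ _ _ _ (m * 14 + 26).+2); first by lia.
  apply: runs_skip_seq; apply: next => //.
  by rewrite !fc1// Hxj addr0.
move=> [fn2 fc2] x2 xj2.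
have Hin2 : inputs s2.
  apply: (@inputs_frame s1 _ [::] [:: 4]) => //.
  exact: (@inputs_frame s _ [:: 3] [:: 9]).
apply: (@runs_le _ _ _ _ ((m * 4 + 3) + (m * 10 + 15)).+1); first by lia.
have Hj2 : nreg s2 2 = j by rewrite fn2// fn1.
apply: runs_seq (runs_disc jn Hin2 Hj2) _ => s3 [[fn3 fc3] d3].
pose d := fun i => disc w i + a i * (up%:R - frac (Ordinal jn)).
have {}d3 (i : 'I_m) : cell s3 5 i 0 = d i.
  rewrite d3 fc2// fc1// D xj2 /d /frac; congr (_ + _ * _).
  by rewrite opprB addrCA addrA.
apply: (@runs_le _ _ _ _ (m * 10 + 13).+2); first by lia.
apply: runs_setN_seq; apply: (@runs_le _ _ _ _ (m * 10 + 12).+1); first by lia.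
apply: runs_if => /=.
have r3 : nreg s3 4 = rem w by rewrite fn3// fn2// fn1.
have l3 : nreg s3 5 = pos w by rewrite fn3// fn2// fn1.
rewrite r3 l3 addn1 /advance -/a -/up -/d.
case: ifP => ph; last first.
  apply: (@runs_le _ _ _ _ 1); first by lia.
  apply: runs_skip; split => /=.
  + split => [x|b]; rewrite !inE !negb_or => H.
      move: H => /and3P[x3 x4 /negbTE] /= ->.
      by rewrite fn3 ?inE// fn2// fn1// inE.
    move: H => /and5P[b4 b5 b6 b7 /andP[b9 b10]] /=.
    by rewrite fc3 ?inE// fc2 ?inE// fc1 ?inE.
  + split => //=; rewrite ?fn3 ?fc3 ?fn2 ?fc2 ?fn1 ?fc1//.
  + by move=> k kj /=; rewrite fc3// x2// fc1.
  + by rewrite /= fc3.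
apply: (@runs_le _ _ _ _ (m * 10 + 5).+4.+2); first by lia.
apply: runs_setN_seq; apply: runs_setN_seq; apply: runs_setR_seq.
set s4 := set_cell _ _ _ _ _.
have Hin4 : inputs s4.
  have Hin3 : inputs s3 by apply: (@inputs_frame s2 _ [:: 3] [:: 5]).
  by case: Hin3 => Hn3 Hm3 HA3 Hx3 Hf3 Hs3; split.
have Hz4 : cell s4 8 0 0 = ratio_pow 10 by rewrite /= fc3// fc2// fc1.
have [s5 [t [g1 g2 [[fn5 fc5] v5 w5]]]] := runs_excess Hin4 Hz4.
exists s5, t; split => //.
have T4 : cell s4 7 0 0 = next_thr sigma scl (thr w).
  rewrite /= fc3// fc2// fc1// T fn3// fn2// fn1// HS /next_thr.
  by rewrite fc3// fc2// fc1// Hs /c3.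
have r4 : nreg s4 4 = (rem w - (pos w).+1)%N by rewrite /= r3.
have v5' (i : 'I_m) : cell s5 6 i 0 =
    if steering_range R n m (rem w - (pos w).+1)%N
    then excess (next_thr sigma scl (thr w)) (d i) else 0.
  by rewrite v5 r4 T4 /= d3.
split => /=.
+ split => [x|b]; rewrite !inE !negb_or => H.
    move: H => /and3P[x3 x4 x5]; rewrite fn5 ?inE//= (negbTE x4) (negbTE x5).
    by rewrite fn3 ?inE// fn2// fn1// inE.
  move: H => /and5P[b4 b5 b6 b7 /andP[b9 b10]] /=.
  rewrite fc5 ?inE ?negb_or ?b6//=; apply/funext => k; apply/funext => l.
  by rewrite (negbTE b7)/= fc3 ?inE// fc2 ?inE// fc1 ?inE.
+ split => //=.
  * by move=> i; rewrite fc5//= d3.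
  * by rewrite fc5// T4.
  * by rewrite fn5// r4.
  * by rewrite fn5.
  * by rewrite w5; apply: eq_bigr => i _; rewrite v5'.
+ by move=> k kj; rewrite fc5//= fc3// x2// fc1.
+ by rewrite fc5//= fc3.
Qed.

Definition is_output (x : 'cV[R]_n) : Prop :=
  is_rounding x0 x /\ forall i : 'I_m,
    \sum_(j < n) A i j * (x j 0 - x0 j 0) =
    disc (walk_after (enum 'I_n) (walk0 R m (size fcols))) i.

Lemma ceil_fractional (j : 'I_n) : fractional j ->
  fl j + 1 = (Num.ceil (x0 j 0))%:~R.
Proof.
rewrite /fractional /fl => h.
have : Num.ceil (x0 j 0) = Num.floor (x0 j 0) + 1.
  apply: ceil_def.
  by rewrite addrK h/= ltW// floorD1_gt.
by move=> ->; rewrite intrD.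
Qed.

Lemma runs_walk s : prepared s -> nreg s 8 = scl -> cell s 8 0 0 = ratio_pow 10 ->
  runs prog_walk s (fun s' => is_output (\col_(j < n) cell s' 4 j 0))
    (n * (m * 18 + 39) + 3).
Proof.
move=> [Hin X Rr L D V T W] HS Hz.
apply: (@runs_le _ _ _ _ (n * (m * 18 + 38).+1).+1.+2); first by lia.
apply: runs_setN_seq; set s1 := set_nreg _ _ _.
pose Wk j := walk_after (take j (enum 'I_n)) (walk0 R m (size fcols)).
pose Inv j s' := [/\ [/\ inputs s', nreg s' 2 = j, nreg s' 8 = scl
      & cell s' 8 0 0 = ratio_pow 10], tracks s' (Wk j),
   forall k : 'I_n, (j <= k)%N -> cell s' 4 k 0 = fl k,
   forall k : 'I_n, cell s' 4 k 0 = fl k \/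
     (fractional k /\ cell s' 4 k 0 = fl k + 1)
  & forall i, disc (Wk j) i =
     \sum_(k < n | (k < j)%N) A i k * (cell s' 4 k 0 - x0 k 0)].
have [|||s' [t [h1 h2 [h3 h4 h5 h6 h7]]]] := @runs_while R Inv n (m * 18 + 38)
  (BLeN (rj +n K 1) rn)
    (CIf nonint prog_column CSkip ;; CSetN 2 (rj +n K 1)) s1.
- by move=> j s' jn [[[Hn _ _ _ _ _] Hj _ _] _ _ _ _] /=; rewrite Hn Hj addn1.
- move=> j s' jn [[Hin' Hj HS' Hz'] tr Xj Xk dE].
  apply: (@runs_le _ _ _ _ (m * 18 + 37).+1); first by lia.
  apply: runs_if_seq; rewrite (fractionalE jn Hin' Hj).
  have WS : Wk j.+1 = if fractional (Ordinal jn) then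
      adv (Wk j) (frac (Ordinal jn)) (fun i => A i (Ordinal jn)) else Wk j.
    by rewrite /Wk /walk_after (take_enumS jn) foldl_rcons.
  have split_sum (F : 'I_n -> R) : \sum_(k < n | (k < j.+1)%N) F k =
      F (Ordinal jn) + \sum_(k < n | (k < j)%N) F k.
    rewrite (bigD1 (Ordinal jn))//=; congr (_ + _).
    by apply: eq_bigl => k; rewrite -val_eqE/=; lia.
  move: WS; case: ifP => fr WS.
    apply: (@runs_le _ _ _ _ ((m * 18 + 35) + 1).+1); first by lia.
    apply: runs_seq (runs_column Hin' Hj HS' Hz' (Xj (Ordinal jn) (leqnn j)) tr) _.
    move=> s2 [[fn fc] tr2 x2 xj2]; apply: runs_setN => /=.
    split => /=.
    + split => /=; rewrite ?fn// ?fc//.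
        have := inputs_frame (conj fn fc) isT isT Hin'.
        by case=> *; split.
      by rewrite Hj addn1.
    + rewrite WS; case: tr2 => *; split => //.
    + by move=> k jk; rewrite x2 ?Xj ?gtn_eqF// ltnW.
    + move=> k; have [kj|kj] := eqVneq (k : nat) j.
        have -> : k = Ordinal jn by exact/val_inj.
        rewrite xj2; case: (rounds_up _ _ _); first by right.
        by left; rewrite addr0.
      by rewrite x2.
    + move=> i; rewrite WS split_sum /= xj2 disc_advance dE addrC; congr (_ + _).
        by rewrite /frac opprB addrCA addrA.
      by apply: eq_bigr => k kj; rewrite x2// ltn_eqF.
  apply: (@runs_le _ _ _ _ 3); first by lia.
  apply: runs_skip_seq; apply: runs_setN => /=; split => /=.
  + split => //=; last by rewrite Hj addn1.
    by case: Hin' => *; split.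
  + by rewrite WS; case: tr => *; split.
  + by move=> k jk; apply: Xj; exact: ltnW.
  + exact: Xk.
  + move=> i; rewrite WS split_sum /= dE (Xj (Ordinal jn))//.
    (* An integral coordinate is its own floor, so the column that the walk skips adds nothing to
       the sum either. *)
    suff -> : fl (Ordinal jn) = x0 (Ordinal jn) 0 by rewrite subrr mulr0 add0r.
    move/negbT: fr; rewrite /fractional -leNgt => h; apply/le_anti; rewrite h andbT.
    exact: floor_le.
- split => //=.
  + split => //.
    by case: Hin => *; split.
  + rewrite /Wk take0 /=; split => //=.
    by rewrite big1// => i _; rewrite mulr0.
  + by move=> k; left.
  + by move=> i; rewrite /Wk take0 /= big_pred0.
exists s', t; split => //; split.
- move=> j; rewrite mxE; have [->|[fr ->]] := h6 j; first by left.
  by right; exact: ceil_fractional.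
- move=> i; rewrite /Wk take_oversize ?size_enum_ord// in h7.
  rewrite h7; apply: eq_big => [k|k _]; first by rewrite ltn_ord.
  by rewrite mxE.
Qed.

Definition time_bound : nat := n * 8 + (n * 4 + (n * n * 2 + n * (m * 18 + 39))) + 60.

Lemma runs_rounding_program :
  runs rounding_program (init (Instance sigma A x0))
    (fun s => is_output (output n s)) time_bound.
Proof.
apply: (@runs_le _ _ _ _ ((n * 8).+1 + ((n * 4 + 3) + ((n * n * 2).+1 +
  (45 + (n * (m * 18 + 39) + 3)).+1).+1).+1).+1); first by rewrite /time_bound; lia.
apply: runs_seq runs_floor _ => s1 [i1 [[a3 a5 a8] [b5 b6 b7 b9 b10]] x1 r1 L1].
have p1 : prepared s1 by split.
apply: runs_seq (runs_doublings p1 L1) _ => s2 [p2 L2 S2].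
rewrite a8 in S2.
apply: runs_seq (runs_root p2 L2 S2) _ => s3 [p3 S3].
apply: runs_seq (runs_power p3 S3) _ => s4 [p4 S4 z4].
exact: runs_walk.
Qed.

Lemma step_halted coin k (s : state R) : iter k (step coin) ([::], s) = ([::], s).
Proof. by elim: k => //= k ->. Qed.

(** A halted configuration is a fixed point of [step], so any two halting times give the same state;
    by [run_toss_free] the coins do not matter. *)
Lemma rounding_program_spec : exists x, is_output x /\
  forall coin y, outputs rounding_program (Instance sigma A x0) coin y <-> y = x.
Proof.
have [s [t [h1 h2 h3]]] := runs_rounding_program.
exists (output n s); split => // coin y; split.
- move=> [t' [s' [rE <-]]]; rewrite run_toss_free// /run in rE.
  have := h1 [::]; have [tt|/ltnW tt] := leqP t t'.
    by rewrite -(subnK tt) iterD h1 step_halted in rE; case: rE => ->.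
  by rewrite -(subnK tt) iterD rE step_halted => -[->].
- move=> ->; exists t, s; split => //; rewrite run_toss_free// /run.
  exact: h1.
Qed.

(** As a random variable the time is constant, which settles measurability and expectation at
    once. *)
Lemma rounding_program_time : exists tau : \bar R,
  (forall coin, running_time rounding_program (Instance sigma A x0) coin = tau) /\
  (0 <= tau <= time_bound%:R%:E)%E.
Proof.
have [s [t [h1 h2 h3]]] := runs_rounding_program.
exists (running_time rounding_program (Instance sigma A x0) (fun=> true)); split.
  move=> coin; rewrite /running_time; congr ereal_inf.
  by apply/seteqP; split => _ [k /= hk <-]; exists k => //=; move: hk;
    rewrite !(run_toss_free (prog := rounding_program))//.
apply/andP; split.
  by apply: le_ereal_inf_tmp => _ [k _ <-]; rewrite lee_fin.
apply: (@le_trans _ _ (t%:R%:E)); last by rewrite lee_fin ler_nat.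
by apply: ereal_inf_lbound; exists t => //=; rewrite /run h1.
Qed.

End Correctness.
End Program.

(** * From single phases to the probability bound *)

Lemma thr_atE (R : realType) (sigma : R) scale k :
  thr_at sigma scale k = 64 * (sigma * scale%:R) * (1 - (3 / 4) ^+ k).
Proof.
elim: k => [|k IH]; first by rewrite expr0 subrr mulr0.
by rewrite /thr_at iterS -/(thr_at sigma scale k) IH /next_thr exprS; field.
Qed.

Lemma thr_at_step (R : realType) (sigma : R) scale k :
  thr_at sigma scale k.+1 - thr_at sigma scale k =
  16 * (sigma * scale%:R) * (3 / 4) ^+ k.
Proof. by rewrite !thr_atE exprS; field. Qed.

Lemma thr_at_bounds (R : realType) (sigma : R) scale k : 0 <= sigma ->
  0 <= thr_at sigma scale k <= 64 * (sigma * scale%:R).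
Proof.
move=> s0; rewrite thr_atE.
have S0 : 0 <= 64 * (sigma * scale%:R) by rewrite !mulr_ge0.
have q0 : 0 <= (3 / 4) ^+ k :> R by rewrite exprn_ge0.
have q1 : (3 / 4) ^+ k <= 1 :> R by rewrite exprn_ile1//; lra.
by rewrite mulr_ge0 ?subr_ge0//= -[leRHS]mulr1 ler_wpM2l// gerBl.
Qed.

Lemma steering_range_mono (R : realType) n m r r' : (r <= r')%N ->
  steering_range R n m r -> steering_range R n m r'.
Proof.
move=> rr /andP[nr c]; rewrite /steering_range c andbT.
by apply: leq_trans nr _; exact: leq_mul.
Qed.

(** [K] is the first inactive phase. It comes by [size js] at the latest, as a nonempty phase uses
    up a column, and activity is monotone in the number of columns. *)
Lemma last_phase (R : realType) n m (js : seq 'I_n) : exists K,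
  [/\ (K <= size js)%N,
      forall l, (l < K)%N -> steering_range R n m (size (rest js l))
    & forall r, (r <= size (rest js K))%N -> ~~ steering_range R n m r].
Proof.
have exK : exists k, ~~ steering_range R n m (size (rest js k)).
  exists (size js); have := size_rest_sub js (size js); rewrite subnn leqn0.
  by move/eqP => ->; rewrite /steering_range.
case: (ex_minnP exK) => K nK Kmin; exists K; split.
- apply: Kmin; have := size_rest_sub js (size js); rewrite subnn leqn0.
  by move/eqP => ->; rewrite /steering_range.
- move=> l lK; apply/negPn/negP => /Kmin; lia.
- by move=> r rK; apply: contra nK; exact: steering_range_mono.
Qed.

Lemma expRN_ln (R : realType) (m k : nat) : (0 < m)%N ->
  expR (- (k%:R * ln m%:R)) = (m%:R ^+ k)^-1 :> R.
Proof. by move=> m0; rewrite expRN expRM_natl lnK// posrE ltr0n. Qed.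

Section Discrepancy.
Context (d : measure_display) (T : measurableType d) (R : realType).
Variables (P : probability T R) (m n : nat) (X : 'I_m * 'I_n -> {RV P >-> R}).
Variables (sigma : R) (f : 'I_n -> R) (js : seq 'I_n).
Hypotheses (sigma_gt0 : 0 < sigma) (indepX : independent_family X).
Hypothesis gaussX : forall i, gaussian 0 sigma (X i).
Hypothesis f01 : forall j, 0 <= f j <= 1.
Hypothesis ujs : uniq js.
Hypotheses (n_gt0 : (0 < n)%N) (mn : (2 * n <= m)%N).
Notation scale := (root_ceil (n * doublings m n_gt0)).
Notation active := (steering_range R n m).
Notation dat w K i := (disc_at sigma f scale js (entries X w) K i).
Notation rst w K i := (\sum_(j <- rest js K) entries X w j i * - f j).
Notation ell := (ln (m%:R / n%:R) : R).

Let m_gt0 : (0 < m)%N. Proof. lia. Qed.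
Let mR : 0 < m%:R :> R. Proof. by rewrite ltr0n. Qed.
Let nR : 0 < n%:R :> R. Proof. by rewrite ltr0n. Qed.
Let size_js : (size js <= n)%N.
Proof. by rewrite -(card_uniqP ujs) -[leqRHS]card_ord max_card. Qed.

Lemma floors_failure : (m%:R <= (m%:R / n%:R) ^+ (2 ^ 10) :> R) ->
  (P [set w | [exists i : 'I_m, (rounding_bound n m sigma <
      `|\sum_(j <- js) entries X w j i * - f j|)%R]] <= (4 / m%:R ^+ 3)%:E)%E.
Proof.
move=> far.
have l2 := ell_ge R n_gt0 mn.
have nl0 : 0 <= n%:R * ell by rewrite mulr_ge0//; lra.
(* 100^2 / 2 = 5000 exceeds 4 times 1024, so ln m <= 1024 ell makes the tail at most 2 m m^-4. *)
pose y := 100 * (sigma * Num.sqrt (n%:R * ell)).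
have y0 : 0 <= y by rewrite !mulr_ge0 ?sqrtr_ge0// ltW.
have sn : (size js)%:R <= n%:R :> R by rewrite ler_nat.
have H := floors_tail sigma_gt0 indepX gaussX f01 ujs y0 nR sn.
have mex (b : R) : measurable [set w | [exists i : 'I_m,
    (b < `|\sum_(j <- js) entries X w j i * - f j|)%R]].
  apply: measurable_bool_set; apply: measurable_exists_ord => i.
  apply: measurable_fun_ltr => //; apply: measurableT_comp => //.
  by apply: measurable_sum => j; apply: measurable_funM.
apply: (@le_trans _ _ (P [set w | [exists i : 'I_m,
    (y < `|\sum_(j <- js) entries X w j i * - f j|)%R]])).
  apply: le_measure; rewrite ?inE// => w /= /existsP[i hi]; apply/existsP; exists i.
  apply: le_lt_trans hi; apply: le_trans (rounding_bound_ge n m sigma_gt0).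
  by rewrite /y ler_wpM2r ?ler_nat// mulr_ge0 ?sqrtr_ge0// ltW.
apply: (le_trans H); rewrite lee_fin.
have -> : y ^+ 2 / (2 * sigma ^+ 2 * n%:R) = 5000 * ell.
  rewrite /y !exprMn sqr_sqrtr//; field; rewrite !gt_eqF//.
have t1 : 4%:R * ln m%:R <= 5000 * ell.
  have mn0 : 0 < m%:R / n%:R :> R by rewrite divr_gt0.
  move: far; rewrite -ler_ln ?posrE ?exprn_gt0// lnXn// -[ln (m%:R / n%:R) *+ _]mulr_natr.
  have -> : (2 ^ 10)%:R = 1024 :> R by rewrite natrX; lra.
  lra.
apply: (@le_trans _ _ (2 * m%:R * expR (- (4%:R * ln m%:R)))).
  by rewrite ler_wpM2l ?mulr_ge0// ler_expR lerN2.
rewrite expRN_ln// (_ : 2 * m%:R * (m%:R ^+ 4)^-1 = 2 / m%:R ^+ 3); last first.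
  by field; rewrite gt_eqF.
by rewrite ler_wpM2r ?invr_ge0 ?exprn_ge0// ler_nat.
Qed.

Lemma phases_failure K : (m%:R / n%:R) ^+ (2 ^ 10) < m%:R :> R ->
  (K <= size js)%N ->
  (forall l, (l < K)%N -> active (size (rest js l))) ->
  ~~ active (size (rest js K)) ->
  (P [set w | [exists i : 'I_m, (rounding_bound n m sigma <
      `|dat w K i + rst w K i|)%R]] <= (4 / m%:R ^+ 3)%:E)%E.
Proof.
move=> close Kjs act nact.
have t512 := ln_m_ge n_gt0 mn close; have rt := sqrt_n_ge n_gt0 mn close.
set t := ln m%:R in t512 rt; set rho : R := Num.sqrt n%:R in rt.
have rho2 : rho ^+ 2 = n%:R by rewrite sqr_sqrtr// ltW.
have rho0 : 0 < rho by rewrite sqrtr_gt0.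
have p19 : 2 ^+ 16 * (8 * t) <= rho.
  apply: le_trans rt; rewrite mulrA ler_pM2r; last lra.
  by rewrite (exprD _ 16 3) ler_pM2l ?exprn_gt0//; lra.
have p16 : 8 * t <= rho / 2 ^+ 16 by rewrite ler_pdivlMr ?exprn_gt0// mulrC.
have p0 : 8 * t <= rho.
  apply: le_trans p16 _; rewrite ler_pdivrMr ?exprn_gt0// ler_peMr ?(ltW rho0)//.
  by apply: exprn_ege1; rewrite ler1n.
have big l : (l < K)%N -> rho < (size (rest js l))%:R.
  move=> /act/andP[nl _]; rewrite -(@ltr_pXn2r _ 2%N)// ?nnegrE ?(ltW rho0)//.
  by rewrite rho2 expr2 -natrM ltr_nat.
have small : (size (rest js K))%:R <= rho.
  move: nact; rewrite /steering_range close andbT -leqNgt => h.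
  rewrite -(@ler_pXn2r _ 2%N)// ?nnegrE ?(ltW rho0)//.
  by rewrite rho2 expr2 -natrM ler_nat.
have hK k : (k < K)%N -> [/\ (100 <= size (rest js k))%N,
    0 <= thr_at sigma scale k <= thr_at sigma scale k.+1 &
    expR (2 * expR (- (3 / 32 / (sigma ^+ 2 * (size (rest js k))%:R) *
      (thr_at sigma scale k.+1 - thr_at sigma scale k) ^+ 2)) * m%:R
      - 3 / 2 ^+ 17 * (size (rest js k))%:R) <= expR (- (5%:R * t))].
  move=> kK; have bk := big k kK.
  have r100 : (100 <= size (rest js k))%N.
    by rewrite -(ler_nat R); apply: le_trans (ltW bk); lra.
  split => //.
    have /andP[-> _] := thr_at_bounds scale k (ltW sigma_gt0).
    rewrite -subr_ge0 thr_at_step !mulr_ge0 ?exprn_ge0//; exact: ltW.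
  rewrite thr_at_step.
  apply: (@phase_failure_bound R n (size (rest js k)) (doublings m n_gt0) scale k m) => //.
  - exact: leq_trans r100.
  - exact: leq_trans (size_rest_exp js k) size_js.
  - exact: root_ceil_ge.
  - exact: doublings_ge.
  - exact: doublings_gt0.
  - apply: (@le_trans _ _ (rho / 2 ^+ 16)); first lra.
    by rewrite ler_pM2r ?invr_gt0 ?exprn_gt0// ltW.
have Hov := overflow_chain sigma_gt0 indepX gaussX f01 ujs (expR_ge0 _) hK.
(* With at most [rho] columns left, this deviation has the exponent rho / 2 >= 4 ln m. *)
pose y := sigma * rho; have y0 : 0 <= y by rewrite mulr_ge0 ?ltW.
have Hfl := floors_tail sigma_gt0 indepX gaussX f01 (uniq_rest ujs K) y0 rho0 small.
have mD i : measurable_fun setT (fun w => dat w K i).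
  exact: measurable_disc_at_entries.
have mr i : measurable_fun setT (fun w => rst w K i).
  by apply: measurable_sum => j; apply: measurable_funM.
have mov : measurable [set w | overflow sigma scale js K (fun i => dat w K i)].
  apply: measurable_bool_set.
  exact: (@measurable_overflow R m n sigma scale js _ T K (fun i w => dat w K i)).
have mfl : measurable [set w | [exists i : 'I_m, (y < `|rst w K i|)%R]].
  apply: measurable_bool_set; apply: measurable_exists_ord => i.
  by apply: measurable_fun_ltr => //; apply: measurableT_comp.
apply: (@le_trans _ _ (P ([set w | overflow sigma scale js K (fun i => dat w K i)] `|`
    [set w | [exists i : 'I_m, (y < `|rst w K i|)%R]]))).
  apply: le_measure; rewrite ?inE.
  - apply: measurable_bool_set; apply: measurable_exists_ord => i.
    apply: measurable_fun_ltr => //; apply: measurableT_comp => //.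
    exact: measurable_funD.
  - exact: measurableU.
  - move=> w /= /existsP[i hi].
    case: (boolP (overflow sigma scale js K (fun i => dat w K i))) => ov; first by left.
    right; apply/existsP; exists i; rewrite ltNge; apply/negP => hy.
    have /andP[t0 tS] := thr_at_bounds scale K (ltW sigma_gt0).
    have := disc_bound sigma_gt0 t0 ov hy.
    apply/negP; rewrite -ltNge; apply: le_lt_trans hi.
    apply: le_trans (rounding_bound_ge n m sigma_gt0).
    have h1 : sigma * (size (rest js K))%:R <= sigma * rho by rewrite ler_pM2l.
    have h2 : sigma * scale%:R <= sigma * (4 * Num.sqrt (n%:R * ell)).
      by rewrite ler_pM2l//; exact: scale_le_sqrt.
    have h3 : sigma * rho <= sigma * (2 * Num.sqrt (n%:R * ell)).
      by rewrite ler_pM2l//; exact: sqrt_n_le.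
    (* In units of [sigma * q], the threshold costs 64 times 4, the excess 2/8 and the remaining
       columns 2: together 258.25, below 480. *)
    rewrite /y; set q := Num.sqrt _ in h2 h3 *.
    have q0 : 0 <= sigma * q by rewrite mulr_ge0 ?sqrtr_ge0// ltW.
    move: h2 h3; rewrite [sigma * (4 * q)]mulrCA [sigma * (2 * q)]mulrCA => h2 h3.
    lra.
apply: (le_trans (measureU2 _ mov mfl)).
apply: (@le_trans _ _ ((K%:R * expR (- (5%:R * t)))%:E +
   (2 * m%:R * expR (- (y ^+ 2 / (2 * sigma ^+ 2 * rho))))%:E)%E).
  exact: leeD.
rewrite -EFinD lee_fin.
have yE : y ^+ 2 / (2 * sigma ^+ 2 * rho) = rho / 2.
  by rewrite /y; field; rewrite !gt_eqF.
rewrite yE.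
have m1 : 1 <= m%:R :> R by rewrite ler1n.
(* The phases cost at most m^-3, since [K <= m] and each fails with probability at most m^-5; the
   remaining columns cost 2 m^-3. *)
have a1 : K%:R * expR (- (5%:R * t)) <= 1 / m%:R ^+ 3.
  apply: (@le_trans _ _ (m%:R * expR (- (4%:R * t) - t))).
    apply: ler_pM => //; rewrite ?expR_ge0// ?ler_nat; last by rewrite ler_expR; lra.
    apply: leq_trans Kjs (leq_trans size_js _).
    exact: leq_trans (leq_pmull n (isT : 0 < 2)%N) mn.
  rewrite expRD [expR (- t)]expRN lnK ?posrE// mulrC -mulrA mulVf ?gt_eqF// mulr1.
  rewrite expRN_ln// div1r lef_pV2 ?posrE ?exprn_gt0//.
  exact: ler_weXn2l.
have a2 : 2 * m%:R * expR (- (rho / 2)) <= 2 / m%:R ^+ 3.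
  apply: (@le_trans _ _ (2 * m%:R * expR (- (4%:R * t)))).
    by rewrite ler_wpM2l ?mulr_ge0// ler_expR lerN2; lra.
  rewrite expRN_ln// le_eqVlt; apply/predU1P; left.
  by field; rewrite gt_eqF.
have a3 : 0 <= 1 / m%:R ^+ 3 :> R by rewrite divr_ge0 ?exprn_ge0.
have -> : 4 / m%:R ^+ 3 = 4 * (1 / m%:R ^+ 3) :> R by rewrite mul1r.
have a4 : 2 / m%:R ^+ 3 = 2 * (1 / m%:R ^+ 3) :> R by rewrite mul1r.
rewrite a4 in a2; lra.
Qed.

Lemma walk_discrepancy :
  let good := [set w | forall i : 'I_m,
    `|disc (walk_cols sigma f scale active (entries X w) (walk0 R m (size js)) js) i|
      <= rounding_bound n m sigma] in
  measurable good /\ ((1 - 4 / m%:R ^+ 3)%:E <= P good)%E.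
Proof.
move=> good; have [K [Kjs act nact]] := last_phase R m js.
pose bad := [set w | [exists i : 'I_m, (rounding_bound n m sigma <
      `|dat w K i + rst w K i|)%R]].
have goodE : good = ~` bad.
  have act0 : ~~ active 0 by rewrite /steering_range.
  apply/seteqP; split => w /=; rewrite /good /bad /=.
    move=> h; apply/negP; rewrite negb_exists; apply/forallP => i; rewrite -leNgt.
    by have := h i; rewrite (disc_walk_cols _ _ _ act0 _ _ act nact).
  move=> /negP; rewrite negb_exists => /forallP h i; have := h i; rewrite -leNgt.
  by rewrite (disc_walk_cols _ _ _ act0 _ _ act nact).
have mbad : measurable bad.
  apply: measurable_bool_set; apply: measurable_exists_ord => i.
  apply: measurable_fun_ltr => //; apply: measurableT_comp => //.
  apply: measurable_funD; first exact: measurable_disc_at_entries.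
  by apply: measurable_sum => j; apply: measurable_funM.
rewrite goodE; split; first exact: measurableC.
have Pbad : (P bad <= (4 / m%:R ^+ 3)%:E)%E.
  have [far|close] := leP (m%:R : R) ((m%:R / n%:R) ^+ (2 ^ 10)).
    have K0 : K = 0%N.
      case: K Kjs act {nact bad goodE mbad} => [//|K] _ /(_ 0%N isT).
      by rewrite /steering_range ltNge far andbF.
    apply: le_trans (floors_failure far); rewrite /bad K0 /=.
    by under eq_set do under eq_existsb do rewrite add0r.
  by apply: phases_failure => //; exact: nact.
rewrite probability_setC// EFinB; exact: leeB.
Qed.

End Discrepancy.

Lemma walk_after_cols (R : realType) n m (sigma : R) (A : 'M[R]_(m, n))
    (x0 : 'cV[R]_n) (n_gt0 : (0 < n)%N) js (w : walk R m) :
  walk_after sigma A x0 n_gt0 js w =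
  walk_cols sigma (frac x0) (root_ceil (n * doublings m n_gt0))
    (steering_range R n m) (fun j i => A i j) w [seq j <- js | fractional x0 j].
Proof.
rewrite /walk_after /walk_cols; elim: js w => [//|j js IH] w /=.
by rewrite IH; case: ifP.
Qed.

Lemma frac_itv (R : realType) n (x0 : 'cV[R]_n) j : 0 <= frac x0 j <= 1.
Proof.
rewrite /frac subr_ge0 floor_le/= lerBlDl.
by apply: ltW; have := floorD1_gt (x0 j 0); rewrite intrD.
Qed.

Lemma mutually_independent_family d (T : measurableType d) (R : realType)
    (P : probability T R) (I : finType) (J : eqType) (X : I -> {RV P >-> R})
    (F : I + J -> set (set T)) :
  (forall i, F (inl i) = sigma_of (X i)) -> mutually_independent P F ->
  independent_family X.
Proof.
move=> FX indF E mE.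
pose E' (a : I + J) := if a is inl i then X i @^-1` E i else setT.
have := indF [seq inl i | i <- index_enum I] E'.
rewrite !big_map; apply; first by rewrite map_inj_uniq ?index_enum_uniq// => ? ? [].
by move=> _ /mapP[i _ ->]; rewrite FX; exists (E i) => //; rewrite setTI.
Qed.

(* The outer variable stands for n and the inner one for m. *)
Definition time_poly (R : realType) : {poly {poly R}} :=
  'X * 8%:R + ('X * 4%:R + ('X * 'X * 2%:R +
    'X * (('X)%:P * 18%:R + 39%:R))) + 60%:R.

Lemma time_polyE (R : realType) n m :
  (time_poly R).[n%:R].[m%:R] = (time_bound n m)%:R.
Proof.
have h1 k (x : {poly R}) : (k%:R : {poly {poly R}}).[x] = k%:R.
  by rewrite hornerMn hornerC.
have h2 k (x : R) : (k%:R : {poly R}).[x] = k%:R by rewrite hornerMn hornerC.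
rewrite /time_poly /time_bound.
do ! rewrite ?hornerD ?hornerM ?hornerX ?hornerC ?h1 ?h2.
by rewrite !natrD !natrM !natrD !natrM.
Qed.

Theorem theorem2 (R : realType) :
  exists (prog : cmd) (q : {poly {poly R}}),
  forall (n m : nat) (sigma : R),
    (0 < n)%N -> (2 * n <= m)%N -> (m <= 2 ^ n)%N -> 0 < sigma ->
  [/\ forall (A : 'M[R]_(m, n)) (x0 x : 'cV[R]_n) (coin : nat -> bool),
        outputs prog (Instance sigma A x0) coin x -> is_rounding x0 x,
      forall (d : measure_display) (T : measurableType d)
          (P : probability T R)
          (A : 'I_m -> 'I_n -> {RV P >-> R}) (coin : nat -> {RV P >-> bool}),
        (forall i j, gaussian 0 sigma (A i j)) ->
        (forall k, fair (coin k)) ->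
        mutually_independent P
          (fun a : ('I_m * 'I_n) + nat =>
             match a with
             | inl ij => sigma_of (A ij.1 ij.2)
             | inr k => sigma_of (coin k)
             end) ->
        forall x0 : 'cV[R]_n,
        let good := [set w : T | exists x : 'cV[R]_n,
          outputs prog (Instance sigma (\matrix_(i, j) A i j w) x0)
            (fun k => coin k w) x /\
          forall i : 'I_m,
            `|\sum_(j < n) A i j w * (x j 0 - x0 j 0)|
              <= rounding_bound n m sigma] in
        measurable good /\ ((1 - 4 / m%:R ^+ 3)%:E <= P good)%E
    & forall (d : measure_display) (T : measurableType d)
          (P : probability T R) (coin : nat -> {RV P >-> bool}),
        (forall k, fair (coin k)) ->
        mutually_independent P (fun k => sigma_of (coin k)) ->
        forall (A : 'M[R]_(m, n)) (x0 : 'cV[R]_n),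
        let time := fun w : T =>
          running_time prog (Instance sigma A x0) (fun k => coin k w) in
        measurable_fun setT time /\
        (\int[P]_w time w <= (q.[n%:R].[m%:R])%:E)%E].
Proof.
exists rounding_program, (time_poly R) => n m sigma n_gt0 mn m_le s0; split.
- move=> A x0 x coin; have [y [[yr _] out]] := rounding_program_spec sigma A x0 n_gt0 m_le.
  by move/out => ->.
- move=> d T P A coin gA _ indA x0 good.
  pose X (e : 'I_m * 'I_n) := A e.1 e.2.
  have indX : independent_family X.
    by apply: (mutually_independent_family (J := nat)) indA.
  have gX e : gaussian 0 sigma (X e) by exact: gA.
  have [mgood Pgood] := walk_discrepancy s0 indX gX (frac_itv x0)
    (filter_uniq (fractional x0) (enum_uniq 'I_n)) n_gt0 mn.
  (* The output exists and is unique, so asking for a good output is a condition on the walk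
     alone. *)
  suff -> : good = [set w | forall i : 'I_m,
    `|disc (walk_cols sigma (frac x0) (root_ceil (n * doublings m n_gt0))
       (steering_range R n m) (entries X w) (walk0 R m (size (fcols x0))) (fcols x0)) i|
      <= rounding_bound n m sigma] by [].
  apply/funext => w; rewrite /good/=.
  have [y [[_ yd] out]] :=
    rounding_program_spec sigma (\matrix_(i, j) A i j w) x0 n_gt0 m_le.
  have E : (fun j i => (\matrix_(i, j) A i j w) i j) = entries X w.
    by apply/funext => j; apply/funext => i; rewrite mxE.
  have {}yd i : \sum_(j < n) A i j w * (y j 0 - x0 j 0) =
      disc (walk_cols sigma (frac x0) (root_ceil (n * doublings m n_gt0))
       (steering_range R n m) (entries X w) (walk0 R m (size (fcols x0))) (fcols x0)) i.
    transitivity (\sum_(j < n) (\matrix_(i, j) A i j w) i j * (y j 0 - x0 j 0)).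
      by apply: eq_bigr => j _; rewrite mxE.
    by rewrite yd walk_after_cols E.
  apply/propext; split => [[x [/out -> h]] i|h]; first by rewrite -yd.
  by exists y; split => [|i]; [exact/out|rewrite yd].
- move=> d T P coin _ _ A x0 time.
  have [tau [tauE /andP[tau0 tauB]]] := rounding_program_time sigma A x0 n_gt0 m_le.
  have timeE : time = cst tau by apply/funext => w; exact: tauE.
  rewrite timeE; split; first exact: measurable_cst.
  rewrite integral_cst//= probability_setT mule1 time_polyE; exact: tauB.
Qed.
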